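(* Let $k$ be an algebraically closed field of characteristic $5$, let $\Gamma\subset\mathbb{P}^2$ be a $k$-Hermitian curve, let $\mathcal{Q}$ be the set of non-singular conics totally tangent to $\Gamma$, and let $\mathcal{D}$ be the set of connected components of the graph $G$ on $\mathcal{Q}$. Suppose that $D,D'\in\mathcal{D}$ are distinct, and hence disjoint as subsets of $\mathcal{Q}$. Then one of the following holds, where $t(Q,D')$ is the type of $(Q,D')$: $(\beta^{21})$ $t(Q,D')=\beta$ for all $Q\in D$. $(\gamma^{21})$ $t(Q,D')=\gamma$ for all $Q\in D$. $(\alpha^{15}\gamma^{6})$ $t(Q,D')=\alpha$ for $15$ conics $Q\in D$, and $t(Q,D')=\gamma$ for $6$ conics $Q\in D$. $(\alpha^{3}\gamma^{18})$ $t(Q,D')=\alpha$ for $3$ conics $Q\in D$, and $t(Q,D')=\gamma$ for $18$ conics $Q\in D$.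
   Context: Work over an algebraically closed field $k$ of characteristic $5$. A $k$-Hermitian curve is a projective plane curve $\Gamma\subset\mathbb{P}^2$ of degree $6$ that is projectively isomorphic (via $\mathrm{PGL}_3(k)$) to the Fermat curve $\Gamma_5: x^6+y^6+z^6=0$. $\mathcal{P}$ denotes the set of Weierstrass points of $\Gamma$; equivalently, the set of points $P\in\Gamma$ whose tangent line meets $\Gamma$ at $P$ with intersection multiplicity $6$ (for $\Gamma=\Gamma_5$, the $\mathbb{F}_{25}$-rational points). One has $|\mathcal{P}|=126$. A line of $\mathbb{P}^2$ is a special secant line of $\Gamma$ if it passes through two distinct points of $\mathcal{P}$. A non-singular conic $Q\subset\mathbb{P}^2$ is totally tangent to $\Gamma$ if $Q$ meets $\Gamma$ at six distinct points, each with intersection multiplicity $2$. $\mathcal{Q}$ denotes the set of all such conics; one has $|\mathcal{Q}|=3150$ and $Q\cap\Gamma\subset\mathcal{P}$ for $Q\in\mathcal{Q}$. For $Q\in\mathcal{Q}$, $\mathcal{S}(Q)$ is the set of the $15$ special secant lines of $\Gamma$ passing through two distinct points of $Q\cap\Gamma$. $G$ is the graph with vertex set $\mathcal{Q}$ in which distinct $Q,Q'$ are adjacent if and only if $|Q\cap Q'|=4$ and $|\mathcal{S}(Q)\cap\mathcal{S}(Q')|=3$. $\mathcal{D}$ is the set of connected components of $G$ (there are $150$ of them); each $D\in\mathcal{D}$ is regarded as a subset of $\mathcal{Q}$, consisting of $21$ conics. For $Q\in\mathcal{Q}$ and $D'\in\mathcal{D}$ with $Q\notin D'$, the type $t(Q,D')\in\{\alpha,\beta,\gamma\}$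 is defined by the values of $|Q\cap Q'\cap\Gamma|$ as $Q'$ runs over the $21$ conics of $D'$: $t(Q,D')=\alpha$ if the value is $2$ for $3$ conics and $0$ for $18$; $t(Q,D')=\beta$ if it is $2$ for $1$ conic, $1$ for $4$ conics and $0$ for $16$; $t(Q,D')=\gamma$ if it is $1$ for $6$ conics and $0$ for $15$. (One of these three cases always occurs.) *)

(* Defs.v *)
From HB Require Import structures.
From Stdlib Require Import Relation_Operators.
From mathcomp Require Import all_boot all_order all_algebra.
From mathcomp Require Import all_classical.
From mathcomp Require Import mpoly.

Set Implicit Arguments.
Unset Strict Implicit.
Unset Printing Implicit Defensive.

Import GRing.Theory.

Local Open Scope classical_set_scope.
Local Open Scope card_scope.
Local Open Scope ring_scope.

Definition projspace (k : fieldType) (V : vectType k) :=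
  {U : {vspace V} | \dim U == 1%N}.

Section PlaneCurves.
Variable k : fieldType.

Definition proj_point := projspace 'rV[k]_3.

(* A plane curve of degree d is a nonzero form of degree d up to a scalar, so
   multiplicities of components are part of the data. *)
Definition curve (d : nat) := projspace (dhomog 3 k d).

Definition forms d (C : curve d) : set {mpoly k[3]} :=
  [set f | exists2 h : dhomog 3 k d, h \in val C & f = h :> {mpoly k[3]}].

Definition pts d (C : curve d) : set proj_point :=
  [set P : proj_point |
    forall f (v : 'rV[k]_3), forms C f -> v \in val P -> f.@[v 0] = 0].

Definition nonsingular d (C : curve d) :=
  forall P, pts C P ->
  exists f (v : 'rV[k]_3) i,
    [/\ forms C f, v \in val P & (f^`M(i)).@[v 0] != 0].

(* The form [sum_i (df/dX_i)(v) X_i] vanishes identically at singular points,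
   where every line is therefore tangent. *)
Definition tangent_line d (C : curve d) (P : proj_point) (L : curve 1) :=
  pts C P /\
  forall f (v : 'rV[k]_3), forms C f -> v \in val P ->
    forms L (\sum_(i < 3) (f^`M(i)).@[v 0] *: 'X_i).

Definition proj_isomorphic d (C C' : curve d) :=
  exists2 g : 'M[k]_3, g \in unitmx &
    forms C' = [set f \mPo [tuple \sum_(j < 3) g i j *: 'X_j | i < 3]
               | f in forms C].

(* Fractions a / b with a in I, where a and b are forms of the same degree
   and b does not vanish at P. *)
Definition fractions_at (P : proj_point) (I : set {mpoly k[3]}) :
    set {fraction {mpoly k[3]}} :=
  [set h | exists a b d,
    [/\ I a, a \is d.-homog, b \is d.-homog,
        exists2 v : 'rV[k]_3, v \in val P & b.@[v 0] != 0
      & h = tofrac a / tofrac b]].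

Definition local_ring (P : proj_point) := fractions_at P setT.

Definition local_ideal (P : proj_point) d e (C : curve d) (C' : curve e) :=
  fractions_at P
    [set a | exists u f w g, [/\ forms C f, forms C' g & a = u * f + w * g]].

(* The k-vector space local_ring P / local_ideal P C C' has dimension m. *)
Definition intersection_multiplicity (P : proj_point) d e
    (C : curve d) (C' : curve e) (m : nat) :=
  exists2 b : 'I_m -> {fraction {mpoly k[3]}}, (forall i, local_ring P (b i)) &
    forall h, local_ring P h ->
      exists! c : 'rV[k]_m,
        local_ideal P C C' (h - \sum_(i < m) tofrac (c 0 i)%:MP * b i).

Definition fermat_form : {mpoly k[3]} := \sum_(i < 3) 'X_i ^+ 6.

Lemma fermat_homog : fermat_form \is 6.-homog.
Proof.
apply: rpred_sum => i _; have Xi1 : 'X_i \is [in k[3], 1.-homog].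
  by rewrite dhomogX; apply/eqP; exact: mdeg1.
exact: (dhomogMn 6 Xi1).
Qed.

Definition fermat_dhomog : dhomog 3 k 6 := DHomog fermat_homog.

Lemma fermat_dim : \dim <[fermat_dhomog]>%VS == 1%N.
Proof.
rewrite dim_vline; suff -> : fermat_dhomog != 0 by [].
apply/eqP => /(congr1 (@mpoly_of_dhomog _ _ _)) /=.
move=> /(congr1 (mcoeff (U_(0%R) *+ 6)%MM)).
rewrite /fermat_form !big_ord_recl big_ord0 addr0 !mcoeffD !mpolyXn !mcoeffX.
rewrite mcoeff0 eqxx.
do 2![case: eqP => [/mnmP/(_ 0%R)|_]; first by rewrite !mulmnE !mnm1E].
by move=> /eqP; rewrite !addr0 oner_eq0.
Qed.

Definition fermat_curve : curve 6 := Sub <[fermat_dhomog]>%VS fermat_dim.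

End PlaneCurves.

Section HermitianCurve.
Variables (k : fieldType) (Gamma : curve k 6).

Definition hermitian_curve := proj_isomorphic (fermat_curve k) Gamma.

Definition weierstrass : set (proj_point k) :=
  [set P | exists2 L, tangent_line Gamma P L
                    & intersection_multiplicity P L Gamma 6].

Definition special_secant : set (curve k 1) :=
  [set L | exists P P', [/\ weierstrass P, weierstrass P', P <> P',
                           pts L P & pts L P']].

Definition totally_tangent (Q : curve k 2) :=
  pts Q `&` pts Gamma #= `I_6 /\
  forall P, (pts Q `&` pts Gamma) P -> intersection_multiplicity P Q Gamma 2.

Definition tangent_conics : set (curve k 2) :=
  [set Q | nonsingular Q /\ totally_tangent Q].

Definition secants (Q : curve k 2) : set (curve k 1) :=
  [set L | special_secant L /\
     exists P P', [/\ (pts Q `&` pts Gamma) P, (pts Q `&` pts Gamma) P',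
                      P <> P', pts L P & pts L P']].

Definition adjacent (Q Q' : curve k 2) : Prop :=
  [/\ tangent_conics Q, tangent_conics Q', Q <> Q',
      pts Q `&` pts Q' #= `I_4 & secants Q `&` secants Q' #= `I_3].

Definition component (Q : curve k 2) : set (curve k 2) :=
  [set Q' | clos_refl_trans (curve k 2) adjacent Q Q'].

Definition components : set (set (curve k 2)) :=
  [set component Q | Q in tangent_conics].

Inductive pair_type := type_alpha | type_beta | type_gamma.

Definition meeting (Q : curve k 2) (D : set (curve k 2)) (m : nat) :
    set (curve k 2) :=
  [set Q' | D Q' /\ pts Q `&` pts Q' `&` pts Gamma #= `I_m].

Definition has_type (Q : curve k 2) (D : set (curve k 2)) (t : pair_type) :=
  match t with
  | type_alpha => meeting Q D 2 #= `I_3 /\ meeting Q D 0 #= `I_18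
  | type_beta => [/\ meeting Q D 2 #= `I_1, meeting Q D 1 #= `I_4
              & meeting Q D 0 #= `I_16]
  | type_gamma => meeting Q D 1 #= `I_6 /\ meeting Q D 0 #= `I_15
  end.

End HermitianCurve.

(* Main.v *)
Require Import Defs.
From HB Require Import structures.
From Stdlib Require Import Relation_Operators.
From mathcomp Require Import all_boot all_order all_algebra.
From mathcomp Require Import all_classical.
From mathcomp Require Import finmap mpoly.
From mathcomp Require Import ring.

Set Implicit Arguments.
Unset Strict Implicit.
Unset Printing Implicit Defensive.

Import GRing.Theory.

Local Open Scope classical_set_scope.
Local Open Scope card_scope.
Local Open Scope ring_scope.

(* Given a conic Q totally tangent to Gamma, take coordinates in which Q is
   xz = y^2 and three of the six contact points are t = 0, 1, oo. Restricted to
   the parametrization (1 : t : t^2), the Hermitian form becomes a polynomial in t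
   whose exponents are of the form i + 5j with i, j <= 2, so its third derivative
   vanishes; as it has five double roots, among them 0 and 1, it is a multiple of
   (t^5 - t)^2. Hence Q has a frame (a matrix whose rows are the new basis) in
   which Q is xz = y^2 and Gamma is x z^5 - 2 y^6 + z x^5 = 0. Two frames differ by
   a unitary matrix over F_25, so everything happens in a finite unitary group.
   The component of Q consists of 21 explicit conics, and every point with
   isotropic coordinates lies on one of them; so another component has a conic
   through the point (1 : 0 : 0) of the frame of Q, and a frame of that conic is
   obtained from the frame of Q by a lower triangular matrix. Up to a torus and
   the shears that preserve Q, few such matrices are left, and for each of them
   the table of the 21 x 21 meeting numbers is computed. *)

(** * Forms, curves and points *)

(** The definitions live over [k], the computations over a field with 25 elements; this gap shapes
    the proof. Multiplicity is defined by the dimension of a local quotient, so it is first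
    identified with the order of vanishing along a branch [(1 : t : eps t^2)]: [eps = 1] gives a
    conic, [eps = 0] the tangent line at a contact point. In a frame the single matrix [Kmx] is the
    Gram matrix both of the conic (as a symmetric form) and of Gamma (as a Hermitian form), so the
    symmetric square of SL(2,5) preserves the two at once and moves the six contact points like the
    projective line over F_5. Common points on Gamma are then F_25-rational and can be counted by
    testing, but adjacency counts all the common points of two conics over [k]. Here a common secant
    helps: placed at [y = 0] in both frames, it makes the intersection a biquadratic equation in
    [t], and whether that equation has four roots is read from its coefficients. The 21 conics of a
    component partition the 126 isotropic points, which is why another component always has a conic
    through a prescribed point, and why the meeting numbers of each type add up to six. *)

Section Homogeneous.
Variable k : fieldType.
Implicit Types (f g : {mpoly k[3]}) (v : 'rV[k]_3).

Lemma homog0E f : f \is 0.-homog -> exists c, f = c%:MP.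
Proof.
move/dhomogP => hf; exists f@_0%MM; apply/mpolyP => m; rewrite mcoeffC.
have [<-|m0] := eqVneq 0%MM m; first by rewrite mulr1.
rewrite mulr0; apply/memN_msupp_eq0; apply: contra_neqN m0 => /hf /eqP.
by rewrite mdeg_eq0 => /eqP ->.
Qed.

Lemma homogSE d f : f \is d.+1.-homog ->
  exists2 g : 'I_3 -> {mpoly k[3]}, (forall i, g i \is d.-homog) &
    f = \sum_i 'X_i * g i.
Proof.
move/dhomogP => hf; rewrite (mpolyE f); move: hf.
elim: (msupp f) => [|m s IH] hf.
  exists (fun=> 0) => [i|]; first exact: dhomog0.
  by rewrite big_nil big1 // => i _; rewrite mulr0.
rewrite big_cons.
have [g hg ->] : exists2 g : 'I_3 -> {mpoly k[3]}, (forall i, g i \is d.-homog) &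
    \sum_(m <- s) f@_m *: 'X_[m] = \sum_i 'X_i * g i.
  by apply: IH => m' m's; apply: hf; rewrite in_cons m's orbT.
have me : mdeg m = d.+1 by apply: hf; rewrite mem_head.
have [i mi] : exists i, m i != 0%N.
  apply/existsP; apply: contra_eqT me; rewrite negb_exists => /forallP m0.
  by rewrite mdegE big1 // => i _; apply/eqP; rewrite -[_ == _]negbK m0.
have mE : m = (U_(i) + (m - U_(i)))%MM.
  rewrite addmC submK //; apply/mnm_lepP => j; rewrite mnm1E.
  by case: eqP => // <-; rewrite lt0n.
exists (fun j => (if j == i then f@_m *: 'X_[m - U_(i)] else 0) + g j).
  move=> j; apply: rpredD => //; case: eqP => _; last exact: rpred0.
  apply: rpredZ; rewrite dhomogX; apply/eqP.
  by move: me; rewrite {1}mE mdegD mdeg1 add1n => -[].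
under [RHS]eq_bigr do rewrite mulrDr.
rewrite big_split /=; congr (_ + _).
rewrite (bigD1 i) //= eqxx big1 ?addr0 => [|j /negbTE ->].
  by rewrite -scalerAr -mpolyXD -mE.
by rewrite mulr0.
Qed.

(** Splitting off one variable at a time shows that constants, sums and products by a variable
    generate all forms. This suits statements in which the degree varies, such as elimination along
    a branch. *)
Lemma homog_ind (P : nat -> {mpoly k[3]} -> Prop) :
  (forall c, P 0%N c%:MP) -> (forall d, P d 0) ->
  (forall d f g, P d f -> P d g -> P d (f + g)) ->
  (forall d i f, P d f -> P d.+1 ('X_i * f)) ->
  forall d f, f \is d.-homog -> P d f.
Proof.
move=> PC P0 PD PX; elim=> [f /homog0E[c ->]|d IH f /homogSE[g hg ->]] //.
by elim/big_ind: _ => // [f' g'|i _]; [apply: PD | apply/PX/IH].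
Qed.

Lemma meval_homog d f c v : f \is d.-homog ->
  f.@[(c *: v) 0] = c ^+ d * f.@[v 0].
Proof.
move: d f; apply: homog_ind => [a|d|d f g Hf Hg|d i f Hf].
- by rewrite !mevalC mul1r.
- by rewrite !meval0 mulr0.
- by rewrite !mevalD Hf Hg; ring.
- by rewrite !mevalM !mevalXU Hf mxE exprS; ring.
Qed.

Definition linear_form (c : 'rV[k]_3) : {mpoly k[3]} := \sum_i c 0 i *: 'X_i.

Lemma varX_homog i : 'X_i \is [in k[3], 1.-homog].
Proof. by rewrite dhomogX; apply/eqP; exact: mdeg1. Qed.

Lemma linear_form_homog c : linear_form c \is 1.-homog.
Proof.
by apply: rpred_sum => i _; apply/rpredZ/varX_homog.
Qed.

Lemma linear_formE f : f \is 1.-homog -> exists c, f = linear_form c.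
Proof.
move=> /homogSE[g hg ->].
have /choice[c cE] i : exists c, g i = c%:MP by exact: homog0E.
exists (\row_i c i); apply: eq_bigr => i _.
by rewrite cE mxE mulrC mul_mpolyC.
Qed.

Definition quadratic_form (S : 'M[k]_3) : {mpoly k[3]} :=
  \sum_i \sum_j S i j *: ('X_i * 'X_j).

Lemma quadratic_formE f : f \is 2.-homog -> exists S, f = quadratic_form S.
Proof.
move=> /homogSE[g hg ->].
have /choice[c cE] i : exists c, g i = linear_form c by exact: linear_formE.
exists (\matrix_(i, j) c i 0 j); apply: eq_bigr => i _.
by rewrite cE mulr_sumr; apply: eq_bigr => j _; rewrite mxE scalerAr.
Qed.

Lemma meval_linear_form c v : (linear_form c).@[v 0] = (v *m c^T) 0 0.
Proof.
rewrite mxE raddf_sum; apply: eq_bigr => i _ /=.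
by rewrite mevalZ mevalXU mxE mulrC.
Qed.

Lemma meval_quadratic_form S v :
  (quadratic_form S).@[v 0] = (v *m S *m v^T) 0 0.
Proof.
rewrite mxE; under eq_bigr => j _ do rewrite mxE mulr_suml.
rewrite exchange_big /= raddf_sum; apply: eq_bigr => i _ /=.
rewrite raddf_sum; apply: eq_bigr => j _ /=.
by rewrite mevalZ mevalM !mevalXU mxE; ring.
Qed.

End Homogeneous.

Section CurvesAndPoints.
Variable k : fieldType.
Implicit Types (P : proj_point k) (u v : 'rV[k]_3).

Lemma vline_ex (V : vectType k) (U : projspace V) :
  exists2 v, v != 0 & val U = <[v]>%VS.
Proof.
case: U => U /= U1; have Un0 : U != 0%VS by rewrite -dimv_eq0 (eqP U1).
exists (vpick U); first by rewrite vpick0.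
apply/esym/eqP; rewrite eqEdim dim_vline vpick0 Un0 (eqP U1) leqnn andbT.
by rewrite -memvE memv_pick.
Qed.

(** The implication sits under the existential so that [pt] is a total function of the vector, with
    an unspecified value at 0; no proof of [v != 0] occurs inside terms. *)
Lemma pt_ex v : exists P, v != 0 -> val P = <[v]>%VS.
Proof.
have [->|v0] := eqVneq v 0.
  have e0 : const_mx 1 != 0 :> 'rV[k]_3.
    by apply/eqP => /matrixP/(_ 0 0); rewrite !mxE => /eqP; rewrite oner_eq0.
  have H : \dim <[const_mx 1 : 'rV[k]_3]> == 1%N by rewrite dim_vline e0.
  by exists (exist (fun U => is_true (\dim U == 1%N)) _ H).
have H : \dim <[v]> == 1%N by rewrite dim_vline v0.
by exists (exist (fun U => is_true (\dim U == 1%N)) _ H).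
Qed.

Definition pt v : proj_point k := projT1 (cid (pt_ex v)).

Lemma val_pt v : v != 0 -> val (pt v) = <[v]>%VS.
Proof. exact: projT2 (cid (pt_ex v)). Qed.

Lemma ptP P : exists2 v, v != 0 & P = pt v.
Proof.
have [v v0 vE] := vline_ex P; exists v => //.
by apply: val_inj; rewrite val_pt.
Qed.

Lemma eq_ptP u v : u != 0 -> v != 0 ->
  pt u = pt v <-> exists2 c, c != 0 & u = c *: v.
Proof.
move=> u0 v0; split=> [/(congr1 val)|[c c0 ->]].
  rewrite !val_pt // => E; have : u \in <[v]>%VS by rewrite -E memv_line.
  move=> /vlineP[c uE]; exists c => //.
  by apply: contra_neq u0 => c0; rewrite uE c0 scale0r.
apply: val_inj; rewrite !val_pt ?scaler_eq0 ?negb_or ?c0 //.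
by apply/eqP; rewrite eqEsubv -!memvE memvZ ?memv_line //= -{1}[v]scale1r -(mulVf c0) -scalerA memvZ ?memv_line.
Qed.

Lemma ptZ c v : c != 0 -> v != 0 -> pt (c *: v) = pt v.
Proof.
by move=> c0 v0; apply/eq_ptP; rewrite // ?scaler_eq0 ?negb_or ?c0 //; exists c.
Qed.

Lemma forms_homog d (C : curve k d) f : forms C f -> f \is d.-homog.
Proof. by case=> h _ ->; exact: dhomog_is_dhomog. Qed.

Lemma forms_gen d (C : curve k d) : exists2 f, forms C f & f != 0.
Proof.
have [h h0 hE] := vline_ex C; exists h.
  by exists h => //; rewrite hE memv_line.
by apply: contra_neq h0 => h0; apply: val_inj.
Qed.

Lemma formsP d (C : curve k d) f g : forms C f -> f != 0 ->
  forms C g <-> exists c, g = c *: f.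
Proof.
have [h h0 hE] := vline_ex C.
move=> -[h1]; rewrite hE => /vlineP[a ->] -> ah0.
have a0 : a != 0 by apply: contra_neq ah0 => ->; rewrite scale0r.
split=> [[h2]|[c ->]].
  rewrite hE => /vlineP[b ->] ->; exists (b / a).
  by rewrite /= !linearZ /= scalerA [a * _]mulrC divfK.
exists ((c * a) *: h); first by rewrite hE memvZ ?memv_line.
by rewrite /= !linearZ /= scalerA mulrC.
Qed.

Lemma curve_ext d (C C' : curve k d) f :
  f != 0 -> forms C f -> forms C' f -> C = C'.
Proof.
have [h h0 hE] := vline_ex C; have [h' h'0 hE'] := vline_ex C'.
move=> f0 [h1]; rewrite hE => /vlineP[a ->] E1 [h2].
rewrite hE' => /vlineP[b ->] E2; apply: val_inj; rewrite hE hE'.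
have E : a *: h = b *: h' by apply: val_inj; apply: etrans (esym E1) E2.
have a0 : a != 0 by apply: contra_neq f0 => a0; rewrite E1 a0 scale0r.
have b0 : b != 0 by apply: contra_neq f0 => b0; rewrite E2 b0 scale0r.
apply/eqP; rewrite eqEsubv -!memvE.
have -> : h = (b / a) *: h' by rewrite mulrC -scalerA -E scalerA mulVf // scale1r.
rewrite memvZ ?memv_line //=; set c := b / a.
have c0 : c != 0 by rewrite mulf_neq0 ?invr_neq0.
by rewrite -{1}[h']scale1r -(mulVf c0) -scalerA memvZ ?memv_line.
Qed.

(** As for points, this makes [curve_of] total. The power of the first variable only shows that some
    curve of degree [d] exists when [f] is unsuitable. *)
Lemma curve_ex d f : exists C : curve k d,
  f \is d.-homog -> f != 0 -> forms C f.
Proof.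
have H (g : dhomog 3 k d) : g != 0 -> exists C : curve k d, forms C g.
  move=> g0; have H : \dim <[g]> == 1%N by rewrite dim_vline g0.
  by exists (exist (fun U => is_true (\dim U == 1%N)) _ H); exists g; rewrite //= memv_line.
have [[fd f0]|nf] := pselect (f \is d.-homog /\ f != 0).
  have [|C CP] := H (DHomog fd); last by exists C.
  by apply: contra_neq f0 => /(congr1 val).
have Xd : 'X_[U_(0 : 'I_3) *+ d] \is [in k[3], d.-homog].
  by rewrite dhomogX; apply/eqP; rewrite /= mdegMn mdeg1 mul1n.
have [|C _] := H (DHomog Xd); last by exists C => *; case: nf.
apply/eqP => /(congr1 val) /= /(congr1 (mcoeff (U_(0) *+ d))).
by rewrite mcoeffX eqxx mcoeff0 => /eqP; rewrite oner_eq0.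
Qed.

Definition curve_of d f : curve k d := projT1 (cid (curve_ex d f)).

Lemma curve_ofP d f : f \is d.-homog -> f != 0 -> forms (curve_of d f) f.
Proof. exact: projT2 (cid (curve_ex d f)). Qed.

Lemma curve_of_eq d (C : curve k d) f : forms C f -> f != 0 -> C = curve_of d f.
Proof.
by move=> Cf f0; apply: (curve_ext f0 Cf); apply: curve_ofP; rewrite ?(forms_homog Cf).
Qed.

Lemma curve_ofZ d c f : f \is d.-homog -> f != 0 -> c != 0 ->
  curve_of d (c *: f) = curve_of d f.
Proof.
move=> fd f0 c0; apply/esym/curve_of_eq; last first.
  by apply: contra_neq f0 => E; rewrite -[f]scale1r -(mulVf c0) -scalerA E scaler0.
by apply/(formsP _ (curve_ofP fd f0)) => //; exists c.
Qed.

Lemma pts_pt d (C : curve k d) f v : forms C f -> f != 0 -> v != 0 ->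
  pts C (pt v) <-> f.@[v 0] = 0.
Proof.
move=> Cf f0 v0; split=> [|fv g w Cg]; first by apply => //; rewrite val_pt ?memv_line.
rewrite val_pt // => /vlineP[c ->]; have [a ->] := (formsP g Cf f0).1 Cg.
by rewrite mevalZ (meval_homog _ _ (forms_homog Cf)) fv !mulr0.
Qed.

End CurvesAndPoints.

(** * Intersection multiplicities along a parametrized branch *)

Section Dimension3.

Lemma ord3P (P : 'I_3 -> Prop) : P 0 -> P 1 -> P 2%:R -> forall i, P i.
Proof.
move=> P0 P1 P2 [[|[|[|//]]] h].
- by rewrite (_ : Ordinal h = 0) //; apply: val_inj.
- by rewrite (_ : Ordinal h = 1) //; apply: val_inj.
- by rewrite (_ : Ordinal h = 2%:R) //; apply: val_inj.
Qed.

Lemma sum3 (V : nmodType) (F : 'I_3 -> V) :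
  \sum_i F i = F 0 + F 1 + F 2%:R.
Proof.
rewrite !big_ord_recl big_ord0 addr0 addrA.
by congr (F _ + F _ + F _); apply: val_inj.
Qed.

Definition row3 (T : Type) (a b c : T) : 'rV[T]_3 := \row_i nth c [:: a; b] i.

Lemma row3_0 T (a b c : T) : row3 a b c 0 0 = a. Proof. by rewrite mxE. Qed.
Lemma row3_1 T (a b c : T) : row3 a b c 0 1 = b. Proof. by rewrite mxE. Qed.
Lemma row3_2 T (a b c : T) : row3 a b c 0 2%:R = c. Proof. by rewrite mxE. Qed.
Definition row3E := (row3_0, row3_1, row3_2).

Lemma row3P T (v : 'rV[T]_3) : v = row3 (v 0 0) (v 0 1) (v 0 2%:R).
Proof. by apply/rowP; elim/ord3P; rewrite row3E. Qed.

Lemma map_row3 T U (h : T -> U) a b c :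
  map_mx h (row3 a b c) = row3 (h a) (h b) (h c).
Proof. by apply/rowP; elim/ord3P; rewrite mxE !row3E. Qed.

Definition mx3 (T : Type) (u v w : 'rV[T]_3) : 'M[T]_3 :=
  \matrix_i row3 u v w 0 i.

Lemma row_mx3 T (u v w : 'rV[T]_3) i : row i (mx3 u v w) = row3 u v w 0 i.
Proof. by rewrite rowK. Qed.

End Dimension3.

Section Along.
Variable k : fieldType.
Implicit Types (f g : {mpoly k[3]}) (v : 'rV[k]_3) (Phi : 'M[k]_3).

Definition along (gamma : 'rV[{poly k}]_3) f : {poly k} :=
  mmap (@polyC k) (gamma 0) f.

Variable gamma : 'rV[{poly k}]_3.

Lemma alongD f g : along gamma (f + g) = along gamma f + along gamma g.
Proof. exact: raddfD. Qed.
Lemma alongB f g : along gamma (f - g) = along gamma f - along gamma g.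
Proof. exact: raddfB. Qed.
Lemma alongM f g : along gamma (f * g) = along gamma f * along gamma g.
Proof. exact: rmorphM. Qed.
Lemma alongXn f n : along gamma (f ^+ n) = along gamma f ^+ n.
Proof. exact: rmorphXn. Qed.
Lemma alongZ c f : along gamma (c *: f) = c *: along gamma f.
Proof. by rewrite /along mmapZ mul_polyC. Qed.
Lemma alongC c : along gamma c%:MP = c%:P.
Proof. exact: mmapC. Qed.
Lemma along0 : along gamma 0 = 0.
Proof. exact: raddf0. Qed.
Lemma alongX i : along gamma 'X_i = gamma 0 i.
Proof. by rewrite /along mmapX mmap1U. Qed.
Lemma along_sum (I : Type) (r : seq I) (P : pred I) F :
  along gamma (\sum_(i <- r | P i) F i) = \sum_(i <- r | P i) along gamma (F i).
Proof. exact: raddf_sum. Qed.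

Lemma horner_along f t : (along gamma f).[t] = f.@[(map_mx (horner_eval t) gamma) 0].
Proof.
elim/mpolyind: f => [|c m f _ _ IH].
  by rewrite along0 horner0 meval0.
rewrite alongD alongZ hornerD hornerZ mevalD mevalZ IH; congr (_ * _ + _).
rewrite mevalX /along mmapX /mmap1 horner_prod; apply: eq_bigr => i _.
by rewrite horner_exp mxE.
Qed.

End Along.

Section LocalParametrization.
Variables (k : fieldType) (Phi : 'M[k]_3) (eps : k).
Hypothesis Phi_unit : Phi \in unitmx.
Implicit Types (f g : {mpoly k[3]}) (v : 'rV[k]_3) (p q : {poly k}).

Definition coordinate (i : 'I_3) : {mpoly k[3]} :=
  linear_form (col i (invmx Phi))^T.

(** The branch [(1 : t : eps t^2)] in the basis formed by the rows of [Phi]; it passes through the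
    first row at [t = 0]. Both a conic and its tangent line at that point are obtained by the choice
    of [eps]. *)
Definition local_branch : 'rV[{poly k}]_3 :=
  row3 1 'X (eps *: 'X^2) *m map_mx (@polyC k) Phi.

Local Notation lin := coordinate.
Local Notation ev := (along local_branch).

Lemma coordinate_homog i : lin i \is 1.-homog.
Proof. exact: linear_form_homog. Qed.

Lemma meval_coordinate i v : (lin i).@[v 0] = (v *m invmx Phi) 0 i.
Proof.
by rewrite meval_linear_form trmxK !mxE; apply: eq_bigr => j _; rewrite !mxE.
Qed.

Lemma varX_coordinate i : 'X_i = \sum_j Phi j i *: lin j.
Proof.
rewrite /lin /linear_form.
under eq_bigr do rewrite scaler_sumr.
rewrite exchange_big /= (bigD1 i) //= [X in _ + X]big1 => [|j ji].
  transitivity (((invmx Phi *m Phi) i i)%:MP * 'X_i : {mpoly k[3]}).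
    by rewrite mulVmx // mxE eqxx mul1r.
  rewrite addr0 mul_mpolyC mxE scaler_suml.
  by apply: eq_bigr => l _; rewrite !mxE scalerA mulrC.
transitivity (((invmx Phi *m Phi) j i)%:MP * 'X_j : {mpoly k[3]}).
  rewrite mul_mpolyC mxE scaler_suml.
  by apply: eq_bigr => l _; rewrite !mxE scalerA mulrC.
by rewrite mulVmx // mxE (negbTE ji) mul0r.
Qed.

Lemma along_linear_form gamma c :
  along gamma (linear_form c) = (gamma *m map_mx (@polyC k) c^T) 0 0.
Proof.
rewrite along_sum mxE; apply: eq_bigr => i _.
by rewrite alongZ alongX !mxE mulrC mul_polyC.
Qed.

Lemma along_coordinate i : ev (lin i) = row3 1 'X (eps *: 'X^2) 0 i.
Proof.
rewrite along_linear_form trmxK.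
transitivity ((local_branch *m map_mx (@polyC k) (invmx Phi)) 0 i).
  by rewrite !mxE; apply: eq_bigr => j _; rewrite !mxE.
by rewrite /local_branch -mulmxA -map_mxM mulmxV // map_mx1 mulmx1.
Qed.

Lemma size_mulX_leq (p : {poly k}) : (size (p * 'X)%R <= (size p).+1)%N.
Proof.
have [->|p0] := eqVneq p 0; first by rewrite mul0r size_poly0.
by rewrite size_mulX.
Qed.

(** The target degree [n] is independent of [p], because powers of the first coordinate are inserted
    freely below. Coefficients beyond [n] are dropped, hence the size conditions that follow. *)
Definition homogenization n p : {mpoly k[3]} :=
  \sum_(i < n.+1) p`_i *: (lin 0 ^+ (n - i) * lin 1 ^+ i).

Local Notation hom := homogenization.

Lemma homogenization_homog n p : hom n p \is n.-homog.
Proof.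
apply: rpred_sum => i _; apply: rpredZ.
have h j m : lin j ^+ m \is m.-homog.
  have := dhomogMn m (coordinate_homog j); by rewrite mul1n.
by have := dhomogM (h 0 (n - i)%N) (h 1 i); rewrite subnK // -ltnS.
Qed.

Lemma homogenizationD n p q : hom n (p + q) = hom n p + hom n q.
Proof.
by rewrite -big_split; apply: eq_bigr => i _; rewrite coefD scalerDl.
Qed.

Lemma homogenizationZ n c p : hom n (c *: p) = c *: hom n p.
Proof.
by rewrite scaler_sumr; apply: eq_bigr => i _; rewrite coefZ scalerA.
Qed.

Lemma homogenizationS n p : (size p <= n.+1)%N ->
  hom n.+1 p = lin 0 * hom n p.
Proof.
move=> sp; rewrite /hom big_ord_recr /= nth_default // scale0r addr0 mulr_sumr.
apply: eq_bigr => i _; rewrite -scalerAr mulrA -exprS subSn //.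
by rewrite -ltnS.
Qed.

Lemma homogenizationMX n p : hom n.+1 (p * 'X) = lin 1 * hom n p.
Proof.
rewrite /hom big_ord_recl coefMX eqxx scale0r add0r mulr_sumr.
apply: eq_bigr => i _; rewrite coefMX /= /bump /= add1n subSS.
by rewrite -scalerAr exprS; congr (_ *: _); ring.
Qed.

Lemma homogenization_shift n m q : (size q <= m.+1)%N ->
  hom (n + m) q = lin 0 ^+ n * hom m q.
Proof.
move=> sq; elim: n => [|n IH]; first by rewrite mul1r.
rewrite addSn homogenizationS ?IH ?exprS ?mulrA //.
by rewrite (leq_trans sq) // ltnS leq_addl.
Qed.

Lemma homogenization_const n c : hom n c%:P = c *: lin 0 ^+ n.
Proof.
rewrite -[n]addn0 homogenization_shift ?size_polyC ?leq_b1 // addn0.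
by rewrite /hom big_ord1 coefC eqxx !expr0 mulr1 -scalerAr mulr1.
Qed.

Lemma homogenizationM n m p q : (size p <= n.+1)%N -> (size q <= m.+1)%N ->
  hom (n + m) (p * q) = hom n p * hom m q.
Proof.
move=> + sq; elim/poly_ind: p n => [|p c IH] n sp.
  by rewrite mul0r -[0]polyC0 !homogenization_const !scale0r mul0r.
rewrite mulrDl !homogenizationD mulrDl mul_polyC homogenizationZ.
rewrite (homogenization_shift n sq) homogenization_const -scalerAl; congr (_ + _).
have [-> | p0] := eqVneq p 0.
  by rewrite !mul0r -[0]polyC0 !homogenization_const !scale0r mul0r.
case: n sp => [|n] sp.
  move: sp; rewrite size_MXaddC (negbTE p0) /= ltnS leqn0 size_poly_eq0.
  by rewrite (negbTE p0).
rewrite -mulrA ['X * q]mulrC mulrA addSn !homogenizationMX IH ?mulrA //.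
by move: sp; rewrite size_MXaddC (negbTE p0).
Qed.

Lemma along_homogenization n p : (size p <= n.+1)%N -> ev (hom n p) = p.
Proof.
move=> sp; rewrite along_sum -[RHS]coefK poly_def.
rewrite (big_ord_widen n.+1 (fun i => p`_i *: 'X^i) sp) [RHS]big_mkcond /=.
apply: eq_bigr => i _; rewrite alongZ alongM !alongXn !along_coordinate !row3E.
rewrite expr1n mul1r; case: ltnP => // hi.
by rewrite nth_default // scale0r.
Qed.

(* XZ - eps Y^2 *)
Definition branch_form := lin 0 * lin 2%:R - eps *: lin 1 ^+ 2.

(** Write X, Y, Z for the adapted coordinates. Modulo the branch form [X Z = eps Y^2], so [d]
    factors X eliminate every Z from a form of degree [d]. What remains is a form in X and Y of
    degree [2 d], determined by its restriction to the branch. *)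
Lemma homogenize_along d f : f \is d.-homog -> (size (ev f) <= d.*2.+1)%N /\
  exists u, lin 0 ^+ d * f = hom d.*2 (ev f) + u * branch_form.
Proof.
move: d f; apply: homog_ind => [c|d|d f g [sf [u fE]] [sg [w gE]]|d i f [sf [u fE]]].
- rewrite alongC homogenization_const size_polyC; split; first by case: (c == 0).
  by exists 0; rewrite mul0r addr0 !mul1r -mul_mpolyC mulr1.
- rewrite along0 size_poly0; split=> //; exists 0.
  by rewrite mulr0 -polyC0 homogenization_const scale0r mul0r addr0.
- rewrite alongD; split; first by rewrite (leq_trans (size_polyD _ _)) // geq_max sf.
  by exists (u + w); rewrite mulrDr fE gE homogenizationD; ring.
(* The induction multiplies by the variables, whereas the elimination is transparent for the adapted
   coordinates; each variable is a linear combination of these. *)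
have H j : (size (ev (lin j * f)%R) <= d.+1.*2.+1)%N /\
  exists u, lin 0 ^+ d.+1 * (lin j * f) = hom d.+1.*2 (ev (lin j * f)) + u * branch_form.
  have sX : (size (ev f * 'X)%R <= d.*2.+2)%N.
    by apply: leq_trans (size_mulX_leq _) _.
  rewrite alongM along_coordinate doubleS.
  have E : lin 0 ^+ d.+1 * (lin j * f) = lin 0 * lin j * (lin 0 ^+ d * f).
    by rewrite exprS; ring.
  rewrite E fE; elim/ord3P: j {E}; rewrite !row3E.
  + rewrite mul1r; split; first by rewrite (leq_trans sf) // ltnW.
    exists (lin 0 * lin 0 * u); rewrite !homogenizationS ?(leq_trans sf) //.
    by ring.
  + rewrite mulrC; split; first by rewrite (leq_trans sX).
    exists (lin 0 * lin 1 * u); rewrite homogenizationS // homogenizationMX.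
    by ring.
  rewrite -mulrC -scalerAr expr2 mulrA; split.
    rewrite (leq_trans (size_scale_leq _ _)) //.
    by apply: leq_trans (size_mulX_leq _) _.
  exists (lin 0 * lin 2%:R * u + hom d.*2 (ev f)); rewrite homogenizationZ !homogenizationMX.
  by rewrite /branch_form -!mul_mpolyC; ring.
have [/choice[w wE] sw] : (forall j, exists u, lin 0 ^+ d.+1 * (lin j * f) =
     hom d.+1.*2 (ev (lin j * f)) + u * branch_form) /\
   forall j, (size (ev (lin j * f)%R) <= d.+1.*2.+1)%N.
  by split=> j; have [] := H j.
have E : 'X_i * f = \sum_j Phi j i *: (lin j * f).
  by rewrite varX_coordinate mulr_suml; apply: eq_bigr => j _; rewrite scalerAl.
have evE : ev ('X_i * f) = \sum_j Phi j i *: ev (lin j * f).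
  by rewrite E along_sum; apply: eq_bigr => j _; rewrite alongZ.
rewrite evE; split.
  apply: (leq_trans (size_sum _ _ _)); apply/bigmax_leqP => j _.
  exact: leq_trans (size_scale_leq _ _) (sw j).
exists (\sum_j Phi j i *: w j); rewrite E !sum3 !mulrDr -!scalerAr !wE.
rewrite !homogenizationD !homogenizationZ.
by rewrite /branch_form -!mul_mpolyC; ring.
Qed.

Lemma row0_neq0 : row 0 Phi != 0.
Proof.
apply/eqP => /(congr1 (mulmx^~ (invmx Phi))); rewrite -row_mul mulmxV // mul0mx.
by move/rowP/(_ 0); rewrite !mxE eqxx => /eqP; rewrite oner_eq0.
Qed.

Lemma coef0_along f : (ev f)`_0 = f.@[(row 0 Phi) 0].
Proof.
rewrite -horner_coef0 horner_along; apply: meval_eq => i.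
rewrite !mxE horner_evalE horner_sum sum3 !row3E !mxE.
by rewrite !hornerE /= mulr0 mul0r addr0.
Qed.

Lemma meval_pt_row0 d b : b \is d.-homog ->
  (exists2 v : 'rV[k]_3, v \in val (pt (row 0 Phi)) & b.@[v 0] != 0) <->
  (ev b)`_0 != 0.
Proof.
move=> bd; rewrite coef0_along val_pt ?row0_neq0 //; split=> [[v]|b0]; last first.
  by exists (row 0 Phi); rewrite ?memv_line.
by move=> /vlineP[c ->]; rewrite (meval_homog _ _ bd) mulf_eq0 negb_or => /andP[].
Qed.

Lemma size_leq_mulXn p m : (size p <= size (p * 'X^m)%R)%N.
Proof.
have [->|p0] := eqVneq p 0; first by rewrite mul0r.
by rewrite size_mulXn // leq_addl.
Qed.

Section Multiplicity.
Variables (d e : nat) (C : curve k d) (C' : curve k e) (h f u0 : {mpoly k[3]}).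
Hypotheses (Ch : forms C h) (C'f : forms C' f) (h_neq0 : h != 0) (f_neq0 : f != 0).
(** For a conic [u0] is 1. For the line [Z = 0] the branch form with [eps = 0] is [X Z], and [u0] is
    the coordinate X, which does not vanish at the point. *)
Hypotheses (ev_h : ev h = 0) (branch_h : branch_form = u0 * h).

Local Notation P := (pt (row 0 Phi)).

(** If [ev a = al * 'X^m], then [u * ev a = al * ev f]. Homogenized, this equates
    [hom u * lin 0 ^+ n * a] with [hom al * lin 0 ^+ e * f] modulo the branch form, up to powers of
    [lin 0] absorbed in the degrees. The factor [w] in front of [a] is a unit at the point, so
    numerator and denominator may be multiplied by it. *)
Lemma local_ideal_mem m u a b n : ev f = u * 'X^m -> u`_0 != 0 ->
  a \is n.-homog -> b \is n.-homog -> (ev b)`_0 != 0 ->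
  'X^m %| ev a -> local_ideal P C C' (tofrac a / tofrac b).
Proof.
move=> fE u_0 an bn b0 /dvdpP[al aE].
have [sa [u1 a1E]] := homogenize_along an.
have [sf [u2 f1E]] := homogenize_along (forms_homog C'f).
have su : (size u <= e.*2.+1)%N.
  by rewrite (leq_trans (size_leq_mulXn u m)) // -fE.
have sal : (size al <= n.*2.+1)%N.
  by rewrite (leq_trans (size_leq_mulXn al m)) // -aE.
pose w := hom e.*2 u * lin 0 ^+ n.
have wn : w \is (e.*2 + n).-homog.
  rewrite dhomogM ?homogenization_homog //.
  by have := dhomogMn n (coordinate_homog 0); rewrite mul1n.
have w0 : (ev w)`_0 != 0.
  by rewrite alongM along_homogenization // alongXn along_coordinate row3E expr1n mulr1.
exists (w * a), (w * b), (e.*2 + n + n)%N; split.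
- exists (u0 * 0 + (hom e.*2 u * u1 - hom n.*2 al * u2) * u0), h, (hom n.*2 al * lin 0 ^+ e), f.
  split=> //; rewrite -[RHS]addrC -!mulrA [u0 * 0]mulr0 add0r f1E /w -!mulrA a1E.
  have E : hom e.*2 u * hom n.*2 (ev a) = hom n.*2 al * hom e.*2 (ev f).
    rewrite -!homogenizationM // addnC aE fE; congr hom; ring.
  by rewrite -branch_h !mulrDr E; ring.
- exact: dhomogM.
- exact: dhomogM.
- by apply/(meval_pt_row0 (dhomogM wn bn)); rewrite alongM coef0M mulf_neq0.
rewrite (tofracM w a) (tofracM w b) -mulf_div divff ?mul1r // tofrac_eq0.
by apply: contra_neq w0 => ->; rewrite along0 coef0.
Qed.

(** Restriction to the branch kills [h] and sends [f] to a multiple of ['X^m]; denominators restrict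
    to polynomials with nonzero constant term, which are coprime to ['X^m]. *)
Lemma local_ideal_dvd m u a b n : ev f = u * 'X^m ->
  a \is n.-homog -> b \is n.-homog -> (ev b)`_0 != 0 ->
  local_ideal P C C' (tofrac a / tofrac b) -> 'X^m %| ev a.
Proof.
move=> fE an bn b0 [A [B [N [[u1 [h1 [w1 [f1 [Ch1 Cf1 AE]]]] AN BN]]]]].
move=> /(meval_pt_row0 BN) B0.
have nz g : (ev g)`_0 != 0 -> tofrac g != 0.
  by move=> g0; rewrite tofrac_eq0; apply: contra_neq g0 => ->; rewrite along0 coef0.
move=> /eqP; rewrite eqr_div ?nz // -!tofracM tofrac_eq => /eqP/(congr1 ev).
rewrite !alongM AE alongD !alongM.
have [c ->] := (formsP h1 Ch h_neq0).1 Ch1.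
have [c' ->] := (formsP f1 C'f f_neq0).1 Cf1.
rewrite !alongZ ev_h scaler0 mulr0 add0r fE => E.
rewrite -(@Gauss_dvdpl _ _ (ev B)); last first.
  by rewrite coprimep_sym coprimep_expr // coprimepX /root horner_coef0.
apply/dvdpP; exists (c' *: (ev w1 * u * ev b)); rewrite E -!mul_polyC; ring.
Qed.

(** The quotient of the local ring is [k[t] / (t^m)], with [t = lin 1 / lin 0]; the basis consists
    of the powers of [t], and the two preceding lemmas turn membership in the ideal into
    divisibility by ['X^m]. *)
Lemma local_multiplicity m u : ev f = u * 'X^m -> u`_0 != 0 ->
  intersection_multiplicity P C C' m.
Proof.
move=> fE u0_neq0.
have nz g : (ev g)`_0 != 0 -> tofrac g != 0.
  by move=> g0; rewrite tofrac_eq0; apply: contra_neq g0 => ->; rewrite along0 coef0.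
have lin0n n : (ev (lin 0 ^+ n))`_0 != 0.
  by rewrite alongXn along_coordinate row3E expr1n coef1 oner_eq0.
have homX j n : lin j ^+ n \is n.-homog.
  by have := dhomogMn n (coordinate_homog j); rewrite mul1n.
pose b (i : 'I_m) := tofrac (lin 1 ^+ i) / tofrac (lin 0 ^+ i).
have sumb (c : 'rV[k]_m) : \sum_i tofrac (c 0 i)%:MP * b i =
    tofrac (hom m (rVpoly c)) / tofrac (lin 0 ^+ m).
  rewrite /hom big_ord_recr /= nth_default ?size_poly // scale0r addr0.
  rewrite raddf_sum mulr_suml; apply: eq_bigr => i _ /=.
  rewrite coef_rVpoly_ord /b -mul_mpolyC tofracM -mulrA; congr (_ * _).
  rewrite -[in tofrac (lin 0 ^+ m)](@subnK i m) ?(ltnW (ltn_ord i)) // exprD.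
  by rewrite !tofracM -mulf_div divff ?mul1r ?nz.
have srV (c : 'rV[k]_m) : (size (rVpoly c) <= m.+1)%N.
  exact: leq_trans (size_poly _ _) _.
exists b => [i|H [a [q [n [_ an qn /(meval_pt_row0 qn) q0 ->]]]]].
  exists (lin 1 ^+ i), (lin 0 ^+ i), i; split=> //.
  exact/(meval_pt_row0 (homX 0 i)).
have subE (c : 'rV[k]_m) : tofrac a / tofrac q - \sum_i tofrac (c 0 i)%:MP * b i =
    tofrac (a * lin 0 ^+ m - q * hom m (rVpoly c)) / tofrac (q * lin 0 ^+ m).
  rewrite sumb tofracB !tofracM -mulNr addf_div ?nz //; congr (_ / _).
  by rewrite mulNr [tofrac q * _]mulrC.
have subP (c : 'rV[k]_m) : local_ideal P C C' (tofrac a / tofrac q - \sum_i tofrac (c 0 i)%:MP * b i)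
    <-> 'X^m %| ev a - ev q * rVpoly c.
  have hN : a * lin 0 ^+ m - q * hom m (rVpoly c) \is (n + m).-homog.
    by apply: rpredB; rewrite dhomogM ?homogenization_homog.
  have hD : q * lin 0 ^+ m \is (n + m).-homog by rewrite dhomogM.
  have D0 : (ev (q * lin 0 ^+ m))`_0 != 0 by rewrite alongM coef0M mulf_neq0.
  have evN : ev (a * lin 0 ^+ m - q * hom m (rVpoly c)) = ev a - ev q * rVpoly c.
    by rewrite alongB !alongM along_homogenization // alongXn along_coordinate row3E expr1n mulr1.
  rewrite subE -evN; split; first exact: local_ideal_dvd fE hN hD D0.
  exact: local_ideal_mem fE u0_neq0 hN hD D0.
have cop : coprimep (ev q) 'X^m by rewrite coprimep_expr // coprimepX /root horner_coef0.
(* Here [s] inverts the restricted denominator modulo ['X^m], so the coordinates of [a / q] are the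
   coefficients of [ev a * s] reduced modulo ['X^m]. *)
have /Bezout_eq1_coprimepP[[s t] /= st] := cop.
have sr : (size ((ev a * s) %% 'X^m)%R <= m)%N.
  by rewrite -ltnS -(size_polyXn k m) ltn_modp -size_poly_eq0 size_polyXn.
have r_dvd : 'X^m %| ev a - ev q * ((ev a * s) %% 'X^m).
  have -> : (ev a * s) %% 'X^m = ev a * s - (ev a * s) %/ 'X^m * 'X^m.
    by rewrite {2}(divp_eq (ev a * s) 'X^m) addrC addKr.
  apply/dvdpP; exists (ev a * t + ev q * ((ev a * s) %/ 'X^m)).
  rewrite -[X in X - _](mulr1 (ev a)) -[in LHS]st; ring.
exists (poly_rV ((ev a * s) %% 'X^m)); split.
  by apply/subP; rewrite poly_rV_K.
move=> c /subP c_dvd; apply: (can_inj (@rVpolyK _ _)); rewrite poly_rV_K //.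
have : 'X^m %| ev q * (rVpoly c - (ev a * s) %% 'X^m).
  have -> : ev q * (rVpoly c - (ev a * s) %% 'X^m) =
    (ev a - ev q * ((ev a * s) %% 'X^m)) - (ev a - ev q * rVpoly c) by ring.
  exact: dvdp_sub.
rewrite Gauss_dvdpr 1?coprimep_sym // => X_dvd; apply/esym/eqP.
rewrite -subr_eq0; apply: contraT => /dvdp_leq/(_ X_dvd).
rewrite size_polyXn leqNgt ltnS (leq_trans (size_polyD _ _)) // geq_max.
by rewrite size_polyN sr size_poly.
Qed.

(* If f vanished to order at most one, all the elements of the local ring
   vanishing at the point would lie in the ideal, so two elements would always
   be dependent modulo the ideal. *)
Lemma multiplicity2_dvd : intersection_multiplicity P C C' 2 -> 'X^2 %| ev f.
Proof.
case=> b bO bU; have [->|evf0] := eqVneq (ev f) 0; first exact: dvdp0.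
have [m [u]] := multiplicity_XsubC (ev f) 0; rewrite evf0 subr0 /root horner_coef0 /=.
move=> u_0 fE; have [m2|m1] := leqP 2 m.
  by rewrite fE; apply/dvdp_mull/dvdp_exp2l.
have [a0 [q0 [n0 [_ a0n q0n /(meval_pt_row0 q0n) q0_0 b0E]]]] := bO 0.
have [a1 [q1 [n1 [_ a1n q1n /(meval_pt_row0 q1n) q1_0 b1E]]]] := bO 1.
have [c0 [c1 [c_neq0 cE]]] : exists c0 c1, (c0, c1) != (0, 0) /\
    c0 * ((ev a0)`_0 * (ev q1)`_0) + c1 * ((ev a1)`_0 * (ev q0)`_0) = 0.
  have [a00|a00] := eqVneq (ev a0)`_0 0.
    exists 1, 0; rewrite a00 !mul0r mulr0 addr0; split=> //.
    by rewrite xpair_eqE oner_eq0.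
  exists ((ev a1)`_0 * (ev q0)`_0), (- ((ev a0)`_0 * (ev q1)`_0)); split; last by ring.
  by rewrite xpair_eqE negb_and oppr_eq0 (mulf_neq0 a00 q1_0) orbT.
pose A := c0 *: (a0 * q1) + c1 *: (a1 * q0).
have An : A \is (n0 + n1).-homog.
  by apply: rpredD; apply: rpredZ; [|rewrite addnC]; exact: dhomogM.
have nz g : (ev g)`_0 != 0 -> tofrac g != 0.
  by move=> g0; rewrite tofrac_eq0; apply: contra_neq g0 => ->; rewrite along0 coef0.
have sumE (c : 'rV[k]_2) : \sum_i tofrac (c 0 i)%:MP * b i =
  tofrac (c 0 0)%:MP * b 0 + tofrac (c 0 1)%:MP * b 1.
  by rewrite !big_ord_recl big_ord0 addr0; congr (_ + tofrac (c 0 _)%:MP * b _); apply: val_inj.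
have O0 : local_ring P 0.
  exists 0, 1, 0%N; split; rewrite ?mul0r ?tofrac0 ?mul0r //; first exact: dhomog0.
  exact: dhomog1.
  by apply/(meval_pt_row0 (dhomog1 _ _)); rewrite -mpolyC1 alongC coefC oner_eq0.
have [c [_ cU]] := bU 0 O0.
have c_0 : c = 0.
  apply: cU; rewrite sumE !mxE !mpolyC0 !tofrac0 !mul0r addr0 subr0.
  exists 0, 1, 0%N; split; rewrite ?mul0r ?tofrac0 ?mul0r //; first last.
  - by apply/(meval_pt_row0 (dhomog1 _ _)); rewrite -mpolyC1 alongC coefC oner_eq0.
  - exact: dhomog1.
  - exact: dhomog0.
  by exists 0, h, 0, f; split; rewrite ?mul0r ?addr0.
have : c = \row_i [:: - c0; - c1]`_i.
  apply: cU; rewrite sumE !mxE /= !mpolyCN !tofracN !mulNr -opprD sub0r opprK.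
  have -> : tofrac c0%:MP * b 0 + tofrac c1%:MP * b 1 = tofrac A / tofrac (q0 * q1).
    rewrite b0E b1E !mulrA addf_div ?nz // -!tofracM -!tofracD; congr (tofrac _ / _).
    by rewrite /A -!mul_mpolyC; ring.
  apply: (local_ideal_mem fE u_0 An (dhomogM q0n q1n)).
    by rewrite alongM coef0M mulf_neq0.
  apply: (@dvdp_trans _ 'X); first by rewrite -[X in _ %| X]expr1 dvdp_exp2l.
  have -> : ev A = ev A - ((ev A)`_0)%:P.
    rewrite /A alongD !alongZ !alongM coefD !coefZ !coef0M.
    by rewrite cE subr0.
  by rewrite -['X]subr0 dvdp_XsubCl /root !hornerE horner_coef0 subrr.
rewrite c_0 => /rowP cE'; move: c_neq0; rewrite xpair_eqE negb_and.
by have := cE' 0; have := cE' 1; rewrite !mxE /= => /esym/eqP; rewrite oppr_eq0 => -> /esym/eqP; rewrite oppr_eq0 => ->.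
Qed.

End Multiplicity.
End LocalParametrization.

(** * Conics and the Hermitian form *)

Section Conics.
Variable k : fieldType.
Implicit Types (Phi S : 'M[k]_3) (u v : 'rV[k]_3).

Definition q0 (R : comNzRingType) (x : 'rV[R]_3) : R :=
  x 0 0 * x 0 2%:R - x 0 1 ^+ 2.

(** The polar matrix of [xz - y^2]. With a Frobenius twist on one side, the same matrix represents
    [x z^5 - 2 y^6 + z x^5]. *)
Definition Kmx (R : comNzRingType) : 'M[R]_3 :=
  mx3 (row3 0 0 1) (row3 0 (- 2) 0) (row3 1 0 0).

Lemma mx3E (T : Type) (u v w : 'rV[T]_3) i j : mx3 u v w i j = row3 u v w 0 i 0 j.
Proof. by rewrite mxE. Qed.

Lemma mx3P (T : Type) (M : 'M[T]_3) : M = mx3 (row 0 M) (row 1 M) (row 2%:R M).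
Proof. by apply/matrixP => i j; rewrite mx3E; elim/ord3P: i; rewrite row3E mxE. Qed.

Lemma row3_mulmx (R : comNzRingType) (a b c : R) (M : 'M[R]_3) :
  row3 a b c *m M = a *: row 0 M + b *: row 1 M + c *: row 2%:R M.
Proof. by apply/rowP => i; rewrite mxE sum3 !row3E !mxE. Qed.

Lemma Kmx_form (R : comNzRingType) (x y : 'rV[R]_3) :
  (x *m Kmx R *m y^T) 0 0 =
  x 0 0 * y 0 2%:R - x 0 1 * y 0 1 *+ 2 + x 0 2%:R * y 0 0.
Proof.
by rewrite !mxE !sum3 !mxE !sum3 !mx3E !row3E; ring.
Qed.

Lemma q0_Kmx (R : comNzRingType) (x : 'rV[R]_3) :
  q0 x *+ 2 = (x *m Kmx R *m x^T) 0 0.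
Proof. by rewrite Kmx_form /q0; ring. Qed.

Lemma q0_stab (R : comNzRingType) (S : 'M[R]_3) c (x : 'rV[R]_3) :
  S *m Kmx R *m S^T = c *: Kmx R -> q0 (x *m S) *+ 2 = c * q0 x *+ 2.
Proof.
move=> SK; rewrite q0_Kmx trmx_mul mulmxA -(mulmxA x) -(mulmxA x) SK.
by rewrite -scalemxAr -scalemxAl mxE -q0_Kmx mulrnAr.
Qed.

Definition coordinates Phi : 'rV[{mpoly k[3]}]_3 := \row_i coordinate Phi i.

Lemma coordinatesE Phi :
  coordinates Phi = \row_i 'X_i *m map_mx (@mpolyC 3 k) (invmx Phi).
Proof.
apply/rowP => i; rewrite !mxE; apply: eq_bigr => j _.
by rewrite !mxE -mul_mpolyC mulrC.
Qed.

Lemma coordinates_mul S Phi : S \in unitmx -> Phi \in unitmx ->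
  coordinates Phi = coordinates (S *m Phi) *m map_mx (@mpolyC 3 k) S.
Proof.
move=> uS uPhi; rewrite !coordinatesE -mulmxA -map_mxM; congr (_ *m map_mx _ _).
rewrite -[RHS](mulmxK uPhi) -(mulmxA _ S Phi) mulVmx ?mul1mx //.
by rewrite unitmx_mul uS.
Qed.

Definition conic_form Phi : {mpoly k[3]} := q0 (coordinates Phi).

Lemma conic_form_branch Phi : conic_form Phi = branch_form Phi 1.
Proof. by rewrite /conic_form /q0 /branch_form !mxE scale1r. Qed.

Lemma meval_conic_form Phi v :
  (conic_form Phi).@[v 0] = q0 (v *m invmx Phi).
Proof.
rewrite /conic_form /q0 ![coordinates _ _ _]mxE mevalB !expr2.
by rewrite !mevalM !meval_coordinate.
Qed.

Lemma conic_form_homog Phi : conic_form Phi \is 2.-homog.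
Proof.
rewrite /conic_form /q0 !mxE; apply: rpredB.
  by have := dhomogM (coordinate_homog Phi 0) (coordinate_homog Phi 2%:R).
by have := dhomogMn 2 (coordinate_homog Phi 1).
Qed.

Lemma conic_form_neq0 Phi : Phi \in unitmx -> conic_form Phi != 0.
Proof.
move=> uPhi; apply/eqP => /(congr1 (meval ((row3 1 0 1 *m Phi) 0))).
rewrite meval_conic_form mulmxK // meval0 /q0 !row3E.
by move/eqP; rewrite mulr1 expr2 mul0r subr0 oner_eq0.
Qed.

Definition conic Phi : curve k 2 := curve_of 2 (conic_form Phi).

Lemma conicP Phi : Phi \in unitmx -> forms (conic Phi) (conic_form Phi).
Proof. by move=> uPhi; apply: curve_ofP (conic_form_homog _) (conic_form_neq0 uPhi). Qed.

Lemma pts_conic Phi v : Phi \in unitmx -> v != 0 ->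
  pts (conic Phi) (pt v) <-> q0 (v *m invmx Phi) = 0.
Proof.
move=> uPhi v0; rewrite -meval_conic_form.
exact: pts_pt (conicP uPhi) (conic_form_neq0 uPhi) v0.
Qed.

Lemma mulmx_neq0 Phi v : Phi \in unitmx -> v != 0 -> v *m Phi != 0.
Proof.
by move=> uPhi; apply: contra_neq => v0; rewrite -(mulmxK uPhi v) v0 mul0mx.
Qed.

Lemma pts_conic_mul Phi v : Phi \in unitmx -> v != 0 ->
  pts (conic Phi) (pt (v *m Phi)) <-> q0 v = 0.
Proof.
by move=> uPhi v0; rewrite pts_conic ?mulmx_neq0 // mulmxK.
Qed.

Hypothesis two_neq0 : 2 != 0 :> k.

(* The condition says that S maps the conic xz = y^2 to itself. *)
Lemma conic_stab S Phi c : S \in unitmx -> Phi \in unitmx -> c != 0 ->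
  S *m Kmx k *m S^T = c *: Kmx k -> conic (S *m Phi) = conic Phi.
Proof.
move=> uS uPhi c0 SK; rewrite /conic.
have -> : conic_form Phi = c *: conic_form (S *m Phi).
  apply: (mulIf (_ : 2 != 0 :> {mpoly k[3]})).
    by rewrite -mpolyC_nat mpolyC_eq0.
  rewrite !mulr_natr -mul_mpolyC.
  have cE : coordinates Phi = coordinates (S *m Phi) *m map_mx (@mpolyC 3 k) S.
    exact: coordinates_mul.
  rewrite /conic_form cE; apply: q0_stab.
  have -> : Kmx {mpoly k[3]} = map_mx (@mpolyC 3 k) (Kmx k).
    apply/matrixP => i j; rewrite [RHS]mxE.
    by elim/ord3P: i; elim/ord3P: j; rewrite !(mx3E, row3E) ?mpolyC0 ?mpolyC1 ?mpolyCN ?mpolyC_nat.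
  by rewrite map_trmx -!map_mxM SK map_mxZ.
rewrite curve_ofZ ?conic_form_homog ?conic_form_neq0 // unitmx_mul uS.
exact: uPhi.
Qed.

Definition par (s t : k) : 'rV[k]_3 := row3 (s ^+ 2) (s * t) (t ^+ 2).
(** The symmetric square of the 2 x 2 matrix with rows [(a, b)] and [(c, d)]: the action on the
    plane of a linear change of the parameters of the conic [xz = y^2]. *)
Definition sym2 (a b c d : k) : 'M[k]_3 :=
  mx3 (row3 (a ^+ 2) (a * b) (b ^+ 2))
      (row3 (a * c *+ 2) (a * d + b * c) (b * d *+ 2))
      (row3 (c ^+ 2) (c * d) (d ^+ 2)).

Lemma par_sym2 s t a b c d :
  par s t *m sym2 a b c d = par (s * a + t * c) (s * b + t * d).
Proof.
by apply/rowP; elim/ord3P; rewrite !(row3E, mx3E, sum3, mxE); ring.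
Qed.

Lemma sym2_Kmx a b c d :
  sym2 a b c d *m Kmx k *m (sym2 a b c d)^T = (a * d - b * c) ^+ 2 *: Kmx k.
Proof.
apply/matrixP => i j; rewrite [LHS]mxE sum3 ![(sym2 _ _ _ _ *m _) _ _]mxE !sum3 ![_^T _ _]mxE [RHS]mxE.
by elim/ord3P: i; elim/ord3P: j; rewrite !(mx3E, row3E); ring.
Qed.

Lemma sym2_adj a b c d :
  sym2 a b c d *m sym2 d (- b) (- c) a = ((a * d - b * c) ^+ 2)%:M.
Proof.
apply/matrixP; elim/ord3P; elim/ord3P; rewrite !(row3E, mx3E, sum3, mxE) /=; ring.
Qed.

Lemma sym2_unit a b c d : a * d - b * c != 0 -> sym2 a b c d \in unitmx.
Proof.
move=> D0; set D := _ - _ in D0.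
have /mulmx1_unit[] // : sym2 a b c d *m (D ^- 2 *: sym2 d (- b) (- c) a) = 1%:M.
by rewrite -scalemxAr sym2_adj scale_scalar_mx mulVf ?expf_neq0.
Qed.

Lemma conic_sym2 a b c d Phi : a * d - b * c != 0 -> Phi \in unitmx ->
  conic (sym2 a b c d *m Phi) = conic Phi.
Proof.
move=> D0 uPhi; apply: conic_stab (sym2_Kmx a b c d) => //.
  exact: sym2_unit.
by rewrite expf_neq0.
Qed.

Lemma Kmx_unit : Kmx k \in unitmx.
Proof.
have /mulmx1_unit[] // :
  Kmx k *m mx3 (row3 0 0 1) (row3 0 (- 2%:R^-1) 0) (row3 1 0 0) = 1%:M.
apply/matrixP; elim/ord3P; elim/ord3P; rewrite !(row3E, mx3E, sum3, mxE) /=; try ring.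
by field.
Qed.

Lemma q0P v : q0 v = 0 -> v != 0 ->
  (exists2 t, v 0 0 != 0 & v = v 0 0 *: par 1 t) \/ v = v 0 2%:R *: par 0 1.
Proof.
move=> qv v0; have [x0|x0] := eqVneq (v 0 0) 0; [right|left].
  have y0 : v 0 1 = 0.
    by move/eqP: qv; rewrite /q0 x0 mul0r sub0r oppr_eq0 expf_eq0 => /eqP.
  by apply/rowP; elim/ord3P; rewrite mxE row3E ?x0 ?y0; ring.
exists (v 0 1 / v 0 0) => //; apply/rowP; elim/ord3P; rewrite mxE row3E.
- by rewrite expr1n mulr1.
- by rewrite mul1r mulrC divfK.
have -> : v 0 2%:R = (v 0 1) ^+ 2 / v 0 0.
  by apply: (mulIf x0); rewrite divfK // mulrC; apply/eqP; rewrite -subr_eq0 -/(q0 v) qv.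
by field.
Qed.

End Conics.

Lemma card_seqP (T : choiceType) (X : set T) n : X #= `I_n <->
  exists s : seq T, [/\ uniq s, size s = n & forall x, X x <-> x \in s].
Proof.
split=> [Xn|[s [us <- Xs]]].
  have fX : finite_set X by apply/finite_setP; exists n.
  exists (fset_set X); rewrite fset_uniq (card_fset_set Xn); split=> // x.
  by rewrite in_fset_set //; split; [exact: mem_set | exact: set_mem].
have -> : X = [set` seq_fset tt s].
  apply/seteqP; split=> x Xx.
    by have /Xs := Xx; rewrite -(seq_fsetE tt).
  by apply/Xs; rewrite -(seq_fsetE tt).
by apply/card_eq_fsetP; rewrite size_seq_fset undup_id.
Qed.

(** * Hermitian forms and their Gram matrices *)

Section Gram.
Variables (k : closedFieldType) (char5 : 5%N \in [pchar k]).
Implicit Types (A Phi S : 'M[k]_3) (u v : 'rV[k]_3).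

Local Notation frob := (GRing.pFrobenius_aut char5).

Lemma natr_neq0 n : ~~ (5 %| n)%N -> n%:R != 0 :> k.
Proof. by rewrite (dvdn_pcharf char5). Qed.

Lemma two_neq0 : 2 != 0 :> k. Proof. exact: natr_neq0. Qed.

Lemma char5_poly : 5%N \in [pchar {poly k}].
Proof. by rewrite pchar_poly. Qed.

Definition hermitian_form A : {mpoly k[3]} :=
  \sum_i \sum_j A i j *: ('X_i * 'X_j ^+ 5).

(** The matrix of the form in the basis of rows of [Phi]. Over [k] the fifth power is not an
    involution, so this is a twisted bilinear form; it becomes Hermitian in the usual sense only
    over the field with 25 elements. *)
Definition gram A Phi : 'M[k]_3 := Phi *m A *m (map_mx frob Phi)^T.

Lemma gram_mul A S Phi : gram A (S *m Phi) = S *m gram A Phi *m (map_mx frob S)^T.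
Proof. by rewrite /gram map_mxM trmx_mul !mulmxA. Qed.

Lemma gram_unit A Phi : A \in unitmx -> Phi \in unitmx -> gram A Phi \in unitmx.
Proof.
by move=> uA uPhi; rewrite /gram !unitmx_mul uA uPhi unitmx_tr map_unitmx.
Qed.

Lemma along_hermitian_form A Phi (w : 'rV[{poly k}]_3) :
  along (w *m map_mx (@polyC k) Phi) (hermitian_form A) =
  \sum_i \sum_j gram A Phi i j *: (w 0 i * w 0 j ^+ 5).
Proof.
pose F5 := GRing.pFrobenius_aut char5_poly.
set g := w *m _.
transitivity ((g *m map_mx (@polyC k) A *m (map_mx F5 g)^T) 0 0).
  rewrite mxE along_sum; under eq_bigr do rewrite along_sum.
  rewrite exchange_big /=; apply: eq_bigr => j _; rewrite mxE mulr_suml; apply: eq_bigr => i _.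
  rewrite alongZ alongM alongXn !alongX !mxE /F5 GRing.pFrobenius_autE -mul_polyC.
  by rewrite mulrA [_%:P * _]mulrC.
have -> : map_mx F5 g = map_mx F5 w *m map_mx (@polyC k) (map_mx frob Phi).
  rewrite /g map_mxM; congr (_ *m _); apply/matrixP => i j.
  by rewrite !mxE /F5 !GRing.pFrobenius_autE rmorphXn.
have -> : g *m map_mx (@polyC k) A *m
      (map_mx F5 w *m map_mx (@polyC k) (map_mx frob Phi))^T =
    w *m map_mx (@polyC k) (gram A Phi) *m (map_mx F5 w)^T.
  by rewrite trmx_mul /g /gram !map_mxM -map_trmx !mulmxA.
rewrite mxE [RHS]exchange_big /=; apply: eq_bigr => j _; rewrite mxE mulr_suml.
apply: eq_bigr => i _; rewrite !mxE /F5 GRing.pFrobenius_autE -mul_polyC.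
by rewrite mulrA [_%:P * _]mulrC.
Qed.

Lemma meval_hermitian_form A Phi v :
  (hermitian_form A).@[(v *m Phi) 0] = (v *m gram A Phi *m (map_mx frob v)^T) 0 0.
Proof.
have -> : v *m gram A Phi *m (map_mx frob v)^T =
    v *m Phi *m A *m (map_mx frob (v *m Phi))^T.
  by rewrite map_mxM trmx_mul /gram !mulmxA.
set g := v *m Phi.
rewrite mxE raddf_sum; under eq_bigr do rewrite raddf_sum.
rewrite exchange_big /=; apply: eq_bigr => j _; rewrite mxE mulr_suml; apply: eq_bigr => i _ /=.
by rewrite mevalZ mevalM rmorphXn /= !mevalXU !mxE GRing.pFrobenius_autE mulrA [A i j * _]mulrC.
Qed.

(** Writing [x^6] as [x * x^5], with [x^5] additive, the pullback of the Fermat form along [g] has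
    the matrix [g^T] times the Frobenius twist of [g]. *)
Lemma hermitian_curveP (Gamma : curve k 6) : hermitian_curve Gamma ->
  exists A, [/\ A \in unitmx, forms Gamma (hermitian_form A) & hermitian_form A != 0].
Proof.
case=> g ug GE; exists (g^T *m map_mx frob g).
have uA : g^T *m map_mx frob g \in unitmx.
  by rewrite unitmx_mul unitmx_tr map_unitmx ug.
split=> //.
  have formE : hermitian_form (g^T *m map_mx frob g) =
      fermat_form k \mPo [tuple \sum_(j < 3) g i j *: 'X_j | i < 3].
    have char5_mpoly : 5%N \in [pchar {mpoly k[3]}].
      by rewrite inE /= -mpolyC_nat (pcharf0 char5) mpolyC0.
    rewrite /fermat_form raddf_sum /=.
    transitivity (\sum_i (\sum_l g i l *: 'X_l) * (\sum_j g i j ^+ 5 *: 'X_j ^+ 5) : {mpoly k[3]}).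
      under [RHS]eq_bigr do rewrite mulr_suml.
      rewrite exchange_big /=; apply: eq_bigr => l _.
      under [RHS]eq_bigr do rewrite mulr_sumr.
      rewrite exchange_big /=; apply: eq_bigr => j _.
      rewrite mxE scaler_suml; apply: eq_bigr => i _.
      by rewrite !mxE GRing.pFrobenius_autE -!mul_mpolyC mpolyCM; ring.
    apply: eq_bigr => i _; rewrite rmorphXn /= comp_mpolyXU -tnth_nth tnth_mktuple.
    rewrite [RHS]exprS -(GRing.pFrobenius_autE char5_mpoly) raddf_sum /=.
    congr (_ * _); apply: eq_bigr => j _.
    by rewrite GRing.pFrobenius_autE exprZn.
  rewrite formE GE; exists (fermat_form k) => //.
  by exists (fermat_dhomog k); rewrite ?memv_line.
(* In the basis [invmx g^T] the Gram matrix is the identity, so the form takes the value 1 at the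
   first basis vector. *)
apply/eqP => /(congr1 (meval ((row3 1 0 0 *m invmx g^T) 0))).
rewrite meval0 meval_hermitian_form.
have -> : gram (g^T *m map_mx frob g) (invmx g^T) = 1%:M.
  rewrite /gram mulmxA mulVmx ?unitmx_tr // mul1mx map_invmx trmx_inv -map_trmx.
  by rewrite trmxK mulmxV // map_unitmx.
rewrite mulmx1 map_row3 !(mxE, sum3) !rmorph0 !rmorph1 /=.
by move/eqP; rewrite !mulr0 !addr0 mulr1 oner_eq0.
Qed.

End Gram.

(** * Parametrization of a nonsingular conic through given points *)

Section ConicThroughPoints.
Variables (k : closedFieldType) (char5 : 5%N \in [pchar k]).
Implicit Types (S Phi : 'M[k]_3) (u v w : 'rV[k]_3).

Let two_neq0 := two_neq0 char5.

Lemma closed_sqrt n (a : k) : exists x, x ^+ n.+1 = a.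
Proof.
have : size ('X^(n.+1) - a%:P)%R != 1%N by rewrite size_XnsubC.
by move/closed_rootP => [x]; rewrite /root !hornerE subr_eq0 => /eqP; exists x.
Qed.

Definition polar S : 'M[k]_3 := S + S^T.

Lemma polar_sym S : (polar S)^T = polar S.
Proof. by rewrite /polar linearD /= trmxK addrC. Qed.

Lemma dot_sym S u v : (u *m polar S *m v^T) 0 0 = (v *m polar S *m u^T) 0 0.
Proof.
have -> : u *m polar S *m v^T = (v *m polar S *m u^T)^T.
  by rewrite !trmx_mul trmxK polar_sym mulmxA.
by rewrite mxE.
Qed.

Lemma meval_polar S v : (v *m polar S *m v^T) 0 0 = (quadratic_form S).@[v 0] *+ 2.
Proof.
rewrite meval_quadratic_form /polar mulmxDr mulmxDl mxE mulr2n; congr (_ + _).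
rewrite -[in RHS](trmxK (v *m S *m v^T)) [RHS]mxE !trmx_mul trmxK.
by rewrite mulmxA.
Qed.

Lemma quadratic_form_polar S : quadratic_form (polar S) = quadratic_form S *+ 2.
Proof.
rewrite mulr2n {3}/quadratic_form exchange_big -big_split; apply: eq_bigr => i _ /=.
rewrite -big_split; apply: eq_bigr => j _ /=.
by rewrite !mxE scalerDl ['X_j * _]mulrC.
Qed.

Lemma quadratic_form_coordinates S Phi : Phi \in unitmx ->
  quadratic_form S = (coordinates Phi *m map_mx (@mpolyC 3 k) (Phi *m S *m Phi^T) *m
    (coordinates Phi)^T) 0 0.
Proof.
move=> uPhi.
have XE : \row_i 'X_i = coordinates Phi *m map_mx (@mpolyC 3 k) Phi.
  by rewrite coordinatesE -mulmxA -map_mxM mulVmx // map_mx1 mulmx1.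
transitivity ((\row_i 'X_i *m map_mx (@mpolyC 3 k) S *m (\row_i 'X_i)^T) 0 0).
  rewrite mxE; under eq_bigr => j _ do rewrite mxE mulr_suml.
  rewrite exchange_big /=; apply: eq_bigr => i _; apply: eq_bigr => j _.
  by rewrite !mxE -mul_mpolyC; ring.
by rewrite XE !map_mxM trmx_mul -map_trmx !mulmxA.
Qed.

Lemma map_Kmx (R R' : comNzRingType) (f : {rmorphism R -> R'}) :
  map_mx f (Kmx R) = Kmx R'.
Proof.
apply/matrixP => i j; rewrite mxE; elim/ord3P: i; elim/ord3P: j;
  by rewrite !(row3E, mx3E) ?rmorph0 ?rmorph1 ?rmorphN ?rmorph_nat.
Qed.

Lemma quadratic_form_conic S Phi b : Phi \in unitmx ->
  Phi *m polar S *m Phi^T = b *: Kmx k -> quadratic_form S = b *: conic_form Phi.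
Proof.
move=> uPhi SE; apply: (mulIf (_ : 2 != 0 :> {mpoly k[3]})).
  by rewrite -mpolyC_nat mpolyC_eq0.
rewrite !mulr_natr scalerMnr q0_Kmx -quadratic_form_polar.
rewrite (quadratic_form_coordinates _ uPhi) SE map_mxZ map_Kmx.
by rewrite -scalemxAr -scalemxAl mxE mul_mpolyC.
Qed.

Lemma mderiv_quadratic_form S i v :
  ((quadratic_form S)^`M(i)).@[v 0] = (v *m polar S) 0 i.
Proof.
rewrite /polar mulmxDr mxE addrC !mxE.
transitivity (\sum_a \sum_b S a b * ((a == i)%:R * v 0 b + v 0 a * (b == i)%:R)).
  rewrite /quadratic_form (raddf_sum (mderiv i)) raddf_sum; apply: eq_bigr => a _.
  rewrite (raddf_sum (mderiv i)) raddf_sum; apply: eq_bigr => b _ /=.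
  have dX c : ('X_c^`M(i)).@[v 0] = (c == i)%:R.
    rewrite mderivX mevalZ mnm1E mevalX; case: eqVneq => [->|_]; last by rewrite mul0r.
    by rewrite big1 ?mulr1 // => j _; rewrite mnmBE subnn expr0.
  by rewrite mderivZ mevalZ mderivM mevalD !mevalM !mevalXU !dX.
transitivity (\sum_a \sum_b (S a b * (a == i)%:R * v 0 b + S a b * v 0 a * (b == i)%:R)).
  by apply: eq_bigr => a _; apply: eq_bigr => b _; ring.
under eq_bigr do rewrite big_split; rewrite big_split /=; congr (_ + _).
  rewrite (bigD1 i) //= [X in _ + X]big1 ?addr0 => [|a ai].
    by apply: eq_bigr => b _; rewrite eqxx mulr1 mxE mulrC.
  by rewrite big1 // => b _; rewrite (negbTE ai) mulr0 mul0r.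
apply: eq_bigr => a _; rewrite (bigD1 i) //= eqxx mulr1 big1 ?addr0; first by rewrite mulrC.
by move=> b bi; rewrite (negbTE bi) mulr0.
Qed.

Lemma sub_ker_line (M : 'M[k]_(2, 3)) u v : \rank M = 2%N ->
  u *m M^T = 0 -> v *m M^T = 0 -> v != 0 -> exists a, u = a *: v.
Proof.
move=> rM uM vM v0; apply/sub_rVP.
have ku : (u <= kermx M^T)%MS by apply/sub_kermxP.
have kv : (v <= kermx M^T)%MS by apply/sub_kermxP.
apply: (submx_trans ku).
have := mxrank_leqif_sup kv; rewrite mxrank_ker mxrank_tr rM rank_rV v0 => -[_ <-].
by [].
Qed.

(** Two distinct points of the conic give isotropic vectors of the polar form that span a hyperbolic
    plane. A suitably scaled vector orthogonal to this plane completes a basis in which the polar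
    form is a multiple of [Kmx]. *)
Lemma nonsingular_conic_frame (Q : curve k 2) u w :
  nonsingular Q -> u != 0 -> w != 0 -> pt u <> pt w -> pts Q (pt u) -> pts Q (pt w) ->
  exists Phi, [/\ Phi \in unitmx, Q = conic Phi, row 0 Phi = u & row 2%:R Phi = w].
Proof.
move=> nsQ u0 w0 uw Qu Qw.
have [h Qh h0] := forms_gen Q.
have [S0 hE] := quadratic_formE (forms_homog Qh).
pose S := polar S0.
have onQ v : v != 0 -> pts Q (pt v) <-> (v *m S *m v^T) 0 0 = 0.
  move=> v0; rewrite (pts_pt Qh h0 v0) hE /S meval_polar -mulr_natr.
  by split=> [->|/eqP]; rewrite ?mul0r // mulf_eq0 (negbTE two_neq0) orbF => /eqP.
have tan v : v != 0 -> pts Q (pt v) -> v *m S != 0.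
  move=> v0 /[dup] Qv /nsQ[f [x [i [Qf xv]]]]; apply: contra_neq => vS.
  have [c ->] := (formsP f Qh h0).1 Qf.
  move: xv; rewrite val_pt // => /vlineP[a ->].
  by rewrite mderivZ mevalZ hE mderiv_quadratic_form -/S -scalemxAl vS scaler0 mxE mulr0.
have scal (x y : 'rV[k]_3) : x *m y^T = ((x *m y^T) 0 0)%:M.
  exact: mx11_scalar.
have uSu := (onQ _ u0).1 Qu; have wSw := (onQ _ w0).1 Qw.
pose b := (u *m S *m w^T) 0 0.
have wSu : (w *m S *m u^T) 0 0 = b by rewrite /b /S dot_sym.
pose M2 (x y : 'rV[k]_3) : 'M[k]_(2, 3) := \matrix_(i, j) (if i == 0 then x else y) 0 j.
have orth (v x y : 'rV[k]_3) : (v *m x^T) 0 0 = 0 -> (v *m y^T) 0 0 = 0 -> v *m (M2 x y)^T = 0.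
  move=> vx vy; apply/rowP => -[[|[|//]] hi]; rewrite [RHS]mxE.
    by rewrite -[RHS]vx !mxE; apply: eq_bigr => j _; rewrite !mxE.
  by rewrite -[RHS]vy !mxE; apply: eq_bigr => j _; rewrite !mxE.
have M2E (x y : 'rV[k]_3) (z : 'rV[k]_2) : z *m M2 x y = z 0 0 *: x + z 0 1 *: y.
  apply/rowP => j; rewrite !mxE !big_ord_recl big_ord0 addr0 !mxE /=.
  by congr (_ + z 0 _ * _); apply: val_inj.
(* If [b] vanished, [u *m S] and [w *m S] would both annihilate [u] and [w], hence be proportional,
   and some [u - a *: w] would be a singular point of [Q]. *)
have bn0 : b != 0.
  apply/eqP => b_eq0.
  have rM : \rank (M2 u w) = 2%N.
    apply/eqP; apply: inj_row_free => z; rewrite M2E => zE.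
    have z1 : z 0 1 = 0.
      apply: contra_notP uw => /eqP z1; apply/esym/(eq_ptP w0 u0).
      exists (- (z 0 0 / z 0 1)); last first.
        apply: (scalerI z1); rewrite scalerA mulrN mulrCA divff // mulr1 scaleNr.
        by apply/eqP; rewrite -addr_eq0 addrC zE.
      apply/eqP => /eqP; rewrite oppr_eq0 mulf_eq0 invr_eq0 (negbTE z1) orbF => /eqP z0.
      by move: zE; rewrite z0 scale0r add0r => /eqP; rewrite scaler_eq0 (negbTE z1) (negbTE w0).
    move: zE; rewrite z1 scale0r addr0 => /eqP; rewrite scaler_eq0 (negbTE u0) orbF => /eqP z0.
    by apply/rowP => -[[|[|//]] hi]; rewrite [RHS]mxE; [rewrite -[RHS]z0|rewrite -[RHS]z1]; congr (z 0 _); apply: val_inj.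
  have [a aE] : exists a, u *m S = a *: (w *m S).
    by apply: (sub_ker_line rM); rewrite ?orth ?tan // ?wSu.
  have ua0 : u - a *: w != 0.
    rewrite subr_eq0; apply: contra_notN uw => /eqP uE; apply/(eq_ptP u0 w0); exists a => //.
    by apply: contra_neq u0 => a0; rewrite uE a0 scale0r.
  have uaS : (u - a *: w) *m S = 0 by rewrite mulmxBl -scalemxAl aE subrr.
  have /tan : pts Q (pt (u - a *: w)) by apply/onQ; rewrite // uaS mul0mx mxE.
  by move=> /(_ ua0); rewrite uaS eqxx.
pose N := M2 (u *m S) (w *m S).
have /rowV0Pn[v1] : kermx N^T != 0.
  by rewrite -mxrank_eq0 mxrank_ker mxrank_tr -lt0n subn_gt0 (leq_ltn_trans (rank_leq_row _)).
move=> /sub_kermxP v1N v1_0.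
have ST : S^T = S by exact: polar_sym.
have v1u : (v1 *m S *m u^T) 0 0 = 0.
  have := congr1 (fun M : 'rV[k]_2 => M 0 0) v1N; rewrite [RHS]mxE => <-.
  rewrite -{1}ST -mulmxA -trmx_mul !mxE; apply: eq_bigr => j _.
  by rewrite !mxE.
have v1w : (v1 *m S *m w^T) 0 0 = 0.
  have := congr1 (fun M : 'rV[k]_2 => M 0 1) v1N; rewrite [RHS]mxE => <-.
  rewrite -{1}ST -mulmxA -trmx_mul !mxE; apply: eq_bigr => j _.
  by rewrite !mxE.
have uv1 : (u *m S *m v1^T) 0 0 = 0 by rewrite /S dot_sym.
have wv1 : (w *m S *m v1^T) 0 0 = 0 by rewrite /S dot_sym.
have frame_unit (y : 'rV[k]_3) : y != 0 -> (y *m S *m u^T) 0 0 = 0 -> (y *m S *m w^T) 0 0 = 0 ->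
    mx3 u y w \in unitmx.
  move=> y0 yu yw; rewrite -row_free_unit; apply: inj_row_free => x.
  rewrite [x]row3P row3_mulmx !row_mx3 !row3E => xE.
  have dotx (z : 'rV[k]_3) : x 0 0 * (u *m S *m z^T) 0 0 + x 0 1 * (y *m S *m z^T) 0 0 +
      x 0 2%:R * (w *m S *m z^T) 0 0 = 0.
    transitivity (((x 0 0 *: u + x 0 1 *: y + x 0 2%:R *: w) *m S *m z^T) 0 0).
      by rewrite !mulmxDl -!scalemxAl !mxE.
    by rewrite xE !mul0mx mxE.
  have := dotx u; rewrite uSu yu wSu !mulr0 !add0r => /eqP.
  rewrite mulf_eq0 (negbTE bn0) orbF => /eqP x2.
  have := dotx w; rewrite wSw yw -/b !mulr0 !addr0 => /eqP.
  rewrite mulf_eq0 (negbTE bn0) orbF => /eqP x0.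
  move: xE; rewrite x0 x2 !scale0r add0r addr0 => /eqP; rewrite scaler_eq0 (negbTE y0) orbF.
  by move=> /eqP ->; apply/rowP; elim/ord3P; rewrite row3E mxE.
pose d := (v1 *m S *m v1^T) 0 0.
(* An isotropic [v1] would be orthogonal to the whole basis [u], [v1], [w], so it would be a
   singular point of [Q]. *)
have dn0 : d != 0.
  apply/eqP => d0; have Qv1 : pts Q (pt v1) by apply/onQ.
  move/eqP: (tan _ v1_0 Qv1); apply.
  have uF := frame_unit v1 v1_0 v1u v1w.
  have /(congr1 trmx) : v1 *m S *m (mx3 u v1 w)^T = 0.
    apply/rowP => j; rewrite [RHS]mxE; transitivity ((v1 *m S *m (row j (mx3 u v1 w))^T) 0 0).
      by rewrite !mxE; apply: eq_bigr => l _; rewrite !mxE.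
    by rewrite row_mx3; elim/ord3P: j; rewrite row3E.
  move=> /(congr1 (mulmx (invmx (mx3 u v1 w)))).
  by rewrite trmx_mul trmxK mulKmx // trmx0 mulmx0 => /(congr1 trmx); rewrite trmxK trmx0.
(* The scale for which [mu *: v1] has the value [- 2 b], the middle entry of [b *: Kmx k]. *)
have [mu muE] := closed_sqrt 1 (- 2%:R * b / d).
have mu0 : mu != 0.
  apply: contra_eq_neq muE => ->; rewrite expr0n /= eq_sym !mulf_neq0 ?invr_neq0 // oppr_eq0.
  exact: two_neq0.
pose y := mu *: v1.
have uPhi : mx3 u y w \in unitmx.
  apply: frame_unit; first by rewrite scaler_eq0 negb_or mu0.
    by rewrite -!scalemxAl mxE v1u mulr0.
  by rewrite -!scalemxAl mxE v1w mulr0.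
exists (mx3 u y w); split=> //; try by rewrite row_mx3 row3E.
have PhiS : mx3 u y w *m S *m (mx3 u y w)^T = b *: Kmx k.
  apply/matrixP => i j.
  transitivity ((row i (mx3 u y w) *m S *m (row j (mx3 u y w))^T) 0 0).
    rewrite -!row_mul !mxE; apply: eq_bigr => l _; by rewrite !mxE.
  have yE (z : 'rV[k]_3) : (y *m S *m z^T) 0 0 = mu * (v1 *m S *m z^T) 0 0.
    by rewrite -!scalemxAl mxE.
  have Ey (z : 'rV[k]_3) : (z *m S *m y^T) 0 0 = mu * (z *m S *m v1^T) 0 0.
    by rewrite linearZ /= -scalemxAr mxE.
  rewrite !row_mx3 [RHS]mxE; elim/ord3P: i; elim/ord3P: j; rewrite !(row3E, mx3E) ?mulr0 ?mulr1.
  - exact: uSu.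
  - by rewrite Ey uv1 mulr0.
  - by [].
  - by rewrite yE v1u mulr0.
  - by rewrite Ey yE mulrA -expr2 muE divfK // mulrC.
  - by rewrite yE v1w mulr0.
  - exact: wSu.
  - by rewrite Ey wv1 mulr0.
  - exact: wSw.
apply: curve_of_eq (conic_form_neq0 uPhi); apply/(formsP _ Qh h0); exists b^-1.
have -> : h = b *: conic_form (mx3 u y w).
  by rewrite hE; exact: quadratic_form_conic uPhi PhiS.
by rewrite scalerA mulVf // scale1r.
Qed.

(* A third point can be moved to the image of t = 1. *)
Lemma nonsingular_conic_frame3 (Q : curve k 2) P0 P1 P2 :
  nonsingular Q -> pts Q P0 -> pts Q P1 -> pts Q P2 ->
  P0 <> P1 -> P0 <> P2 -> P1 <> P2 ->
  exists Phi, [/\ Phi \in unitmx, Q = conic Phi, P0 = pt (row 0 Phi),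
    P1 = pt (row3 1 1 1 *m Phi) & P2 = pt (row 2%:R Phi)].
Proof.
have [u u0 ->] := ptP P0; have [w w0 ->] := ptP P2; have [v v0 ->] := ptP P1.
move=> nsQ Qu Qv Qw uv uw vw.
have [Phi [uPhi QE PhiE0 PhiE2]] := nonsingular_conic_frame nsQ u0 w0 uw Qu Qw.
pose x := v *m invmx Phi.
have vE : v = x *m Phi by rewrite mulmxKV.
have x0 : x != 0 by rewrite mulmx_neq0 ?unitmx_inv.
have qx : q0 x = 0 by apply/(pts_conic_mul uPhi x0); rewrite -vE -QE.
have [[t x00 xE]|xE] := q0P qx x0; last first.
  case: vw; apply/eq_ptP => //; exists (x 0 2%:R); last first.
    by rewrite {1}vE {1}xE -scalemxAl row3_mulmx expr0n /= mul0r !scale0r !add0r expr1n scale1r PhiE2.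
  by apply: contra_neq x0 => x2; rewrite xE x2 scale0r.
have t0 : t != 0.
  apply: contra_notN uv => /eqP t0; apply/esym/eq_ptP => //; exists (x 0 0) => //.
  by rewrite {1}vE {1}xE -scalemxAl row3_mulmx t0 expr0n mulr0 !scale0r !addr0 expr1n scale1r PhiE0.
have D0 : 1 * t - 0 * 0 != 0 by rewrite mul1r mul0r subr0.
exists (sym2 1 0 0 t *m Phi); split.
- by rewrite unitmx_mul sym2_unit.
- by rewrite conic_sym2 //; exact: two_neq0.
- rewrite row_mul row_mx3 row3E row3_mulmx expr1n mulr0 expr0n !scale0r !addr0 scale1r.
  by rewrite PhiE0.
- rewrite mulmxA -[row3 1 1 1](_ : par 1 1 = _); last by rewrite /par !expr1n mulr1.
  rewrite par_sym2 !mul1r addr0 add0r {1}vE {1}xE -scalemxAl ptZ // mulmx_neq0 //.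
  by apply: contra_neq x0 => p0; rewrite xE p0 scaler0.
rewrite row_mul row_mx3 row3E row3_mulmx mul0r expr0n !scale0r !add0r ptZ ?PhiE2 //.
by rewrite expf_neq0.
Qed.

End ConicThroughPoints.

(** * Frames of totally tangent conics *)

Section DoubleRoots.
Variables (k : closedFieldType) (char5 : 5%N \in [pchar k]).
Implicit Types (p : {poly k}).

Let natr_neq0 := natr_neq0 char5.

Lemma dvdp_double_roots p (rs : seq k) : uniq rs ->
  {in rs, forall r, ('X - r%:P) ^+ 2 %| p} ->
  (\prod_(r <- rs) ('X - r%:P)) ^+ 2 %| p.
Proof.
elim: rs => [|r rs IH] /=; first by rewrite big_nil expr1n dvd1p.
case/andP=> r_rs urs h; rewrite big_cons exprMn Gauss_dvdp.
  rewrite h ?mem_head // IH // => x x_rs; apply: h; rewrite in_cons x_rs orbT.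
  by [].
rewrite coprimep_expl // coprimep_expr // coprimep_sym coprimep_XsubC.
by rewrite root_prod_XsubC.
Qed.

(** By degree, [p] is a constant times [s ^+ 2], with [s] monic of degree five. Vanishing of the
    third derivative gives [s * s''' + 3 * s' * s'' = 0]. At each of the five simple roots of [s]
    this forces [s'' = 0], which is too many roots for a polynomial of degree at most three, so
    [s''] is zero. Then [s] has only terms of degrees 5, 1 and 0, and the roots 0 and 1 fix the last
    two. *)
Lemma double_root_shape p (rs : seq k) : (size p <= 11)%N -> p^`(3) = 0 ->
  uniq rs -> size rs = 5%N -> 0 \in rs -> 1 \in rs ->
  {in rs, forall r, ('X - r%:P) ^+ 2 %| p} ->
  exists c, p = c *: ('X^5 - 'X) ^+ 2.
Proof.
move=> sp p3 urs srs rs0 rs1 /(dvdp_double_roots urs).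
set s := \prod_(r <- rs) _ => /dvdpP[q pE].
have [p0|p0] := eqVneq p 0; first by exists 0; rewrite scale0r.
have ms : s \is monic by apply: monic_prod_XsubC.
have ss : size s = 6%N by rewrite size_prod_XsubC srs.
have ms2 : s ^+ 2 \is monic by rewrite monic_exp.
have ss2 : size (s ^+ 2) = 11%N by rewrite expr2 size_Mmonic ?monic_neq0 // ss.
have q0 : q != 0 by apply: contra_neq p0 => q0; rewrite pE q0 mul0r.
have [c qE] : exists c, q = c%:P.
  exists q`_0; apply: size1_polyC; move: sp; rewrite pE size_Mmonic // ss2 addnS /=.
  by rewrite -(leq_add2r 10 _ 1).
rewrite qE mul_polyC in pE.
have c0 : c != 0 by apply: contra_neq q0 => c0; rewrite qE c0.
have rs_root r : r \in rs -> root s r by rewrite root_prod_XsubC.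
have key : s * s^`(3) + s^`() * s^`(2) *+ 3 = 0.
  have : (s ^+ 2)^`(3) = 0.
    by move: p3; rewrite pE derivnZ => /eqP; rewrite scaler_eq0 (negbTE c0) => /eqP.
  rewrite /derivn /= expr2 !(derivM, derivD).
  set s1 := s^`(); set s2 := s1^`(); set s3 := s2^`() => h.
  apply: (mulIf (_ : 2 != 0 :> {poly k})).
    by rewrite -polyC_natr polyC_eq0 natr_neq0.
  rewrite mul0r -[RHS]h; ring.
have s2_root r : r \in rs -> root s^`(2) r.
  move=> r_rs; have := congr1 (horner_eval r) key.
  rewrite !horner_evalE hornerD hornerM hornerMn hornerM horner0.
  rewrite (rootP (rs_root r r_rs)) mul0r add0r -mulr_natr => /eqP.
  rewrite !mulf_eq0 (negbTE (natr_neq0 _)) // orbF => /orP[|//].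
  move=> /rootP; rewrite /s (big_rem r) //=; set g := \prod_(x <- rem r rs) _.
  rewrite derivM derivXsubC mul1r hornerD hornerM hornerXsubC subrr mul0r addr0.
  by move=> /rootP; rewrite root_prod_XsubC mem_rem_uniq // !inE eqxx.
have s2 : s^`(2) = 0.
  apply: contraTeq urs => s2_0; apply/negP => /(max_poly_roots s2_0).
  have -> : all (root s^`(2)) rs by apply/allP.
  move=> /(_ isT); rewrite srs ltnNge => /negP; apply.
  by apply/leq_sizeP => j hj; rewrite coef_derivn nth_default ?mul0rn // ss (leq_add2l 2 4) ltnW.
(* The second derivative multiplies the coefficient of degree [j] by [j (j - 1)], invertible modulo
   5 for these [j]; for [j = 5] the factor is 20. *)
have s_coef j : (j \in [:: 2; 3; 4])%N -> s`_j = 0.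
  move=> hj; have := congr1 (fun p : {poly k} => p`_(j - 2)%N) s2.
  rewrite coef_derivn coef0 subnKC; last by move: hj; rewrite !inE; case/or3P=> /eqP ->.
  rewrite -mulr_natr => /eqP; rewrite mulf_eq0 => /orP[/eqP //|].
  by rewrite (negbTE (natr_neq0 _)) //; move: hj; rewrite !inE; case/or3P=> /eqP ->.
have s0 : s`_0 = 0 by rewrite -horner_coef0; apply/rootP/rs_root.
have s5 : s`_5 = 1 by move: ms; rewrite monicE lead_coefE ss => /eqP.
have s1 : s`_1 = -1.
  have := rootP (rs_root 1 rs1); rewrite horner_coef ss.
  under eq_bigr do rewrite expr1n mulr1.
  rewrite !big_ord_recl big_ord0 /= s0 s5 /bump /= (s_coef 2) // (s_coef 3) // (s_coef 4) // !add0r !addr0.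
  by move=> /eqP; rewrite addr_eq0 => /eqP.
exists c; rewrite pE; congr (c *: _ ^+ 2); apply/polyP => j.
rewrite coefB coefXn coefX; case: j => [|[|[|[|[|[|j]]]]]] /=;
  rewrite ?s0 ?s1 ?s5 ?(s_coef 2) ?(s_coef 3) ?(s_coef 4) ?subrr ?sub0r ?subr0 //.
by rewrite nth_default // ss.
Qed.

End DoubleRoots.

(** The contact point [P2] is sent to infinity, while the other five receive finite parameters,
    those of [P0] and [P1] being 0 and 1. *)
Lemma uniq6_remove3 (T : eqType) (P0 P1 P2 P3 P4 P5 : T) :
  uniq [:: P0; P1; P2; P3; P4; P5] ->
  [/\ P0 <> P1, P0 <> P2, P1 <> P2, uniq [:: P0; P1; P3; P4; P5] &
    {in [:: P0; P1; P3; P4; P5], forall P,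
      P != P2 /\ P \in [:: P0; P1; P2; P3; P4; P5]}].
Proof.
move=> us; split; try by move=> E; move: us; rewrite /= E !inE eqxx ?orbT ?andbF.
  exact: subseq_uniq (mask_subseq [:: true; true; false; true; true; true] _) us.
move=> P; move: us; rewrite /= !inE !negb_or -!andbA.
case/andP=> _ /andP[n02 /andP[_ /andP[_ /andP[_ /andP[n12 /andP[_ /andP[_ /andP[_]]]]]]]].
case/andP=> n23 /andP[n24 /andP[n25 _]].
by case/or4P => [/eqP->|/eqP->|/eqP->|/orP[]/eqP->]; rewrite ?eqxx ?orbT //; split; rewrite // eq_sym.
Qed.

Section TangentConics.
Variables (k : closedFieldType) (char5 : 5%N \in [pchar k]).
Implicit Types (A G Phi S : 'M[k]_3) (u v w : 'rV[k]_3).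

Local Notation frob := (GRing.pFrobenius_aut char5).
Local Notation gram := (gram char5).
Let two_neq0 := two_neq0 char5.

Definition gram_poly G : {poly k} := \sum_(i < 3) \sum_(j < 3) G i j *: 'X^(i + 5 * j).

Lemma gram_polyE G : gram_poly G = G 0 0 *: 'X^0 + G 0 1 *: 'X^5 + G 0 2%:R *: 'X^10
  + (G 1 0 *: 'X^1 + G 1 1 *: 'X^6 + G 1 2%:R *: 'X^11)
  + (G 2%:R 0 *: 'X^2 + G 2%:R 1 *: 'X^7 + G 2%:R 2%:R *: 'X^12).
Proof. by rewrite /gram_poly !sum3. Qed.

Lemma coef_gram_poly G (i j : 'I_3) : (gram_poly G)`_(i + 5 * j) = G i j.
Proof.
rewrite gram_polyE !coefD !coefZ !coefXn.
by elim/ord3P: i; elim/ord3P: j; rewrite !eqxx /= !mulr0 !mulr1 ?addr0 ?add0r.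
Qed.

Lemma size_gram_poly G : G 1 2%:R = 0 -> G 2%:R 2%:R = 0 -> (size (gram_poly G) <= 11)%N.
Proof.
move=> G12 G22; apply/leq_sizeP => j hj.
rewrite gram_polyE G12 G22 !scale0r !coefD !coefZ !coefXn coef0 !gtn_eqF ?mulr0 ?addr0 //;
  exact: leq_trans hj.
Qed.

Lemma derivn3_gram_poly G : (gram_poly G)^`(3) = 0.
Proof.
have d n : (5 %| n ^_ 3)%N -> ('X^n)^`(3) = 0 :> {poly k}.
  by move=> n5; rewrite derivnXn -mulr_natr -polyC_natr; move: n5; rewrite (dvdn_pcharf char5) => /eqP ->; rewrite mulr0.
by rewrite gram_polyE !derivnD !derivnZ !d ?scaler0 ?addr0.
Qed.

Lemma along_hermitian_par A Phi (p : {poly k}) :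
  along (row3 1 p (p ^+ 2) *m map_mx (@polyC k) Phi) (hermitian_form A) =
  gram_poly (gram A Phi) \Po p.
Proof.
rewrite (along_hermitian_form char5) /gram_poly raddf_sum; apply: eq_bigr => i _.
rewrite raddf_sum; apply: eq_bigr => j _ /=.
have E (l : 'I_3) : row3 1 p (p ^+ 2) 0 l = p ^+ l.
  by elim/ord3P: l; rewrite row3E.
by rewrite comp_polyZ rmorphXn /= comp_polyX !E -exprM mulnC -exprD.
Qed.

Lemma along_local_branch A Phi :
  along (local_branch Phi 1) (hermitian_form A) = gram_poly (gram A Phi).
Proof.
by rewrite /local_branch scale1r along_hermitian_par comp_polyXr.
Qed.

Lemma along_conic_form Phi : Phi \in unitmx -> along (local_branch Phi 1) (conic_form Phi) = 0.
Proof.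
move=> uPhi; rewrite conic_form_branch /branch_form alongB alongZ alongM alongXn.
by rewrite !along_coordinate // !row3E !scale1r mul1r subrr.
Qed.

(** The substitution [t + r] moves the contact point of parameter [r] to [t = 0], the only place
    where multiplicities are computed. *)
Lemma gram_poly_translate A Phi r :
  gram_poly (gram A (sym2 1 r 0 1 *m Phi)) = gram_poly (gram A Phi) \Po ('X + r%:P).
Proof.
rewrite -along_local_branch -along_hermitian_par /local_branch scale1r map_mxM mulmxA.
congr (along (_ *m _) _); apply/rowP; elim/ord3P; rewrite !(row3E, mx3E, sum3, mxE);
  rewrite ?(rmorphD, rmorphM, rmorphXn, rmorph1, rmorph0, rmorphMn) /=; ring.
Qed.

Lemma sym2_swap : sym2 0 1 1 0 = mx3 (row3 0 0 1) (row3 0 1 0) (row3 1 0 0) :> 'M[k]_3.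
Proof.
by rewrite /sym2; congr mx3; congr row3; ring.
Qed.

Section Gamma.
Variables (A : 'M[k]_3) (Gamma : curve k 6).
Hypotheses (uA : A \in unitmx) (GammaA : forms Gamma (hermitian_form A)).
Hypothesis A_neq0 : hermitian_form A != 0.

Lemma gram_poly_dvd Phi : Phi \in unitmx ->
  intersection_multiplicity (pt (row 0 Phi)) (conic Phi) Gamma 2 ->
  'X^2 %| gram_poly (gram A Phi).
Proof.
move=> uPhi; rewrite -along_local_branch.
apply: (multiplicity2_dvd uPhi (conicP uPhi) GammaA (u0 := 1)).
by rewrite -conic_form_branch mul1r.
Qed.

Lemma par_neq0 r : par 1 r != 0 :> 'rV[k]_3.
Proof.
by apply/eqP => /rowP/(_ 0); rewrite row3E mxE expr1n => /eqP; rewrite oner_eq0.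
Qed.

Lemma eq_pt_mul Phi u v : Phi \in unitmx -> u != 0 -> v != 0 ->
  pt (u *m Phi) = pt (v *m Phi) <-> exists2 c, c != 0 & u = c *: v.
Proof.
move=> uPhi u0 v0; rewrite eq_ptP ?mulmx_neq0 //.
split=> -[c c0 E]; exists c => //; last by rewrite E -scalemxAl.
by rewrite -(mulmxK uPhi u) E -scalemxAl mulmxK.
Qed.

Lemma par_inj Phi r s : Phi \in unitmx ->
  pt (par 1 r *m Phi) = pt (par 1 s *m Phi) -> r = s.
Proof.
move=> uPhi /(eq_pt_mul uPhi (par_neq0 _) (par_neq0 _))[c c0 /rowP E].
have := E 0; have := E 1; rewrite !mxE /= !expr1n !mul1r mulr1 => -> <-.
by rewrite mul1r.
Qed.

Lemma row0_sym2 r Phi : row 0 (sym2 1 r 0 1 *m Phi) = par 1 r *m Phi.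
Proof. by rewrite row_mul row_mx3 row3E. Qed.

Lemma tangent_conic_frame Q : tangent_conics Gamma Q ->
  exists Phi, [/\ Phi \in unitmx, gram A Phi = Kmx k & Q = conic Phi].
Proof.
case=> nsQ [/card_seqP[s [us ss sP]] mult].
case: s us ss sP => [|P0 [|P1 [|P2 [|P3 [|P4 [|P5 [|]]]]]]] // us _ sP.
have in_s P : P \in [:: P0; P1; P2; P3; P4; P5] -> pts Q P /\ pts Gamma P.
  by move=> /sP.
have [n01 n02 n12 us5 in5] := uniq6_remove3 us.
have P_in i : (i < 6)%N -> nth P0 [:: P0; P1; P2; P3; P4; P5] i \in [:: P0; P1; P2; P3; P4; P5].
  by move=> hi; apply: (mem_nth P0).
have [Phi [uPhi QE PE0 PE1 PE2]] := nonsingular_conic_frame3 char5 nsQ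
  (in_s P0 (P_in 0%N isT)).1 (in_s P1 (P_in 1%N isT)).1 (in_s P2 (P_in 2%N isT)).1 n01 n02 n12.
pose G := gram A Phi.
have dvd r : pt (par 1 r *m Phi) \in [:: P0; P1; P2; P3; P4; P5] ->
    ('X - r%:P) ^+ 2 %| gram_poly G.
  move=> /sP /mult; rewrite QE -row0_sym2.
  have D0 : 1 * 1 - r * 0 != 0 :> k by rewrite mulr1 mulr0 subr0 oner_eq0.
  rewrite -(conic_sym2 two_neq0 D0 uPhi) => /gram_poly_dvd.
  rewrite unitmx_mul sym2_unit // => /(_ uPhi); rewrite gram_poly_translate -/G.
  move=> /dvdpP[q /(congr1 (comp_poly ('X - r%:P)))].
  rewrite -comp_polyA comp_polyD comp_polyX comp_polyC subrK comp_polyXr => ->.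
  by rewrite comp_polyM rmorphXn /= comp_polyX dvdp_mull.
(* Contact of order two at infinity, seen at 0 after exchanging the two ends of the parameter line,
   removes the terms in [t^12] and [t^11]. *)
have [G22 G12] : G 2%:R 2%:R = 0 /\ G 1 2%:R = 0.
  have : 'X^2 %| gram_poly (gram A (sym2 0 1 1 0 *m Phi)).
    have D0 : 0 * 0 - 1 * 1 != 0 :> k by rewrite mulr1 mulr0 sub0r oppr_eq0 oner_eq0.
    apply: gram_poly_dvd; first by rewrite unitmx_mul sym2_unit.
    rewrite (conic_sym2 two_neq0 D0 uPhi) -QE; apply: mult; apply/sP.
    rewrite row_mul sym2_swap row_mx3 row3E row3_mulmx !scale0r !add0r scale1r -PE2.
    exact: P_in 2%N isT.
  rewrite gram_mul -/G => /dvdpP[q /polyP E].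
  have colJ (M : 'M[k]_3) i :
      (M *m (map_mx frob (sym2 0 1 1 0))^T) i 0 = M i 2%:R.
    rewrite sym2_swap mxE sum3 ![_^T _ _]mxE ![map_mx _ _ _ _]mxE !mx3E !row3E.
    rewrite rmorph0 rmorph1.
    by rewrite !mulr0 mulr1 !add0r.
  have rowJ (M : 'M[k]_3) j : (sym2 0 1 1 0 *m M) 0 j = M 2%:R j /\
      (sym2 0 1 1 0 *m M) 1 j = M 1 j.
    by rewrite sym2_swap ![(_ *m _) _ _]mxE !sum3 !mx3E !row3E !mul0r !mul1r !addr0 !add0r.
  have := E 0%N; have := E 1%N; rewrite !coefMXn /=.
  rewrite (coef_gram_poly _ 0 0) (coef_gram_poly _ 1 0) !colJ.
  by rewrite (rowJ _ _).1 (rowJ _ _).2.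
have uG : G \in unitmx by exact: gram_unit.
have /choice[t tE] P : exists t, P != P2 -> P \in [:: P0; P1; P2; P3; P4; P5] ->
    P = pt (par 1 t *m Phi).
  have [v v0 ->] := ptP P; pose x := v *m invmx Phi.
  have vE : v = x *m Phi by rewrite mulmxKV.
  have x0 : x != 0 by rewrite mulmx_neq0 ?unitmx_inv.
  have [PP|/negP PP] := boolP (pt v \in [:: P0; P1; P2; P3; P4; P5]); last by exists 0.
  have qx : q0 x = 0.
    by apply/(pts_conic_mul uPhi x0); rewrite -vE -QE; have [] := in_s _ PP.
  have [[t x00 xE]|xE] := q0P qx x0.
    by exists t => _ _; rewrite vE xE -scalemxAl ptZ // mulmx_neq0 // par_neq0.
  exists 0 => /eqP []; rewrite PE2 vE xE -scalemxAl ptZ.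
  - by rewrite row3_mulmx expr0n mul0r !scale0r !add0r expr1n scale1r.
  - by apply: contra_neq x0 => x2; rewrite xE x2 scale0r.
  by rewrite mulmx_neq0 //; apply/eqP => /rowP/(_ 2%:R); rewrite row3E mxE expr1n => /eqP; rewrite oner_eq0.
pose s5 := [:: P0; P1; P3; P4; P5].
have ptE P : P \in s5 -> P = pt (par 1 (t P) *m Phi).
  by move=> /in5[]; exact: tE.
have par_row0 : par 1 0 *m Phi = row 0 Phi.
  by rewrite row3_mulmx mulr0 expr0n !scale0r !addr0 expr1n scale1r.
have par11 : par 1 1 = row3 1 1 1 :> 'rV[k]_3 by rewrite /par !expr1n mulr1.
have t0 : t P0 = 0.
  by apply: (par_inj uPhi); rewrite -ptE ?mem_head // par_row0.
have P1_in : P1 \in s5 by exact: (@mem_nth _ P0 s5 1).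
have t1 : t P1 = 1 by apply: (par_inj uPhi); rewrite -ptE ?par11.
have [c cE] : exists c, gram_poly G = c *: ('X^5 - 'X) ^+ 2.
  apply: (double_root_shape char5 (rs := map t s5)) => //.
  - exact: size_gram_poly.
  - exact: derivn3_gram_poly.
  - by rewrite map_inj_in_uniq // => P P' /ptE PE /ptE P'E tt; rewrite PE P'E tt.
  - by rewrite -t0 map_f ?mem_head.
  - by rewrite -t1 map_f.
  move=> r /mapP[P Ps5 ->]; apply: dvd; rewrite -ptE //.
  by have [] := in5 _ Ps5.
(* The nine exponents [i + 5 j] are distinct, so the polynomial [c (t^10 - 2 t^6 + t^2)] determines
   every entry of [G]. *)
have GE : G = c *: Kmx k.
  have sq : ('X^5 - 'X) ^+ 2 = 'X^10 - 'X^6 *+ 2 + 'X^2 :> {poly k} by ring.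
  apply/matrixP => i j; rewrite -coef_gram_poly cE sq mxE coefZ; congr (_ * _).
  rewrite !coefD coefN coefMn !coefXn.
  by elim/ord3P: i; elim/ord3P: j; rewrite !(row3E, mx3E) /= ?mul0rn ?oppr0 ?addr0 ?add0r.
have c0 : c != 0.
  by apply: contraTneq uG => c0; rewrite GE c0 scale0r unitmxE det0 unitr0.
(* A sixth root: because of the Frobenius twist, the scalar [mu] multiplies a Gram matrix by
   [mu^6]. *)
have [mu muE] := closed_sqrt 5 c^-1.
have mu0 : mu != 0 by apply: contra_eq_neq muE => ->; rewrite expr0n /= eq_sym invr_eq0.
have umu : (mu%:M : 'M[k]_3) \in unitmx.
  by rewrite unitmxE det_scalar unitfE expf_neq0.
exists (mu%:M *m Phi); split; first by rewrite unitmx_mul umu.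
- rewrite gram_mul -/G GE map_scalar_mx tr_scalar_mx mul_scalar_mx mul_mx_scalar !scalerA.
  by rewrite /= GRing.pFrobenius_autE -exprSr muE mulVf // scale1r.
rewrite QE (@conic_stab _ two_neq0 _ _ (mu ^+ 2)) ?expf_neq0 //.
by rewrite mul_scalar_mx tr_scalar_mx mul_mx_scalar scalerA.
Qed.

End Gamma.
End TangentConics.

(** * What a frame determines: contact points, multiplicities and tangent lines *)

Section Frames.
Variables (k : closedFieldType) (char5 : 5%N \in [pchar k]).
Implicit Types (A G Phi S : 'M[k]_3) (u v : 'rV[k]_3).

Local Notation frob := (GRing.pFrobenius_aut char5).
Local Notation gram := (gram char5).
Let natr_neq0 := natr_neq0 char5.
Let two_neq0 := two_neq0 char5.

Lemma frob_fixedP (t : k) : t ^+ 5 = t <-> exists2 i, (i < 5)%N & t = i%:R.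
Proof.
split=> [t5|[i _ ->]]; last by rewrite -(GRing.pFrobenius_autE char5) rmorph_nat.
have five0 : 5%:R = 0 :> k by exact: pcharf0 char5.
have /eqP : t * (t - 1) * (t - 2%:R) * (t - 3%:R) * (t - 4%:R) = 0.
  have -> : t * (t - 1) * (t - 2%:R) * (t - 3%:R) * (t - 4%:R) =
    t ^+ 5 - t + 5%:R * (- 2%:R * t ^+ 4 + 7%:R * t ^+ 3 - 10%:R * t ^+ 2 + 5%:R * t) by ring.
  by rewrite t5 five0 mul0r subrr addr0.
rewrite !mulf_eq0 !subr_eq0 -!orbA.
by case/or4P => [/eqP->|/eqP->|/eqP->|/orP[]/eqP->];
  [exists 0|exists 1|exists 2|exists 3|exists 4].
Qed.

Definition base_points : seq 'rV[k]_3 :=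
  par 0 1 :: [seq par 1 i%:R | i <- iota 0 5].

Lemma base_pointsP x : x \in base_points ->
  x = par 0 1 \/ exists2 i, (i < 5)%N & x = par 1 i%:R.
Proof.
rewrite in_cons => /orP[/eqP->|/mapP[i]]; first by left.
by rewrite mem_iota => i5 ->; right; exists i.
Qed.

Lemma natr5_inj i j : (i < 5)%N -> (j < 5)%N -> i%:R = j%:R :> k -> i = j.
Proof.
wlog ij : i j / (i <= j)%N => [H i5 j5 E|i5 j5 E].
  by case/orP: (leq_total i j) => h; [exact: H|apply/esym/H].
apply/eqP; rewrite eqn_leq ij /= -subn_eq0; apply: contraT => ji.
have := @natr_neq0 (j - i)%N; rewrite natrB // E subrr eqxx; apply.
by apply: contra ji => /dvdn_leq; case: (j - i)%N (leq_ltn_trans (leq_subr i j) j5) => // n n5 /(_ isT); rewrite leqNgt n5.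
Qed.

Lemma par01_neq0 : par 0 1 != 0 :> 'rV[k]_3.
Proof.
by apply/eqP => /rowP/(_ 2%:R); rewrite row3E mxE expr1n => /eqP; rewrite oner_eq0.
Qed.

Lemma base_points_neq0 x : x \in base_points -> x != 0.
Proof.
by move=> /base_pointsP[->|[i _ ->]]; [exact: par01_neq0|exact: par_neq0].
Qed.

Lemma base_points_inj Phi : Phi \in unitmx ->
  {in base_points &, injective (fun x => pt (x *m Phi))}.
Proof.
move=> uPhi x y xb yb.
move=> /(eq_pt_mul uPhi (base_points_neq0 xb) (base_points_neq0 yb))[c c0 xy].
suff c1 : c = 1 by rewrite xy c1 scale1r.
move: xb yb xy => /base_pointsP[->|[i _ ->]] /base_pointsP[->|[j _ ->]] /rowP E.
- by have := E 2%:R; rewrite !(row3E, mxE) !expr1n mulr1 => <-.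
- by have := E 0; rewrite !(row3E, mxE) expr0n expr1n mulr1 /= => c0'; rewrite -c0' eqxx in c0.
- by have := E 0; rewrite !(row3E, mxE) expr0n expr1n mulr0 /= => /eqP; rewrite oner_eq0.
- by have := E 0; rewrite !(row3E, mxE) !expr1n mulr1 => <-.
Qed.

Lemma base_points_uniq : uniq base_points.
Proof.
rewrite cons_uniq map_inj_in_uniq ?iota_uniq ?andbT.
  apply/negP => /mapP[i _ /rowP/(_ 0)]; rewrite !row3E expr0n expr1n => /eqP.
  by rewrite eq_sym oner_eq0.
move=> i j; rewrite !mem_iota => i5 j5 /rowP/(_ 1); rewrite !row3E !mul1r.
exact: natr5_inj.
Qed.

Lemma gram_poly_Kmx : gram_poly (Kmx k) = ('X^5 - 'X) ^+ 2.
Proof.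
by rewrite gram_polyE !(mx3E, row3E) !scale0r !scale1r scaleNr scaler_nat; ring.
Qed.

Lemma mderiv_linear_form (c : 'rV[k]_3) i v :
  ((linear_form c)^`M(i)).@[v 0] = c 0 i.
Proof.
rewrite /linear_form (raddf_sum (mderiv i)) raddf_sum (bigD1 i) //= big1 ?addr0.
  by rewrite mderivZ mevalZ mderivX mevalZ mnm1E eqxx mul1r mevalX big1 ?mulr1 // => j _; rewrite mnmBE subnn expr0.
by move=> j ji; rewrite mderivZ mevalZ mderivX mevalZ mnm1E (negbTE ji) mul0r mulr0.
Qed.

(** In the frame the gradient at [x] is [x *m Kmx k], and [Kmx] is invertible because 2 is
    nonzero. *)
Lemma conic_nonsingular Phi : Phi \in unitmx -> nonsingular (conic Phi).
Proof.
move=> uPhi P; have [v v0 ->] := ptP P => _.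
pose x := v *m invmx Phi.
have [i ni] : exists i, (invmx Phi *m (x *m Kmx k)^T) i 0 != 0.
  apply/existsP; apply: contraT; rewrite negb_exists => /forallP h.
  suff : x == 0 by rewrite -(negbK (x == 0)) mulmx_neq0 ?unitmx_inv.
  have : (x *m Kmx k)^T = 0.
    rewrite -(mulKVmx uPhi (x *m Kmx k)^T); apply/eqP.
    rewrite -[X in _ == X](mulmx0 _ Phi); apply/eqP; congr (_ *m _).
    by apply/colP => i; rewrite [RHS]mxE; apply/eqP; rewrite -[_ == _]negbK h.
  move=> /(congr1 trmx); rewrite trmxK trmx0 => /(congr1 (mulmx^~ (invmx (Kmx k)))).
  by rewrite mulmxK ?Kmx_unit // mul0mx => ->.
exists (conic_form Phi), v, i; split=> //; first exact: conicP.
  by rewrite val_pt ?memv_line.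
move: ni; congr (_ != _); rewrite conic_form_branch /branch_form scale1r expr2.
rewrite mderivB !mderivM mevalB !mevalD !mevalM !mderiv_linear_form !meval_coordinate -/x.
rewrite [LHS]mxE sum3 ![_^T _ _]mxE ![(_ *m Kmx k) _ _]mxE !sum3 !mx3E !row3E ![col _ _ _ _]mxE.
by rewrite !mxE; ring.
Qed.

Section Gamma.
Variables (A : 'M[k]_3) (Gamma : curve k 6).
Hypotheses (uA : A \in unitmx) (GammaA : forms Gamma (hermitian_form A)).
Hypothesis A_neq0 : hermitian_form A != 0.

Definition frame Phi := Phi \in unitmx /\ gram A Phi = Kmx k.

Lemma pts_Gamma Phi v : frame Phi -> v != 0 ->
  pts Gamma (pt (v *m Phi)) <->
  v 0 0 * v 0 2%:R ^+ 5 - v 0 1 ^+ 6 *+ 2 + v 0 2%:R * v 0 0 ^+ 5 = 0.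
Proof.
move=> [uPhi gPhi] v0; rewrite (pts_pt GammaA A_neq0) ?mulmx_neq0 //.
rewrite (meval_hermitian_form char5) gPhi Kmx_form ![map_mx _ _ _ _]mxE.
by rewrite /= !GRing.pFrobenius_autE [v 0 1 ^+ 6]exprS.
Qed.

Lemma frame_stab S Phi : S \in unitmx -> S *m Kmx k *m (map_mx frob S)^T = Kmx k ->
  frame Phi -> frame (S *m Phi).
Proof.
by move=> uS SK [uPhi gPhi]; split; rewrite ?unitmx_mul ?uS // gram_mul gPhi.
Qed.

Lemma frob_sym2 a b c d : a ^+ 5 = a -> b ^+ 5 = b -> c ^+ 5 = c -> d ^+ 5 = d ->
  map_mx frob (sym2 a b c d) = sym2 a b c d.
Proof.
move=> a5 b5 c5 d5; apply/matrixP => i j; rewrite mxE.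
elim/ord3P: i; elim/ord3P: j; rewrite !(mx3E, row3E) ?(rmorphD, rmorphM, rmorphXn, rmorphMn) /=
  !GRing.pFrobenius_autE ?a5 ?b5 ?c5 ?d5 //.
Qed.

Lemma frame_sym2 a b c d Phi : a ^+ 5 = a -> b ^+ 5 = b -> c ^+ 5 = c -> d ^+ 5 = d ->
  (a * d - b * c) ^+ 2 = 1 -> frame Phi ->
  frame (sym2 a b c d *m Phi) /\ conic (sym2 a b c d *m Phi) = conic Phi.
Proof.
move=> a5 b5 c5 d5 D1 fPhi.
have D0 : a * d - b * c != 0 by rewrite -sqrf_eq0 D1 oner_eq0.
split; last by apply: conic_sym2 => //; case: fPhi.
by apply: frame_stab => //; rewrite ?sym2_unit // frob_sym2 // sym2_Kmx D1 scale1r.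
Qed.

(** At parameter [t] the equation of Gamma becomes [(t^5 - t)^2 = 0], whose roots are the elements
    of the prime field; infinity is the sixth point. *)
Lemma six_points Phi P : frame Phi ->
  (pts (conic Phi) `&` pts Gamma) P <-> exists2 x, x \in base_points & P = pt (x *m Phi).
Proof.
move=> fPhi; have [uPhi _] := fPhi; split=> [|[x]].
  have [v v0 ->] := ptP P; pose x := v *m invmx Phi.
  have -> : v = x *m Phi by rewrite mulmxKV.
  have x0 : x != 0 by rewrite mulmx_neq0 ?unitmx_inv.
  case=> /(pts_conic_mul uPhi x0) qx Gx.
  have [[t x00 xE]|xE] := q0P qx x0; last first.
    exists (par 0 1); first exact: mem_head.
    rewrite {1}xE -scalemxAl ptZ ?mulmx_neq0 ?par01_neq0 //.
    by apply: contra_neq x0 => x2; rewrite xE x2 scale0r.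
  move: Gx; rewrite xE -scalemxAl ptZ ?mulmx_neq0 ?par_neq0 // (pts_Gamma fPhi) ?par_neq0 // !row3E.
  move=> tE; have /frob_fixedP[i i5 ->] : t ^+ 5 = t.
    apply/eqP; rewrite -subr_eq0 -sqrf_eq0 -tE; apply/eqP; ring.
  exists (par 1 i%:R) => //; rewrite in_cons; apply/orP; right.
  by apply/mapP; exists i; rewrite ?mem_iota.
rewrite in_cons => /orP[/eqP->|/mapP[i _ ->]] ->.
  split; first by apply/pts_conic_mul; rewrite ?par01_neq0 // /q0 !row3E; ring.
  by apply/(pts_Gamma fPhi); rewrite ?par01_neq0 // !row3E; ring.
split; first by apply/pts_conic_mul; rewrite ?par_neq0 // /q0 !row3E; ring.
apply/(pts_Gamma fPhi); rewrite ?par_neq0 // !row3E.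
have i5 : i%:R ^+ 5 = i%:R :> k by rewrite -(GRing.pFrobenius_autE char5) rmorph_nat.
transitivity ((i%:R ^+ 5 - i%:R) ^+ 2 : k); first by ring.
by rewrite i5 subrr expr0n.
Qed.

(** A parameter change over F_5 of determinant 1 or -1 preserves both the conic and the Gram matrix,
    and these move any contact point to parameter 0. Local statements then need proof only at the
    first row of a frame. *)
Lemma frame_at Phi x : frame Phi -> x \in base_points ->
  exists Phi', [/\ frame Phi', conic Phi' = conic Phi & pt (x *m Phi) = pt (row 0 Phi')].
Proof.
move=> fPhi; have n5 i : i%:R ^+ 5 = i%:R :> k by rewrite -(GRing.pFrobenius_autE char5) rmorph_nat.
rewrite in_cons => /orP[/eqP->|/mapP[i _ ->]].
  have [|fP cP] := @frame_sym2 0 1 1 0 Phi (n5 0%N) (n5 1%N) (n5 1%N) (n5 0%N) _ fPhi.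
    by ring.
  exists (sym2 0 1 1 0 *m Phi); split; [exact: fP|exact: cP|congr pt].
  by rewrite row_mul row_mx3 row3E /par; congr (row3 _ _ _ *m _); ring.
have [|fP cP] := @frame_sym2 1 i%:R 0 1 Phi (n5 1%N) (n5 i) (n5 0%N) (n5 1%N) _ fPhi.
  by ring.
exists (sym2 1 i%:R 0 1 *m Phi); split; [exact: fP|exact: cP|congr pt].
by rewrite row0_sym2.
Qed.

Lemma frame_multiplicity2 Phi : frame Phi ->
  intersection_multiplicity (pt (row 0 Phi)) (conic Phi) Gamma 2.
Proof.
move=> [uPhi gPhi].
have br : branch_form Phi 1 = 1 * conic_form Phi by rewrite mul1r conic_form_branch.
have E : along (local_branch Phi 1) (hermitian_form A) = ('X^4 - 1) ^+ 2 * 'X^2.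
  by rewrite (along_local_branch char5) gPhi gram_poly_Kmx; ring.
apply: (local_multiplicity uPhi (conicP uPhi) GammaA (conic_form_neq0 uPhi) A_neq0
  (along_conic_form uPhi) br E).
by rewrite -horner_coef0 !hornerE expr0n /= sub0r sqrrN expr1n oner_eq0.
Qed.

(** The tangent at the first row is [z = 0]. Along [(1 : t : 0)], the branch with [eps = 0], the
    Hermitian form restricts to [- 2 t^6]. *)
Lemma frame_weierstrass Phi : frame Phi -> weierstrass Gamma (pt (row 0 Phi)).
Proof.
move=> fPhi; have [uPhi gPhi] := fPhi.
have z0 : coordinate Phi 2%:R != 0.
  apply/eqP => /(congr1 (meval ((row 2%:R Phi) 0))).
  rewrite meval_coordinate -row_mul mulmxV // meval0 !mxE eqxx => /eqP.
  by rewrite oner_eq0.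
have Lz := curve_ofP (coordinate_homog Phi 2%:R) z0.
have r0 := row0_neq0 uPhi.
exists (curve_of 1 (coordinate Phi 2%:R)).
  split=> [|f v].
    have -> : row 0 Phi = row3 1 0 0 *m Phi.
      by rewrite row3_mulmx scale1r !scale0r !addr0.
    apply/(pts_Gamma fPhi); last by rewrite !row3E; ring.
    by apply/eqP => /rowP/(_ 0); rewrite row3E mxE => /eqP; rewrite oner_eq0.
  move=> /(formsP _ GammaA A_neq0)[c ->]; rewrite val_pt // => /vlineP[a ->].
  apply/(formsP _ Lz z0); exists (c * a ^+ 5).
  (* Fifth powers have zero derivative, so only the linear factor of each term contributes to the
     gradient. *)
  have dE i (v' : 'rV[k]_3) : ((hermitian_form A)^`M(i)).@[v' 0] = (A *m (map_mx frob v')^T) i 0.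
    transitivity (\sum_l \sum_j A l j * ((l == i)%:R * v' 0 j ^+ 5)).
      rewrite /hermitian_form (raddf_sum (mderiv i)) raddf_sum; apply: eq_bigr => l _.
      rewrite (raddf_sum (mderiv i)) raddf_sum; apply: eq_bigr => j _ /=.
      rewrite mderivZ mevalZ.
      have -> : ('X_l * 'X_j ^+ 5 : {mpoly k[3]})^`M(i) = 'X_l^`M(i) * 'X_j ^+ 5.
        have X5 : ('X_j ^+ 5 : {mpoly k[3]})^`M(i) = 0.
          by rewrite mpolyXn mderivX mulmnE mulnC natrM (pcharf0 char5) mul0r scale0r.
        by rewrite mderivM X5 mulr0 addr0.
      rewrite mevalM rmorphXn /= mevalXU; congr (_ * (_ * _)).
      rewrite mderivX mevalZ mnm1E mevalX; case: eqVneq => [->|_]; last by rewrite mul0r.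
      by rewrite big1 ?mulr1 // => j' _; rewrite mnmBE subnn expr0.
    rewrite mxE (bigD1 i) //= [X in _ + X]big1 ?addr0 => [|l li].
      by apply: eq_bigr => j _; rewrite eqxx mul1r !mxE /= GRing.pFrobenius_autE.
    by rewrite big1 // => j _; rewrite (negbTE li) mul0r mulr0.
  have K0 (i : 'I_3) : (gram A Phi *m (row3 1 0 0)^T) i 0 = (i == 2%:R)%:R.
    rewrite gPhi mxE sum3 ![_^T _ _]mxE !row3E !mulr0 mulr1 !addr0 mx3E.
    by elim/ord3P: i; rewrite !row3E.
  transitivity (c * a ^+ 5 *: \sum_i (A *m (map_mx frob (row 0 Phi))^T) i 0 *: 'X_i : {mpoly k[3]}).
    rewrite [RHS]scaler_sumr; apply: eq_bigr => i _; rewrite mderivZ mevalZ dE scalerA; congr (_ *: _).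
    rewrite map_mxZ /= GRing.pFrobenius_autE linearZ /= -scalemxAr mxE; ring.
  congr (_ *: _).
  transitivity ((\row_i 'X_i *m map_mx (@mpolyC 3 k) (A *m (map_mx frob (row 0 Phi))^T)) 0 0).
    by rewrite mxE; apply: eq_bigr => i _; rewrite ![X in _ = X * _]mxE ![X in _ = _ * X]mxE mulrC mul_mpolyC.
  have -> : A *m (map_mx frob (row 0 Phi))^T = invmx Phi *m (gram A Phi *m (row3 1 0 0)^T).
    rewrite /gram !mulmxA mulVmx // mul1mx -mulmxA -trmx_mul; congr (_ *m _^T).
    rewrite row3_mulmx scale1r !scale0r !addr0.
    by apply/rowP => i; rewrite !mxE.
  rewrite map_mxM mulmxA -coordinatesE mxE sum3 ![map_mx _ _ _ _]mxE !K0 /=.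
  by rewrite !mpolyC0 mpolyC1 !mulr0 !add0r mulr1 mxE.
have ev0 : along (local_branch Phi 0) (coordinate Phi 2%:R) = 0.
  by rewrite along_coordinate // row3E scale0r.
have br : branch_form Phi 0 = coordinate Phi 0 * coordinate Phi 2%:R.
  by rewrite /branch_form scale0r subr0.
have E : along (local_branch Phi 0) (hermitian_form A) = (- 2%:R)%:P * 'X^6.
  rewrite (along_hermitian_form char5) gPhi !sum3 !(mx3E, row3E) !scale0r !scale1r.
  by rewrite -mul_polyC; ring.
apply: (local_multiplicity uPhi Lz GammaA z0 A_neq0 ev0 br E).
by rewrite coefC /= oppr_eq0; exact: two_neq0.
Qed.

Lemma frame_tangent Phi : frame Phi -> tangent_conics Gamma (conic Phi).
Proof.
move=> fPhi; have [uPhi _] := fPhi; split; first exact: conic_nonsingular.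
split=> [|P]; last first.
  move=> /(six_points _ fPhi)[x /(frame_at fPhi)[Phi' [fPhi' <- ->]] ->].
  exact: frame_multiplicity2.
apply/card_seqP; exists [seq pt (x *m Phi) | x <- base_points].
split=> [||P]; [|by rewrite size_map|].
  by rewrite map_inj_in_uniq ?base_points_uniq //; exact: base_points_inj.
split=> [/(six_points _ fPhi)[x xb ->]|/mapP[x xb ->]].
  by apply/mapP; exists x.
by apply/(six_points _ fPhi); exists x.
Qed.

Lemma tangent_conic_frameP Q : tangent_conics Gamma Q <->
  exists2 Phi, frame Phi & Q = conic Phi.
Proof.
split=> [/(tangent_conic_frame char5 uA GammaA)[Phi [uPhi gPhi QE]]|[Phi fPhi ->]].
  by exists Phi.
exact: frame_tangent.
Qed.

End Gamma.
End Frames.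

(** * Matrices over the field with 25 elements *)

(** An enumerated type with explicit tables, so that the exhaustive checks below evaluate quickly by
    [vm_compute]. *)
Variant f5 := f0 | f1 | f2 | f3 | f4.

Definition f5_add (x y : f5) : f5 := match x with
  | f0 => match y with f0 => f0 | f1 => f1 | f2 => f2 | f3 => f3 | f4 => f4 end
  | f1 => match y with f0 => f1 | f1 => f2 | f2 => f3 | f3 => f4 | f4 => f0 end
  | f2 => match y with f0 => f2 | f1 => f3 | f2 => f4 | f3 => f0 | f4 => f1 end
  | f3 => match y with f0 => f3 | f1 => f4 | f2 => f0 | f3 => f1 | f4 => f2 end
  | f4 => match y with f0 => f4 | f1 => f0 | f2 => f1 | f3 => f2 | f4 => f3 end
  end.

Definition f5_mul (x y : f5) : f5 := match x with
  | f0 => match y with f0 => f0 | f1 => f0 | f2 => f0 | f3 => f0 | f4 => f0 end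
  | f1 => match y with f0 => f0 | f1 => f1 | f2 => f2 | f3 => f3 | f4 => f4 end
  | f2 => match y with f0 => f0 | f1 => f2 | f2 => f4 | f3 => f1 | f4 => f3 end
  | f3 => match y with f0 => f0 | f1 => f3 | f2 => f1 | f3 => f4 | f4 => f2 end
  | f4 => match y with f0 => f0 | f1 => f4 | f2 => f3 | f3 => f2 | f4 => f1 end
  end.

Definition f5_opp (x : f5) : f5 :=
  match x with f0 => f0 | f1 => f4 | f2 => f3 | f3 => f2 | f4 => f1 end.

Definition f5_eq0 (x : f5) : bool := if x is f0 then true else false.

Definition f5_all (P : f5 -> bool) := [&& P f0, P f1, P f2, P f3 & P f4].

Definition f5_has (P : f5 -> bool) := [|| P f0, P f1, P f2, P f3 | P f4].

Definition nat_of_f5 (x : f5) : nat :=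
  match x with f0 => 0 | f1 => 1 | f2 => 2 | f3 => 3 | f4 => 4 end.

Definition f5_of_nat (n : nat) : f5 := nth f0 [:: f0; f1; f2; f3; f4] n.

Lemma nat_of_f5K : cancel nat_of_f5 f5_of_nat. Proof. by case. Qed.

HB.instance Definition _ := Equality.copy f5 (can_type nat_of_f5K).

(* GF a b is a + b w, where w^2 = 2. *)
Variant gf := GF of f5 & f5.

Definition gf_pair (x : gf) := let: GF a b := x in (a, b).
Definition gf_of_pair (p : f5 * f5) := GF p.1 p.2.

Lemma gf_pairK : cancel gf_pair gf_of_pair. Proof. by case. Qed.

HB.instance Definition _ := Equality.copy gf (can_type gf_pairK).

Definition gf_add (x y : gf) : gf :=
  let: GF a b := x in let: GF c d := y in GF (f5_add a c) (f5_add b d).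
Definition gf_mul (x y : gf) : gf :=
  let: GF a b := x in let: GF c d := y in
  GF (f5_add (f5_mul a c) (f5_mul f2 (f5_mul b d)))
     (f5_add (f5_mul a d) (f5_mul b c)).
Definition gf_opp (x : gf) : gf := let: GF a b := x in GF (f5_opp a) (f5_opp b).
(** This is the fifth power, since [w^5 = 4 w = - w]. *)
Definition gf_conj (x : gf) : gf := let: GF a b := x in GF a (f5_opp b).
Definition gf_eq0 (x : gf) : bool := let: GF a b := x in f5_eq0 a && f5_eq0 b.
Definition gf_of (a : f5) : gf := GF a f0.
Definition gf_enum : seq gf :=
  let s := [:: f0; f1; f2; f3; f4] in [seq GF a b | a <- s, b <- s].
Definition gf_all (P : gf -> bool) := f5_all (fun a => f5_all (fun b => P (GF a b))).

Declare Scope gf_scope.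
Delimit Scope gf_scope with gf.
Bind Scope gf_scope with gf.
Notation "x + y" := (gf_add x y) : gf_scope.
Notation "x * y" := (gf_mul x y) : gf_scope.
Notation "- x" := (gf_opp x) : gf_scope.
Notation "x - y" := (gf_add x (gf_opp y)) : gf_scope.
Notation "0" := (GF f0 f0) : gf_scope.
Notation "1" := (GF f1 f0) : gf_scope.

Definition gf_eq (x y : gf) := gf_eq0 (x - y)%gf.

Variant gf_vec := GV of gf & gf & gf.
Variant gf_mat := GM of gf_vec & gf_vec & gf_vec.

Definition gv_triple (v : gf_vec) := let: GV x y z := v in (x, y, z).
Definition gv_of_triple (t : gf * gf * gf) := GV t.1.1 t.1.2 t.2.
Lemma gv_tripleK : cancel gv_triple gv_of_triple. Proof. by case. Qed.
HB.instance Definition _ := Equality.copy gf_vec (can_type gv_tripleK).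

Definition gm_triple (M : gf_mat) := let: GM u v w := M in (u, v, w).
Definition gm_of_triple (t : gf_vec * gf_vec * gf_vec) := GM t.1.1 t.1.2 t.2.
Lemma gm_tripleK : cancel gm_triple gm_of_triple. Proof. by case. Qed.
HB.instance Definition _ := Equality.copy gf_mat (can_type gm_tripleK).

Definition gm1 := GM (GV 1 0 0) (GV 0 1 0) (GV 0 0 1).

Definition gv_mul (v : gf_vec) (M : gf_mat) : gf_vec :=
  let: GV x y z := v in
  let: GM (GV a b c) (GV d e f) (GV g h i) := M in
  GV (x * a + y * d + z * g)%gf (x * b + y * e + z * h)%gf (x * c + y * f + z * i)%gf.

Definition gm_mul (M N : gf_mat) : gf_mat :=
  let: GM u v w := M in GM (gv_mul u N) (gv_mul v N) (gv_mul w N).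

Definition gv_q0 (v : gf_vec) : gf := let: GV x y z := v in (x * z - y * y)%gf.

Definition gv_herm (u v : gf_vec) : gf :=
  let: GV a b c := u in let: GV x y z := v in
  (a * gf_conj z - gf_of f2 * (b * gf_conj y) + c * gf_conj x)%gf.

Definition gv_dot (u v : gf_vec) : gf :=
  let: GV a b c := u in let: GV x y z := v in (a * x + b * y + c * z)%gf.

Definition gv_cross (u v : gf_vec) : gf_vec :=
  let: GV a b c := u in let: GV x y z := v in
  GV (b * z - c * y)%gf (c * x - a * z)%gf (a * y - b * x)%gf.

(* K M^* K^-1, where M^* is the conjugate transpose. *)
Definition gm_inv (M : gf_mat) : gf_mat :=
  let: GM (GV a b c) (GV d e f) (GV g h i) := M in
  GM (GV (gf_conj i) (gf_of f2 * gf_conj f) (gf_conj c))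
     (GV (gf_of f3 * gf_conj h) (gf_conj e) (gf_of f3 * gf_conj b))
     (GV (gf_conj g) (gf_of f2 * gf_conj d) (gf_conj a)).

(** Preservation of the Hermitian form with matrix [Kmx]; the constant [f3] is its middle entry
    -2. *)
Definition gm_unitary (M : gf_mat) : bool :=
  let: GM u v w := M in
  [&& gf_eq0 (gv_herm u u), gf_eq0 (gv_herm u v), gf_eq (gv_herm u w) 1
    & [&& gf_eq0 (gv_herm v u), gf_eq (gv_herm v v) (gf_of f3), gf_eq0 (gv_herm v w)
    & [&& gf_eq (gv_herm w u) 1, gf_eq0 (gv_herm w v) & gf_eq0 (gv_herm w w)]]].

Definition gv_bil (u v : gf_vec) : gf :=
  let: GV a b c := u in let: GV x y z := v in
  (a * z - gf_of f2 * (b * y) + c * x)%gf.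

(* M K M^T is a nonzero multiple of K, i.e. M preserves the conic xz = y^2. *)
Definition gm_stab (M : gf_mat) : bool :=
  let: GM u v w := M in
  [&& gf_eq0 (gv_bil u u), gf_eq0 (gv_bil u v), ~~ gf_eq0 (gv_bil u w),
      gf_eq0 (gv_bil v v + gf_of f2 * gv_bil u w)%gf, gf_eq0 (gv_bil v w)
    & gf_eq0 (gv_bil w w)].

Definition gm_sym2 (a b c d : f5) : gf_mat :=
  let: (a, b, c, d) := (gf_of a, gf_of b, gf_of c, gf_of d) in
  GM (GV (a * a)%gf (a * b)%gf (b * b)%gf)
     (GV (a * c + a * c)%gf (a * d + b * c)%gf (b * d + b * d)%gf)
     (GV (c * c)%gf (c * d)%gf (d * d)%gf).

Definition gv_par (t : gf) := GV 1 t (t * t)%gf.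

Definition gf_points : seq gf_vec :=
  GV 0 0 1 :: [seq gv_par (gf_of t) | t <- [:: f0; f1; f2; f3; f4]].

(* Found by a computer search: frames, relative to a frame of Q, of the conics in
   the component of Q; Q comes first and then the ten conics adjacent to it. *)
Definition gf_conics : seq gf_mat := [::
  GM (GV (GF f1 f0) (GF f0 f0) (GF f0 f0)) (GV (GF f0 f0) (GF f1 f0) (GF f0 f0)) (GV (GF f0 f0) (GF f0 f0) (GF f1 f0));
  GM (GV (GF f1 f0) (GF f0 f0) (GF f0 f1)) (GV (GF f0 f0) (GF f1 f0) (GF f0 f0)) (GV (GF f0 f4) (GF f0 f0) (GF f4 f0));
  GM (GV (GF f0 f1) (GF f0 f0) (GF f4 f0)) (GV (GF f0 f0) (GF f4 f0) (GF f0 f0)) (GV (GF f1 f0) (GF f0 f0) (GF f0 f4));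
  GM (GV (GF f1 f0) (GF f0 f1) (GF f3 f2)) (GV (GF f2 f4) (GF f4 f2) (GF f2 f4)) (GV (GF f3 f1) (GF f3 f1) (GF f2 f2));
  GM (GV (GF f1 f0) (GF f0 f1) (GF f3 f3)) (GV (GF f2 f4) (GF f4 f2) (GF f0 f1)) (GV (GF f3 f2) (GF f0 f1) (GF f0 f3));
  GM (GV (GF f1 f0) (GF f0 f2) (GF f2 f2)) (GV (GF f3 f2) (GF f4 f1) (GF f4 f1)) (GV (GF f4 f0) (GF f4 f2) (GF f2 f2));
  GM (GV (GF f1 f0) (GF f0 f2) (GF f2 f3)) (GV (GF f0 f2) (GF f4 f0) (GF f2 f0)) (GV (GF f3 f3) (GF f2 f0) (GF f3 f0));
  GM (GV (GF f1 f0) (GF f0 f3) (GF f2 f2)) (GV (GF f0 f3) (GF f4 f0) (GF f2 f0)) (GV (GF f3 f2) (GF f2 f0) (GF f3 f0));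
  GM (GV (GF f1 f0) (GF f0 f3) (GF f2 f3)) (GV (GF f3 f3) (GF f4 f4) (GF f4 f4)) (GV (GF f4 f0) (GF f4 f3) (GF f2 f3));
  GM (GV (GF f1 f0) (GF f0 f4) (GF f3 f2)) (GV (GF f2 f1) (GF f4 f3) (GF f0 f4)) (GV (GF f3 f3) (GF f0 f4) (GF f0 f2));
  GM (GV (GF f1 f0) (GF f0 f4) (GF f3 f3)) (GV (GF f1 f1) (GF f4 f4) (GF f4 f3)) (GV (GF f1 f1) (GF f1 f1) (GF f3 f2));
  GM (GV (GF f2 f2) (GF f0 f1) (GF f2 f4)) (GV (GF f4 f2) (GF f4 f2) (GF f1 f3)) (GV (GF f4 f4) (GF f3 f1) (GF f0 f1));
  GM (GV (GF f2 f3) (GF f0 f2) (GF f3 f4)) (GV (GF f1 f3) (GF f4 f1) (GF f0 f2)) (GV (GF f0 f3) (GF f4 f2) (GF f3 f2));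
  GM (GV (GF f2 f3) (GF f0 f3) (GF f3 f4)) (GV (GF f0 f1) (GF f4 f0) (GF f4 f0)) (GV (GF f3 f4) (GF f2 f0) (GF f1 f3));
  GM (GV (GF f2 f2) (GF f0 f4) (GF f2 f4)) (GV (GF f4 f1) (GF f4 f3) (GF f2 f3)) (GV (GF f4 f3) (GF f0 f4) (GF f1 f1));
  GM (GV (GF f2 f0) (GF f4 f4) (GF f2 f1)) (GV (GF f3 f1) (GF f1 f3) (GF f3 f1)) (GV (GF f4 f2) (GF f3 f3) (GF f4 f0));
  GM (GV (GF f2 f1) (GF f2 f4) (GF f0 f4)) (GV (GF f0 f3) (GF f1 f2) (GF f1 f3)) (GV (GF f2 f3) (GF f3 f1) (GF f4 f1));
  GM (GV (GF f1 f2) (GF f4 f1) (GF f4 f0)) (GV (GF f2 f0) (GF f3 f4) (GF f3 f2)) (GV (GF f4 f2) (GF f1 f0) (GF f1 f2));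
  GM (GV (GF f3 f4) (GF f3 f0) (GF f2 f4)) (GV (GF f1 f2) (GF f1 f1) (GF f4 f4)) (GV (GF f4 f0) (GF f4 f1) (GF f1 f2));
  GM (GV (GF f4 f3) (GF f2 f0) (GF f4 f2)) (GV (GF f0 f2) (GF f0 f4) (GF f0 f2)) (GV (GF f3 f4) (GF f4 f0) (GF f3 f1));
  GM (GV (GF f1 f2) (GF f2 f1) (GF f0 f2)) (GV (GF f0 f1) (GF f1 f3) (GF f2 f4)) (GV (GF f1 f1) (GF f3 f4) (GF f3 f3))].

Definition gf_neighbours : seq gf_mat := take 10 (behead gf_conics).

Fixpoint pairs (T : Type) (s : seq T) : seq (T * T) :=
  if s is x :: s' then [seq (x, y) | y <- s'] ++ pairs s' else [::].

(* The number of common points on Gamma of the conics of frames M Phi and N Phi. *)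
Definition meets (M N : gf_mat) : nat :=
  count (fun v => gf_eq0 (gv_q0 (gv_mul (gv_mul v N) (gm_inv M)))) gf_points.

Definition common_secants (M : gf_mat) : nat :=
  let ps := [seq gv_mul v M | v <- gf_points] in
  count (fun p => let c := gv_cross p.1 p.2 in
                  (1 < count (fun v => gf_eq0 (gv_dot v c)) ps)%N) (pairs gf_points).

(* Representatives of SL(2,5), acting on the conic xz = y^2, modulo the torus. *)
Definition sl2 : seq gf_mat :=
  flatten [seq [:: gm_sym2 f1 b f0 f1; gm_sym2 f1 b f1 (f5_add f1 b);
     gm_sym2 f1 b f2 (f5_add f1 (f5_mul b f2));
     gm_sym2 f1 b f3 (f5_add f1 (f5_mul b f3));
     gm_sym2 f1 b f4 (f5_add f1 (f5_mul b f4)); gm_sym2 f0 f1 f4 b]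
   | b <- [:: f0; f1; f2; f3; f4]].

Definition gv_prop (u v : gf_vec) : bool :=
  let: GV x y z := gv_cross u v in [&& gf_eq0 x, gf_eq0 y & gf_eq0 z].

(** Double transitivity on the six base points: every ordered pair occurs, up to scalars, as the
    first and last rows of a matrix in the list. *)
Definition check_sl2 : bool :=
  all (fun u => all (fun v => (u == v) || has (fun s => let: GM a _ c := s in
    gv_prop u a && gv_prop v c) sl2) gf_points) gf_points.

Definition check_secants : bool :=
  all (fun p => all (fun q => let c := gv_cross p.1 p.2 in
    gf_eq0 (gv_dot q.1 c) && gf_eq0 (gv_dot q.2 c) ==>
    (p == q)) (pairs gf_points)) (pairs gf_points).

Definition in_conics (M : gf_mat) : bool :=
  has (fun N => gm_stab (gm_mul M (gm_inv N))) gf_conics.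

(* Up to a scalar, an isotropic vector is (1, 0, 0) or of the form (x, y, 1). *)
Definition check_cover : bool :=
  let inv := map gm_inv gf_conics in
  let covered v := has (fun N => gf_eq0 (gv_q0 (gv_mul v N))) inv in
  covered (GV 1 0 0) &&
  gf_all (fun y => gf_all (fun x => let v := GV x y 1 in
    if gf_eq0 (gv_herm v v) then covered v else true)).

Definition check_closed : bool :=
  all (fun M => all (fun N => in_conics (gm_mul N M)) gf_neighbours) gf_conics.

(** Two steps suffice: besides the conic itself and its ten neighbours there are ten conics at
    distance two. *)
Definition check_connected : bool :=
  all (fun M => gm_stab M || has (fun N => has (fun N' =>
     gm_stab (gm_mul M (gm_inv N)) ||
     gm_stab (gm_mul M (gm_inv (gm_mul N' N)))) gf_neighbours) gf_neighbours) gf_conics.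

(** Together with [check_cover] this says that the 21 sets of six contact points partition the 126
    isotropic points. Hence the meeting numbers of any tangent conic with the 21 conics add up to 6,
    as in 3 times 2, in 2 + 4, and in 6 times 1. *)
Definition check_disjoint : bool :=
  all (fun p => meets p.1 p.2 == 0) (pairs gf_conics).

Definition check_neighbours : bool :=
  all (fun N => [&& common_secants N == 3, ~~ gf_eq0 (gv_q0 (gv_mul (GV 0 0 1) N))
    & count (fun t => gf_eq0 (gv_q0 (gv_mul (gv_par t) N))) gf_enum == 4]) gf_neighbours.

(* For M = ((p,0,q),(0,1,0),(u,0,w)), q0 (par 1 t M) = a + b t^2 + c t^4. *)
Definition check_adjacency (p q u w : gf) : bool :=
  let M := GM (GV p 0 q) (GV 0 1 0) (GV u 0 w) in
  let: (a, b, c) := (p * q, p * w + q * u - 1, u * w)%gf in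
  if common_secants M == 3 then
    [&& ~~ [&& gf_eq0 a, gf_eq0 b & gf_eq0 c]
      & if [|| gf_eq0 a, gf_eq0 c | gf_eq0 (b * b + a * c)%gf] then true
        else all (fun s => has (fun N => gm_stab (gm_mul (gm_mul M s) (gm_inv N)))
               gf_neighbours) sl2]
  else true.

Definition check_adjacent : bool :=
  gf_all (fun p => gf_all (fun q =>
    if gf_eq0 (p * gf_conj q + q * gf_conj p)%gf then
      gf_all (fun u => gf_all (fun w =>
        if gf_eq (p * gf_conj w + q * gf_conj u)%gf 1 then
          if gf_eq0 (u * gf_conj w + w * gf_conj u)%gf then check_adjacency p q u w
          else true
        else true))
    else true)).

(* Representatives of the nonzero elements of F_25 modulo those of F_5. *)
Definition gf_classes : seq gf :=
  GF f0 f1 :: [seq GF f1 b | b <- [:: f0; f1; f2; f3; f4]].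

(** For nonzero [c] in F_5 the cube is the inverse, so this is [diag (c, 1, 1/c)]; as [c] is fixed
    by conjugation, the conic and the Hermitian form are both preserved. *)
Definition gm_torus (c : f5) : gf_mat :=
  GM (GV (gf_of c) 0 0) (GV 0 1 0) (GV 0 0 (gf_of (f5_mul c (f5_mul c c)))).

Definition check_torus : bool :=
  gf_all (fun l => gf_eq0 l ||
    has (fun c => has (fun l' => gf_eq (gf_of c * l) l')%gf gf_classes) [:: f1; f2; f3; f4]).

(** The lines [l F_5] and [l w F_5] span F_25 over F_5, so adding a suitable multiple [2 d l]
    cancels the component of [p] along the first. *)
Definition check_shear : bool :=
  all (fun l => gf_all (fun p => f5_has (fun d => f5_has (fun e =>
    gf_eq (gf_of (f5_mul f2 d) * l + p) (l * GF f0 e)))))%gf gf_classes.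

(** Rows belong to the conics of the first component and columns to those of the second. The contact
    points and the inverses are shared among entries to keep the evaluation cheap. *)
Definition meeting_table (M : gf_mat) : seq (seq nat) :=
  let ps := [seq [seq gv_mul v (gm_mul N M) | v <- gf_points] | N <- gf_conics] in
  [seq [seq count (fun v => gf_eq0 (gv_q0 (gv_mul v N'))) p | p <- ps]
     | N' <- map gm_inv gf_conics].

Definition occurs (i : nat) (s : seq nat) := count (pred1 i) s.
Definition is_alpha s := (occurs 2 s == 3) && (occurs 0 s == 18).
Definition is_beta s := [&& occurs 2 s == 1, occurs 1 s == 4 & occurs 0 s == 16].
Definition is_gamma s := (occurs 1 s == 6) && (occurs 0 s == 15).

Definition verdict (t : seq (seq nat)) : bool :=
  [|| all is_beta t, all is_gamma t,
     (count is_alpha t == 15) && (count is_gamma t == 6)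
   | (count is_alpha t == 3) && (count is_gamma t == 18)].

(* The matrices left after the reductions by check_torus and check_shear. *)
Definition check_types : bool :=
  all (fun l => f5_all (fun e => gf_all (fun z => if gf_eq (l * gf_conj z) 1 then
    gf_all (fun y => let u := GV l 0 0 in let v := GV (l * GF f0 e) 1 0 in
      if gf_eq0 (gv_herm v (GV 0 y z)) then
        gf_all (fun x => let M := GM u v (GV x y z) in
          if gm_unitary M then
            if in_conics M then true else verdict (meeting_table M)
          else true)
      else true)
    else true)))%gf gf_classes.

Lemma f5_allP (P : f5 -> bool) : f5_all P -> forall x, P x.
Proof. by case/and5P=> ? ? ? ? ? []. Qed.

Lemma f5_hasP (P : f5 -> bool) : f5_has P -> exists x, P x.
Proof. by case/or4P => [?|?|?|/orP[]?]; eexists; eassumption. Qed.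

Lemma gf_allP (P : gf -> bool) : gf_all P -> forall x, P x.
Proof. by move=> h [a b]; exact: f5_allP (f5_allP h a) b. Qed.

(** * The finite field and its matrices inside [k] *)

Section Embedding.
Variables (k : closedFieldType) (char5 : 5%N \in [pchar k]).
Variables (w : k) (w2 : w ^+ 2 = 2).

Local Notation frob := (GRing.pFrobenius_aut char5).
Let two_neq0 := two_neq0 char5.

Lemma five_eq0 : 5%:R = 0 :> k. Proof. exact: pcharf0 char5. Qed.

Definition f5_emb (x : f5) : k := (nat_of_f5 x)%:R.
Definition gf_emb (x : gf) : k := let: GF a b := x in f5_emb a + f5_emb b * w.
Definition gv_emb (v : gf_vec) : 'rV[k]_3 :=
  let: GV x y z := v in row3 (gf_emb x) (gf_emb y) (gf_emb z).
Definition gm_emb (M : gf_mat) : 'M[k]_3 :=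
  let: GM a b c := M in mx3 (gv_emb a) (gv_emb b) (gv_emb c).

Lemma natr_mod5 n : (n %% 5)%:R = n%:R :> k.
Proof. by rewrite [in RHS](divn_eq n 5) natrD natrM five_eq0 mulr0 add0r. Qed.

Lemma f5_embD x y : f5_emb (f5_add x y) = f5_emb x + f5_emb y.
Proof. by rewrite /f5_emb -natrD -[RHS]natr_mod5; case: x; case: y. Qed.

Lemma f5_embM x y : f5_emb (f5_mul x y) = f5_emb x * f5_emb y.
Proof. by rewrite /f5_emb -natrM -[RHS]natr_mod5; case: x; case: y. Qed.

Lemma f5_embN x : f5_emb (f5_opp x) = - f5_emb x.
Proof.
apply/eqP; rewrite -addr_eq0 -f5_embD; apply/eqP.
by rewrite (_ : f5_add _ _ = f0) //; case: x.
Qed.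

Lemma f5_emb_eq0 x : (f5_emb x == 0) = f5_eq0 x.
Proof.
by rewrite /f5_emb; case: x; rewrite ?eqxx //= -(dvdn_pcharf char5).
Qed.

Lemma f5_emb_frob x : f5_emb x ^+ 5 = f5_emb x.
Proof. by rewrite -(GRing.pFrobenius_autE char5) rmorph_nat. Qed.

Lemma gf_embD x y : gf_emb (x + y)%gf = gf_emb x + gf_emb y.
Proof. by case: x y => [a b] [c d]; rewrite /= !f5_embD; ring. Qed.

Lemma gf_embM x y : gf_emb (x * y)%gf = gf_emb x * gf_emb y.
Proof.
case: x y => [a b] [c d]; rewrite /gf_mul /gf_emb !(f5_embD, f5_embM).
have -> : f5_emb f2 = w ^+ 2 by rewrite w2.
ring.
Qed.

Lemma gf_embN x : gf_emb (- x)%gf = - gf_emb x.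
Proof. by case: x => [a b]; rewrite /= !f5_embN; ring. Qed.

Lemma gf_emb_of x : gf_emb (gf_of x) = f5_emb x.
Proof. by rewrite /= mul0r addr0. Qed.

Lemma gf_emb0 : gf_emb 0%gf = 0. Proof. by rewrite /= mul0r addr0. Qed.
Lemma gf_emb1 : gf_emb 1%gf = 1. Proof. by rewrite /= mul0r addr0. Qed.
Lemma gf_emb2 : gf_emb (gf_of f2) = 2. Proof. by rewrite gf_emb_of. Qed.
Lemma gf_emb3 : gf_emb (gf_of f3) = - 2.
Proof.
by rewrite gf_emb_of; apply/eqP; rewrite -subr_eq0 opprK -natrD five_eq0.
Qed.

Lemma w_frob : w ^+ 5 = - w.
Proof.
rewrite (exprD w 1 4) expr1 (exprM w 2 2) w2; apply/eqP; rewrite -subr_eq0 opprK.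
have -> : w * 2 ^+ 2 + w = 5%:R * w by ring.
by rewrite five_eq0 mul0r.
Qed.

Lemma gf_emb_conj x : gf_emb (gf_conj x) = gf_emb x ^+ 5.
Proof.
case: x => a b; rewrite /= -(GRing.pFrobenius_autE char5) rmorphD rmorphM /=.
by rewrite !GRing.pFrobenius_autE !f5_emb_frob w_frob f5_embN mulrN mulNr.
Qed.

Definition gf_embE := (gf_embD, gf_embM, gf_embN, gf_emb_conj, gf_emb0, gf_emb1, gf_emb2, gf_emb3).

(** If [a + b w = 0], the fifth power gives [a - b w = 0]; the sum and the nonvanishing of 2 and [w]
    yield [a = b = 0]. *)
Lemma gf_emb_eq0 x : (gf_emb x == 0) = gf_eq0 x.
Proof.
apply/idP/idP => [/eqP x0|]; last first.
  by case: x => a b; rewrite /= -!f5_emb_eq0 => /andP[/eqP-> /eqP->]; rewrite mul0r addr0.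
have := gf_emb_conj x; rewrite x0 expr0n /= => cx0.
case: x x0 cx0 => a b /= x0; rewrite f5_embN => cx0.
have a0 : f5_emb a = 0.
  apply: (mulIf two_neq0); rewrite mul0r.
  transitivity ((f5_emb a + f5_emb b * w) + (f5_emb a + - f5_emb b * w)); first by ring.
  by rewrite x0 cx0 addr0.
move: x0; rewrite -!f5_emb_eq0 a0 eqxx add0r /= => /eqP; rewrite mulf_eq0 => /orP[//|/eqP w0].
by move: two_neq0; rewrite -w2 w0 expr0n eqxx.
Qed.

Lemma gf_eqP x y : reflect (gf_emb x = gf_emb y) (gf_eq x y).
Proof.
by rewrite /gf_eq -gf_emb_eq0 gf_embD gf_embN subr_eq0; exact: eqP.
Qed.

Lemma gf_eq0P x : reflect (gf_emb x = 0) (gf_eq0 x).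
Proof. by rewrite -gf_emb_eq0; exact: eqP. Qed.

Lemma gf_emb_inj : injective gf_emb.
Proof.
by move=> x y /gf_eqP; rewrite /gf_eq; case: x y => a b [c d]; case: a; case: c => //; case: b; case: d.
Qed.

Lemma f5_emb_surj (x : k) : x ^+ 5 = x -> exists y, f5_emb y = x.
Proof.
move=> /(frob_fixedP char5)[i i5 ->]; exists (f5_of_nat i).
by case: i i5 => [|[|[|[|[|]]]]].
Qed.

(** If [x = a + b w], then [x^5 = a - b w]. Therefore [a = 3 (x + x^5)], as 3 is one half modulo 5,
    and [b = (x^5 - x) w], as [- 2 b w^2 = - 4 b = b]. *)
Lemma gf_emb_surj (x : k) : x ^+ 25 = x -> exists y, gf_emb y = x.
Proof.
move=> x25.
have F25 : (x ^+ 5) ^+ 5 = x by rewrite -exprM.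
have n5 n : n%:R ^+ 5 = n%:R :> k by rewrite -(GRing.pFrobenius_autE char5) rmorph_nat.
have [|a aE] := @f5_emb_surj (3%:R * (x + x ^+ 5)).
  rewrite exprMn n5 -(GRing.pFrobenius_autE char5) rmorphD /= !GRing.pFrobenius_autE F25.
  by ring.
have [|b bE] := @f5_emb_surj ((x ^+ 5 - x) * w).
  rewrite exprMn w_frob -(GRing.pFrobenius_autE char5) rmorphB /= !GRing.pFrobenius_autE F25.
  by ring.
exists (GF a b); rewrite /= aE bE; apply/eqP; rewrite -subr_eq0; apply/eqP.
transitivity (5%:R * x ^+ 5 + (x ^+ 5 - x) * (w ^+ 2 - 2)); first by ring.
by rewrite w2 five_eq0 subrr mulr0 mul0r addr0.
Qed.

Lemma gv_emb_mul v M : gv_emb (gv_mul v M) = gv_emb v *m gm_emb M.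
Proof.
case: v M => x y z [[a b c] [d e f] [g h i]].
rewrite /gv_mul /gm_emb /gv_emb.
by apply/rowP; elim/ord3P; rewrite [RHS]mxE sum3 !(mx3E, row3E) !gf_embE.
Qed.

Lemma gm_emb_mul M N : gm_emb (gm_mul M N) = gm_emb M *m gm_emb N.
Proof.
case: M => u v z; apply/row_matrixP => i; rewrite row_mul !row_mx3.
by elim/ord3P: i; rewrite !row3E gv_emb_mul.
Qed.

Lemma gf_emb_q0 v : gf_emb (gv_q0 v) = q0 (gv_emb v).
Proof. by case: v => x y z; rewrite /q0 /gv_emb !row3E !gf_embE expr2. Qed.

Lemma gf_emb_dot u v : gf_emb (gv_dot u v) = (gv_emb u *m (gv_emb v)^T) 0 0.
Proof.
by case: u v => [a b c] [x y z]; rewrite /gv_emb mxE sum3 ![_^T _ _]mxE !row3E !gf_embE.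
Qed.

Lemma gf_emb_herm u v :
  gf_emb (gv_herm u v) = (gv_emb u *m Kmx k *m (map_mx frob (gv_emb v))^T) 0 0.
Proof.
case: u v => [a b c] [x y z]; rewrite /gv_emb Kmx_form map_row3 !row3E !GRing.pFrobenius_autE.
by rewrite !gf_embE; ring.
Qed.

Lemma gf_emb_bil u v : gf_emb (gv_bil u v) = (gv_emb u *m Kmx k *m (gv_emb v)^T) 0 0.
Proof.
by case: u v => [a b c] [x y z]; rewrite /gv_emb Kmx_form !row3E !gf_embE; ring.
Qed.

Lemma gm_unitaryP M : reflect
  (gm_emb M *m Kmx k *m (map_mx frob (gm_emb M))^T = Kmx k) (gm_unitary M).
Proof.
case: M => u v z; set X := gm_emb _.
have XE i j : (X *m Kmx k *m (map_mx frob X)^T) i j =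
    gf_emb (gv_herm (nth z [:: u; v] i) (nth z [:: u; v] j)).
  rewrite gf_emb_herm; transitivity ((row i X *m Kmx k *m (map_mx frob (row j X))^T) 0 0).
    by rewrite -!row_mul !mxE; apply: eq_bigr => l _; rewrite !mxE.
  by rewrite !row_mx3; elim/ord3P: i; elim/ord3P: j; rewrite !row3E.
apply: (iffP idP) => [|E].
  case/and4P=> /gf_eq0P h1 /gf_eq0P h2 /gf_eqP h3 /and4P[/gf_eq0P h4 /gf_eqP h5 /gf_eq0P h6].
  case/and3P=> /gf_eqP h7 /gf_eq0P h8 /gf_eq0P h9; apply/matrixP => i j; rewrite XE.
  by elim/ord3P: i; elim/ord3P: j; rewrite !(mx3E, row3E) /= ?h1 ?h2 ?h3 ?h4 ?h5 ?h6 ?h7 ?h8 ?h9 ?gf_emb1 ?gf_emb3.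
have {}XE (i j : 'I_3) : gf_emb (gv_herm (nth z [:: u; v] i) (nth z [:: u; v] j)) = Kmx k i j.
  by rewrite -XE E.
apply/and4P; split; [apply/gf_eq0P|apply/gf_eq0P|apply/gf_eqP|apply/and4P; split].
- by rewrite (XE 0 0) !(mx3E, row3E).
- by rewrite (XE 0 1) !(mx3E, row3E).
- by rewrite (XE 0 2%:R) !(mx3E, row3E) gf_emb1.
- by apply/gf_eq0P; rewrite (XE 1 0) !(mx3E, row3E).
- by apply/gf_eqP; rewrite (XE 1 1) !(mx3E, row3E) gf_emb3.
- by apply/gf_eq0P; rewrite (XE 1 2%:R) !(mx3E, row3E).
apply/and3P; split; [apply/gf_eqP|apply/gf_eq0P|apply/gf_eq0P].
- by rewrite (XE 2%:R 0) !(mx3E, row3E) gf_emb1.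
- by rewrite (XE 2%:R 1) !(mx3E, row3E).
- by rewrite (XE 2%:R 2%:R) !(mx3E, row3E).
Qed.

Lemma gm_stabP M : gm_stab M -> exists2 c, c != 0 &
  gm_emb M *m Kmx k *m (gm_emb M)^T = c *: Kmx k.
Proof.
case: M => u v z; set X := gm_emb _.
have XE i j : (X *m Kmx k *m X^T) i j =
    gf_emb (gv_bil (nth z [:: u; v] i) (nth z [:: u; v] j)).
  rewrite gf_emb_bil; transitivity ((row i X *m Kmx k *m (row j X)^T) 0 0).
    by rewrite -!row_mul !mxE; apply: eq_bigr => l _; rewrite !mxE.
  by rewrite !row_mx3; elim/ord3P: i; elim/ord3P: j; rewrite !row3E.
have bilC a b : gf_emb (gv_bil a b) = gf_emb (gv_bil b a).
  by rewrite !gf_emb_bil !Kmx_form; ring.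
case/and4P=> /gf_eq0P h1 /gf_eq0P h2 h3 /and3P[/gf_eq0P h4 /gf_eq0P h5 /gf_eq0P h6].
exists (gf_emb (gv_bil u z)); first by rewrite gf_emb_eq0.
move: h4; rewrite !gf_embE => /eqP; rewrite addr_eq0 => /eqP h4.
apply/matrixP => i j; rewrite XE [RHS]mxE.
elim/ord3P: i; elim/ord3P: j; rewrite !(mx3E, row3E) ?mulr0 ?mulr1 /= ?[gf_emb (gv_bil z _)]bilC
  ?[gf_emb (gv_bil v u)]bilC ?h1 ?h2 ?h4 ?h5 ?h6 //; ring.
Qed.

Lemma gm_invP M : gm_unitary M -> gm_emb M *m gm_emb (gm_inv M) = 1%:M.
Proof.
move=> /gm_unitaryP MK.
have E : gm_emb (gm_inv M) *m Kmx k = Kmx k *m (map_mx frob (gm_emb M))^T.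
  case: M {MK} => [[a b c] [d e f] [g h i]]; apply/matrixP => l j.
  rewrite ![(_ *m _) l j]mxE !sum3 ![_^T _ _]mxE ![map_mx _ _ _ _]mxE.
  have e4 (x : k) : 2 * x * - 2 = x.
    apply/eqP; rewrite -subr_eq0; have -> : 2 * x * - 2 - x = - (5%:R * x) by ring.
    by rewrite five_eq0 mul0r oppr0.
  elim/ord3P: l; elim/ord3P: j; rewrite /gm_inv /gm_emb /gv_emb !(mx3E, row3E) !GRing.pFrobenius_autE
    !gf_embE ?(mulr0, mul0r, addr0, add0r) ?e4 //; ring.
have E2 : gm_emb M *m gm_emb (gm_inv M) *m Kmx k = Kmx k by rewrite -mulmxA E mulmxA MK.
by rewrite -[LHS](mulmxK (Kmx_unit two_neq0)) E2 mulmxV // Kmx_unit.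
Qed.

Lemma gm_emb_unit M : gm_unitary M -> gm_emb M \in unitmx.
Proof. by move=> /gm_invP /mulmx1_unit[]. Qed.

Lemma gm_invE M : gm_unitary M -> gm_emb (gm_inv M) = invmx (gm_emb M).
Proof.
move=> uM; rewrite -[LHS](mulKmx (gm_emb_unit uM)) gm_invP // mulmx1 //.
Qed.

Lemma gv_emb_eq0 v : gv_emb v = 0 -> v = GV 0 0 0.
Proof.
case: v => x y z /rowP E; have [x0 y0 z0] : [/\ gf_emb x = 0, gf_emb y = 0 & gf_emb z = 0].
  by have := E 0; have := E 1; have := E 2%:R; rewrite /gv_emb !row3E !mxE.
by congr GV; apply: gf_emb_inj; rewrite gf_emb0.
Qed.

Lemma gv_emb_surj (v : 'rV[k]_3) : (forall i, v 0 i ^+ 25 = v 0 i) -> exists x, gv_emb x = v.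
Proof.
move=> v25; have [x xE] := gf_emb_surj (v25 0); have [y yE] := gf_emb_surj (v25 1).
have [z zE] := gf_emb_surj (v25 2%:R); exists (GV x y z).
by rewrite /gv_emb xE yE zE -row3P.
Qed.

Lemma gm_emb_surj (M : 'M[k]_3) : (forall i j, M i j ^+ 25 = M i j) -> exists X, gm_emb X = M.
Proof.
move=> M25; have r i : exists x, gv_emb x = row i M.
  by apply: gv_emb_surj => j; rewrite mxE.
have [u uE] := r 0; have [v vE] := r 1; have [x xE] := r 2%:R.
by exists (GM u v x); rewrite /gm_emb uE vE xE -mx3P.
Qed.

(* Applying Frobenius to M K M^* = K and transposing gives M'' K M^* = K,
   where M'' is the second Frobenius twist of M; hence M'' = M. *)
Lemma unitary_gm (M : 'M[k]_3) : M *m Kmx k *m (map_mx frob M)^T = Kmx k ->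
  exists2 X, gm_unitary X & gm_emb X = M.
Proof.
move=> MK; have KT : (Kmx k)^T = Kmx k.
  by apply/matrixP => i j; rewrite mxE; elim/ord3P: i; elim/ord3P: j; rewrite !(mx3E, row3E).
have uK := Kmx_unit two_neq0.
have uM : M \in unitmx.
  have : M *m (Kmx k *m (map_mx frob M)^T *m invmx (Kmx k)) = 1%:M.
    by rewrite !mulmxA MK mulmxV.
  by case/mulmx1_unit.
have MK2 : map_mx frob (map_mx frob M) *m Kmx k *m (map_mx frob M)^T = Kmx k.
  have := congr1 trmx (congr1 (map_mx frob) MK); rewrite map_Kmx KT => {2}<-.
  by rewrite !map_mxM map_Kmx !trmx_mul KT -map_trmx trmxK mulmxA.
have uF : Kmx k *m (map_mx frob M)^T \in unitmx.
  by rewrite unitmx_mul uK unitmx_tr map_unitmx.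
have FF : map_mx frob (map_mx frob M) = M.
  rewrite -[LHS](mulmxK uF) -[RHS](mulmxK uF); congr (_ *m _).
  by rewrite !mulmxA MK2 MK.
have [|X XM] := @gm_emb_surj M.
  move=> i j; rewrite -[RHS](congr1 (fun N : 'M[k]_3 => N i j) FF) !mxE.
  by rewrite !GRing.pFrobenius_autE -exprM.
by exists X; first by apply/gm_unitaryP; rewrite XM.
Qed.

Lemma gv_emb_par t : gv_emb (gv_par t) = par 1 (gf_emb t).
Proof. by rewrite /gv_emb /gv_par /par gf_emb1 gf_embM expr1n mul1r expr2. Qed.

Lemma gv_emb_inf : gv_emb (GV 0 0 1) = par 0 1.
Proof. by rewrite /gv_emb /par gf_emb0 gf_emb1 expr0n mul0r expr1n. Qed.

Lemma gf_pointsE : [seq gv_emb v | v <- gf_points] = base_points k.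
Proof.
rewrite /gf_points map_cons gv_emb_inf; congr (_ :: _).
by rewrite !map_cons !gv_emb_par !gf_emb_of.
Qed.

End Embedding.

Lemma gf_points_uniq : uniq gf_points. Proof. by []. Qed.

Lemma gf_conics_unitary M : M \in gf_conics -> gm_unitary M.
Proof. by apply/allP: M; vm_compute. Qed.

Lemma count_gt1P (T : eqType) (P : pred T) (s : seq T) : uniq s ->
  (1 < count P s)%N <-> exists x y, [/\ x \in s, y \in s, x != y, P x & P y].
Proof.
move=> us; split=> [|[x [y [xs ys xy Px Py]]]].
  rewrite -size_filter; have := filter_uniq P us.
  have fE x : x \in seq.filter P s -> x \in s /\ P x by rewrite mem_filter => /andP[].
  case: (seq.filter P s) fE => [|x [|y r]] // fE /= /andP[]; rewrite inE negb_or => /andP[xy _] _ _.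
  have [xs Px] := fE x (mem_head _ _); have [ys Py] := fE y (@mem_nth _ y [:: x, y & r] 1 isT).
  by exists x, y.
rewrite -size_filter; apply: (@uniq_leq_size _ [:: x; y]); first by rewrite /= inE xy.
by move=> z; rewrite !inE mem_filter => /orP[]/eqP->; rewrite ?Px ?Py.
Qed.

Lemma mem_pairs (T : eqType) (s : seq T) x y : x \in s -> y \in s -> x != y ->
  (x, y) \in pairs s \/ (y, x) \in pairs s.
Proof.
elim: s => //= z s IH; rewrite !inE !mem_cat => /orP[/eqP->|xs] /orP[/eqP->|ys] xy.
- by rewrite eqxx in xy.
- by left; rewrite map_f.
- by right; rewrite map_f.
by case: (IH xs ys xy) => ->; rewrite orbT; [left|right].
Qed.

Lemma pairs_mem (T : eqType) (s : seq T) p : uniq s -> p \in pairs s ->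
  [/\ p.1 \in s, p.2 \in s & p.1 != p.2].
Proof.
elim: s => //= z s IH /andP[zs us]; rewrite mem_cat => /orP[/mapP[y ys ->]|/(IH us)[p1 p2 p12]].
  by rewrite /= !inE eqxx ys orbT; split=> //; apply: contraNneq zs => ->.
by rewrite !inE p1 p2 !orbT.
Qed.

(** * Incidences between conics, points and secants *)

Section Incidence.
Variables (k : closedFieldType) (char5 : 5%N \in [pchar k]).
Variables (w : k) (w2 : w ^+ 2 = 2).
Variables (A : 'M[k]_3) (Gamma : curve k 6).
Hypotheses (uA : A \in unitmx) (GammaA : forms Gamma (hermitian_form A)).
Hypothesis A_neq0 : hermitian_form A != 0.
Implicit Types (M N : gf_mat) (Phi : 'M[k]_3).

Local Notation frame := (frame char5 A).
Local Notation gv := (gv_emb w).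
Local Notation gm := (gm_emb w).
Let two_neq0 := two_neq0 char5.

Lemma frame_gm M Phi : gm_unitary M -> frame Phi -> frame (gm M *m Phi).
Proof.
move=> uM; apply: frame_stab; first exact: (gm_emb_unit char5 w2 uM).
exact/(gm_unitaryP char5 w2).
Qed.

(** Equal Gram matrices make the transition matrix unitary, and a unitary matrix has entries in
    F_25. This is where the geometry over [k] becomes finite. *)
Lemma frame_rel Phi Phi' : frame Phi -> frame Phi' ->
  exists2 M, gm_unitary M & Phi' = gm M *m Phi.
Proof.
move=> [uPhi gPhi] [uPhi' gPhi'].
have E : Phi' = Phi' *m invmx Phi *m Phi by rewrite mulmxKV.
have [|M uM ME] := @unitary_gm _ char5 _ w2 (Phi' *m invmx Phi).
  by rewrite -{1}gPhi -gram_mul -E.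
by exists M; rewrite ?ME.
Qed.

Lemma gm_unitary_mul M N : gm_unitary M -> gm_unitary N -> gm_unitary (gm_mul M N).
Proof.
move=> /(gm_unitaryP char5 w2) MK /(gm_unitaryP char5 w2) NK.
apply/(gm_unitaryP char5 w2); rewrite (gm_emb_mul char5 w2) map_mxM trmx_mul !mulmxA.
by rewrite -(mulmxA (gm M)) -(mulmxA (gm M)) NK.
Qed.

Lemma conic_gm_stab M N Phi : gm_unitary M -> gm_unitary N -> frame Phi ->
  gm_stab (gm_mul M (gm_inv N)) -> conic (gm M *m Phi) = conic (gm N *m Phi).
Proof.
move=> uM uN [uPhi _] /(gm_stabP char5 w2)[c c0].
have eM := gm_emb_unit char5 w2 uM; have eN := gm_emb_unit char5 w2 uN.
rewrite (gm_emb_mul char5 w2) (gm_invE char5 w2 uN) => E.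
have -> : gm M *m Phi = gm M *m invmx (gm N) *m (gm N *m Phi).
  by rewrite mulmxA mulmxKV.
by apply: (conic_stab two_neq0 _ _ c0 E); rewrite unitmx_mul ?unitmx_inv ?eM ?eN.
Qed.

Definition gpt Phi v : proj_point k := pt (gv v *m Phi).

Lemma gv_points v : v \in gf_points -> gv v \in base_points k.
Proof. by move=> vp; rewrite -(gf_pointsE char5 w2) map_f. Qed.

Lemma gv_neq0 v : v \in gf_points -> gv v != 0.
Proof. by move=> /gv_points /base_points_neq0. Qed.

Lemma gv_inj : injective gv.
Proof.
move=> [a b c] [x y z] /rowP E.
have := E 0; have := E 1; have := E 2%:R; rewrite /gv_emb !row3E.
by do 3![move=> /(gf_emb_inj char5 w2) ->].
Qed.

Lemma gpt_inj Phi : Phi \in unitmx -> {in gf_points &, injective (gpt Phi)}.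
Proof.
move=> uPhi u v /gv_points up /gv_points vp E.
by apply: gv_inj; exact: (base_points_inj uPhi up vp E).
Qed.

Lemma gpt_six Phi P : frame Phi ->
  (pts (conic Phi) `&` pts Gamma) P <-> exists2 v, v \in gf_points & P = gpt Phi v.
Proof.
move=> fPhi; rewrite (six_points GammaA A_neq0 _ fPhi) -(gf_pointsE char5 w2).
split=> [[x /mapP[v vp ->] ->]|[v vp ->]]; first by exists v.
by exists (gv v); rewrite ?map_f.
Qed.

(** A common point on Gamma is one of the six contact points of the second conic, so it is enough to
    test these six in the coordinates of the first. *)
Lemma meet_card Phi M N : frame Phi -> gm_unitary M -> gm_unitary N ->
  pts (conic (gm M *m Phi)) `&` pts (conic (gm N *m Phi)) `&` pts Gamma #= `I_(meets M N).
Proof.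
move=> fPhi uM uN; have [uMPhi _] := frame_gm uM fPhi.
have fN := frame_gm uN fPhi; have [uNPhi _] := fN.
have eM := gm_emb_unit char5 w2 uM.
apply/card_seqP; pose Z v := gf_eq0 (gv_q0 (gv_mul (gv_mul v N) (gm_inv M))).
exists [seq gpt (gm N *m Phi) v | v <- gf_points & Z v].
have ZP v : v \in gf_points ->
    pts (conic (gm M *m Phi)) (gpt (gm N *m Phi) v) <-> Z v.
  move=> vp; rewrite /gpt.
  have E : gv v *m (gm N *m Phi) =
      gv (gv_mul (gv_mul v N) (gm_inv M)) *m (gm M *m Phi).
    rewrite !(gv_emb_mul char5 w2) (gm_invE char5 w2 uM) !mulmxA; congr (_ *m _).
    by rewrite mulmxKV.
  rewrite E pts_conic_mul // -?(gf_emb_q0 char5 w2).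
    by split=> [/eqP|/(gf_eq0P char5 w2)//]; rewrite (gf_emb_eq0 char5 w2).
  apply: contra_neq (gv_neq0 vp) => z0; move: E; rewrite z0 mul0mx => E.
  by rewrite -(mulmxK uNPhi (gv v)) E mul0mx.
split.
- rewrite map_inj_in_uniq ?filter_uniq // => u v; rewrite !mem_filter.
  by move=> /andP[_ up] /andP[_ vp]; exact: gpt_inj.
- by rewrite size_map size_filter.
move=> P; split=> [[[MP NP] GP]|/mapP[v]].
  have /(gpt_six _ fN)[v vp PE] : (pts (conic (gm N *m Phi)) `&` pts Gamma) P by [].
  apply/mapP; exists v => //; rewrite mem_filter vp andbT; apply/(ZP v vp).
  by rewrite -PE.
rewrite mem_filter => /andP[Zv vp] ->.
have [NP GP] : (pts (conic (gm N *m Phi)) `&` pts Gamma) (gpt (gm N *m Phi) v).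
  by apply/(gpt_six _ fN); exists v.
by split; [split; [apply/(ZP v vp)|exact: NP]|exact: GP].
Qed.

Lemma check_disjointE : check_disjoint. Proof. by vm_compute. Qed.

(** Equal conics share their six contact points, whereas different entries of the list share
    none. *)
Lemma conics_inj Phi M N : frame Phi -> M \in gf_conics -> N \in gf_conics ->
  conic (gm M *m Phi) = conic (gm N *m Phi) -> M = N.
Proof.
move=> fPhi Mc Nc E; apply: contraTeq isT => MN.
wlog MNp : M N Mc Nc E MN / (M, N) \in pairs gf_conics => [H|].
  have [p|p] := mem_pairs Mc Nc MN; first exact: H M N Mc Nc E MN p.
  by apply: (H N M Nc Mc (esym E) _ p); rewrite eq_sym.
have uM := gf_conics_unitary Mc; have uN := gf_conics_unitary Nc.
have := meet_card fPhi uM uN; have /eqP -> := allP check_disjointE _ MNp.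
rewrite E; move=> /card_seqP[s [_ /size0nil -> sP]].
have fN := frame_gm uN fPhi.
have [NP GP] : (pts (conic (gm N *m Phi)) `&` pts Gamma) (gpt (gm N *m Phi) (GV 0 0 1)).
  by apply/(gpt_six _ fN); exists (GV 0 0 1); rewrite ?mem_head.
have : gpt (gm N *m Phi) (GV 0 0 1) \in [::].
  by apply/sP; split; [split; exact: NP|exact: GP].
by rewrite in_nil.
Qed.

End Incidence.

(** * Lines and secants in the coordinates of a frame *)

Section Lines.
Variable k : fieldType.
Implicit Types (x c u v n : 'rV[k]_3) (Phi : 'M[k]_3).

Lemma linear_form_neq0 c : c != 0 -> linear_form c != 0.
Proof.
apply: contra_neq => c0; apply/rowP => i.
have := congr1 (meval ((delta_mx 0 i : 'rV[k]_3) 0)) c0.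
by rewrite meval_linear_form meval0 -rowE !mxE.
Qed.

Lemma meval_linear_form_mul Phi c x : Phi \in unitmx ->
  (linear_form (c *m (invmx Phi)^T)).@[(x *m Phi) 0] = (x *m c^T) 0 0.
Proof. by move=> uPhi; rewrite meval_linear_form trmx_mul trmxK mulmxA mulmxK. Qed.

Lemma proportional n x : n != 0 ->
  x 0 0 * n 0 1 = x 0 1 * n 0 0 -> x 0 1 * n 0 2%:R = x 0 2%:R * n 0 1 ->
  x 0 0 * n 0 2%:R = x 0 2%:R * n 0 0 -> exists a, x = a *: n.
Proof.
move=> n0 h01 h12 h02.
have [i ni] : exists i, n 0 i != 0.
  apply/existsP; apply: contraT; rewrite negb_exists => /forallP h.
  case/eqP: n0; apply/rowP => i; rewrite mxE; apply/eqP; exact: negbNE (h i).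
have h (j : 'I_3) : x 0 j * n 0 i = x 0 i * n 0 j.
  by elim/ord3P: i {ni}; elim/ord3P: j.
exists (x 0 i / n 0 i); apply/rowP => j; rewrite mxE; apply: (mulIf ni).
by rewrite h mulrAC divfK.
Qed.

Definition cross u v : 'rV[k]_3 :=
  row3 (u 0 1 * v 0 2%:R - u 0 2%:R * v 0 1) (u 0 2%:R * v 0 0 - u 0 0 * v 0 2%:R)
       (u 0 0 * v 0 1 - u 0 1 * v 0 0).

Lemma dotE u v : (u *m v^T) 0 0 = u 0 0 * v 0 0 + u 0 1 * v 0 1 + u 0 2%:R * v 0 2%:R.
Proof. by rewrite mxE sum3 ![_^T _ _]mxE. Qed.

Lemma cross_normal u v x : cross u v != 0 -> (u *m x^T) 0 0 = 0 -> (v *m x^T) 0 0 = 0 ->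
  exists a, x = a *: cross u v.
Proof.
rewrite !dotE => n0 ux vx; apply: (proportional n0); rewrite !row3E; apply/eqP; rewrite -subr_eq0; apply/eqP.
- transitivity (u 0 2%:R * (v 0 0 * x 0 0 + v 0 1 * x 0 1 + v 0 2%:R * x 0 2%:R) -
    v 0 2%:R * (u 0 0 * x 0 0 + u 0 1 * x 0 1 + u 0 2%:R * x 0 2%:R)); first by ring.
  by rewrite ux vx !mulr0 subrr.
- transitivity (u 0 0 * (v 0 0 * x 0 0 + v 0 1 * x 0 1 + v 0 2%:R * x 0 2%:R) -
    v 0 0 * (u 0 0 * x 0 0 + u 0 1 * x 0 1 + u 0 2%:R * x 0 2%:R)); first by ring.
  by rewrite ux vx !mulr0 subrr.
transitivity (v 0 1 * (u 0 0 * x 0 0 + u 0 1 * x 0 1 + u 0 2%:R * x 0 2%:R) -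
  u 0 1 * (v 0 0 * x 0 0 + v 0 1 * x 0 1 + v 0 2%:R * x 0 2%:R)); first by ring.
by rewrite ux vx !mulr0 subrr.
Qed.

Lemma cross_eq0 u v : cross u v = 0 -> v != 0 -> exists a, u = a *: v.
Proof.
move=> /rowP E v0; have := E 0; have := E 1; have := E 2%:R; rewrite !row3E ![(0 : 'rV_3) _ _]mxE.
move=> /eqP; rewrite subr_eq0 => /eqP h01 /eqP; rewrite subr_eq0 => /eqP h02 /eqP.
rewrite subr_eq0 => /eqP h12; exact: (proportional v0).
Qed.

(** The cross product gives the line in frame coordinates; linear forms transform by the inverse
    transpose of [Phi]. *)
Definition secant_line Phi u v : curve k 1 :=
  curve_of 1 (linear_form (cross u v *m (invmx Phi)^T)).

Lemma secant_lineP Phi u v : Phi \in unitmx -> cross u v != 0 ->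
  forms (secant_line Phi u v) (linear_form (cross u v *m (invmx Phi)^T)).
Proof.
move=> uPhi c0; apply: curve_ofP; first exact: linear_form_homog.
by apply/linear_form_neq0/mulmx_neq0; rewrite // unitmx_tr unitmx_inv.
Qed.

Lemma pts_secant_line Phi u v x : Phi \in unitmx -> cross u v != 0 -> x != 0 ->
  pts (secant_line Phi u v) (pt (x *m Phi)) <-> (x *m (cross u v)^T) 0 0 = 0.
Proof.
move=> uPhi c0 x0; rewrite -(meval_linear_form_mul _ _ uPhi).
apply: pts_pt (secant_lineP uPhi c0) _ (mulmx_neq0 uPhi x0).
by apply/linear_form_neq0/mulmx_neq0; rewrite // unitmx_tr unitmx_inv.
Qed.

Lemma secant_line_unique Phi u v L : Phi \in unitmx -> cross u v != 0 ->
  u != 0 -> v != 0 -> pts L (pt (u *m Phi)) -> pts L (pt (v *m Phi)) ->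
  L = secant_line Phi u v.
Proof.
move=> uPhi c0 u0 v0 Lu Lv; have [g Lg g0] := forms_gen L.
have [c gE] := linear_formE (forms_homog Lg).
pose x := c *m Phi^T.
have cE : c = x *m (invmx Phi)^T by rewrite /x -mulmxA -trmx_mul mulVmx // trmx1 mulmx1.
have dot z : z != 0 -> pts L (pt (z *m Phi)) -> (z *m x^T) 0 0 = 0.
  move=> z0 /(pts_pt Lg g0 (mulmx_neq0 uPhi z0)).
  by rewrite gE cE (meval_linear_form_mul _ _ uPhi).
have [a xE] := cross_normal c0 (dot _ u0 Lu) (dot _ v0 Lv).
apply: (curve_ext g0 Lg); apply/(formsP _ (secant_lineP uPhi c0)).
  by apply/linear_form_neq0/mulmx_neq0; rewrite // unitmx_tr unitmx_inv.
exists a; rewrite gE cE xE -scalemxAl /linear_form scaler_sumr.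
by apply: eq_bigr => i _; rewrite mxE scalerA.
Qed.

End Lines.

Section Secants.
Variables (k : closedFieldType) (char5 : 5%N \in [pchar k]).
Variables (w : k) (w2 : w ^+ 2 = 2).
Variables (A : 'M[k]_3) (Gamma : curve k 6).
Hypotheses (uA : A \in unitmx) (GammaA : forms Gamma (hermitian_form A)).
Hypothesis A_neq0 : hermitian_form A != 0.
Implicit Types (M N : gf_mat) (Phi : 'M[k]_3).

Local Notation frame := (frame char5 A).
Local Notation gv := (gv_emb w).
Local Notation gm := (gm_emb w).
Local Notation gpt := (gpt w).

Lemma gv_cross_emb u v : gv (gv_cross u v) = cross (gv u) (gv v).
Proof.
by case: u v => a b c [x y z]; rewrite /cross /gv_cross /gv_emb !row3E !(gf_embE char5 w2).
Qed.

Lemma cross_points u v : u \in gf_points -> v \in gf_points -> u != v ->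
  cross (gv u) (gv v) != 0.
Proof.
move=> up vp uv; rewrite -gv_cross_emb.
have : (u != v) ==> (gv_cross u v != GV 0 0 0).
  have H : all (fun u => all (fun v => (u != v) ==> (gv_cross u v != GV 0 0 0)) gf_points) gf_points by vm_compute.
  exact: allP (allP H u up) v vp.
rewrite uv; apply: contra_neq => /(gv_emb_eq0 char5 w2) //.
Qed.

Definition gsecant Phi (p : gf_vec * gf_vec) := secant_line Phi (gv p.1) (gv p.2).

Lemma pts_gsecant Phi p v : Phi \in unitmx -> p \in pairs gf_points -> gv v != 0 ->
  pts (gsecant Phi p) (gpt Phi v) <-> gf_eq0 (gv_dot v (gv_cross p.1 p.2)).
Proof.
move=> uPhi /(pairs_mem gf_points_uniq)[p1 p2 p12] vp.
rewrite /gsecant /gpt pts_secant_line ?cross_points //.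
rewrite -gv_cross_emb -(gf_emb_dot char5 w2).
by split=> [/eqP|/(gf_eq0P char5 w2)//]; rewrite (gf_emb_eq0 char5 w2).
Qed.

Lemma gsecant_unique Phi p L : Phi \in unitmx -> p \in pairs gf_points ->
  pts L (gpt Phi p.1) -> pts L (gpt Phi p.2) -> L = gsecant Phi p.
Proof.
move=> uPhi /(pairs_mem gf_points_uniq)[p1 p2 p12] L1 L2.
by apply: secant_line_unique L1 L2; rewrite ?cross_points ?(gv_neq0 char5 w2).
Qed.

Lemma gsecant_pts Phi p : Phi \in unitmx -> p \in pairs gf_points ->
  pts (gsecant Phi p) (gpt Phi p.1) /\ pts (gsecant Phi p) (gpt Phi p.2).
Proof.
move=> uPhi pp; have [p1 p2 p12] := pairs_mem gf_points_uniq pp.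
by split; apply/(pts_gsecant uPhi pp); rewrite ?(gv_neq0 char5 w2) //;
  rewrite -(gf_emb_eq0 char5 w2) (gf_emb_dot char5 w2) gv_cross_emb dotE !row3E;
  apply/eqP; ring.
Qed.

Lemma gpt_weierstrass Phi v : frame Phi -> v \in gf_points -> weierstrass Gamma (gpt Phi v).
Proof.
move=> fPhi /(gv_points char5 w2) /(frame_at fPhi)[Phi' [fPhi' _ E]].
by rewrite /gpt E; exact: (frame_weierstrass GammaA A_neq0 fPhi').
Qed.

Lemma secantsP Phi L : frame Phi ->
  secants Gamma (conic Phi) L <-> exists2 p, p \in pairs gf_points & L = gsecant Phi p.
Proof.
move=> fPhi; have [uPhi _] := fPhi; split.
  case=> _ [P [P' [SP SP' PP' LP LP']]].
  have /(gpt_six w2 GammaA A_neq0 _ fPhi)[v vp PE] := SP.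
  have /(gpt_six w2 GammaA A_neq0 _ fPhi)[v' vp' PE'] := SP'.
  have vv' : v != v' by apply: contra_notN PP' => /eqP vv'; rewrite PE PE' vv'.
  case: (mem_pairs vp vp' vv') => pp; [exists (v, v')|exists (v', v)] => //;
    by apply: gsecant_unique; rewrite // -?PE -?PE'.
case=> p pp ->; have [p1 p2 p12] := pairs_mem gf_points_uniq pp.
have [L1 L2] := gsecant_pts uPhi pp.
have ne : gpt Phi p.1 <> gpt Phi p.2.
  by move=> /(gpt_inj char5 w2 uPhi p1 p2)/eqP; rewrite (negbTE p12).
split; exists (gpt Phi p.1), (gpt Phi p.2); split=> //.
- exact: gpt_weierstrass.
- exact: gpt_weierstrass.
- by apply/(gpt_six w2 GammaA A_neq0 _ fPhi); exists p.1.
by apply/(gpt_six w2 GammaA A_neq0 _ fPhi); exists p.2.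
Qed.

(** A secant of the first conic is a secant of the second exactly when it contains two contact
    points of the second. The 15 secants of one conic are distinct lines by [check_secants], so
    counting pairs counts lines. *)
Lemma common_secants_card Phi M : frame Phi -> gm_unitary M ->
  secants Gamma (conic Phi) `&` secants Gamma (conic (gm M *m Phi)) #= `I_(common_secants M).
Proof.
move=> fPhi uM; have [uPhi _] := fPhi; have fM := frame_gm w2 uM fPhi.
have [uMPhi _] := fM.
pose Z (p : gf_vec * gf_vec) :=
  (1 < count (fun v => gf_eq0 (gv_dot (gv_mul v M) (gv_cross p.1 p.2))) gf_points)%N.
have -> : common_secants M = count Z (pairs gf_points).
  by apply: eq_count => p; rewrite /Z count_map.
apply/card_seqP; exists [seq gsecant Phi p | p <- pairs gf_points & Z p].
have ptM v : gpt (gm M *m Phi) v = gpt Phi (gv_mul v M).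
  by rewrite /gpt (gv_emb_mul char5 w2) mulmxA.
have nzM v : v \in gf_points -> gv (gv_mul v M) != 0.
  move=> vp; rewrite (gv_emb_mul char5 w2); apply: mulmx_neq0.
    exact: (gm_emb_unit char5 w2).
  exact: (gv_neq0 char5 w2).
have ZP p : p \in pairs gf_points -> secants Gamma (conic (gm M *m Phi)) (gsecant Phi p) <-> Z p.
  move=> pp; rewrite (secantsP _ fM) /Z (count_gt1P _ gf_points_uniq); split.
    case=> q qp E; have [q1 q2 q12] := pairs_mem gf_points_uniq qp.
    exists q.1, q.2; split=> //; apply/(pts_gsecant uPhi pp); rewrite ?nzM // -ptM E.
      by have [] := gsecant_pts uMPhi qp.
    by have [] := gsecant_pts uMPhi qp.
  case=> x [y [xp yp xy /(pts_gsecant uPhi pp (nzM x xp)) Lx /(pts_gsecant uPhi pp (nzM y yp)) Ly]].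
  rewrite -!ptM in Lx Ly.
  by case: (mem_pairs xp yp xy) => qp; [exists (x, y)|exists (y, x)] => //; apply: gsecant_unique.
split.
- rewrite map_inj_in_uniq ?filter_uniq // => p q; rewrite !mem_filter => /andP[_ pp] /andP[_ qp] E.
  have H : check_secants by vm_compute.
  have [q1 q2 _] := pairs_mem gf_points_uniq qp.
  have [L1 L2] := gsecant_pts uPhi qp.
  have := allP (allP H p pp) q qp; rewrite /=.
  have -> : gf_eq0 (gv_dot q.1 (gv_cross p.1 p.2)).
    by apply/(pts_gsecant uPhi pp); rewrite ?(gv_neq0 char5 w2) // E.
  have -> : gf_eq0 (gv_dot q.2 (gv_cross p.1 p.2)).
    by apply/(pts_gsecant uPhi pp); rewrite ?(gv_neq0 char5 w2) // E.
  by move=> /eqP.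
- by rewrite size_map size_filter.
move=> L; split=> [[/(secantsP _ fPhi)[p pp ->] /(ZP p pp) Zp]|/mapP[p]].
  by apply/mapP; exists p; rewrite ?mem_filter ?Zp.
rewrite mem_filter => /andP[Zp pp] ->; split; last exact/ZP.
by apply/(secantsP _ fPhi); exists p.
Qed.

End Secants.

(** * Adjacent conics and components *)

Section Quartic.
Variables (k : closedFieldType) (char5 : 5%N \in [pchar k]).
Implicit Types (Phi : 'M[k]_3).

Let two_neq0 := two_neq0 char5.

Lemma conic_pts_par Phi P : Phi \in unitmx -> pts (conic Phi) P ->
  P = pt (par 0 1 *m Phi) \/ exists t, P = pt (par 1 t *m Phi).
Proof.
move=> uPhi; have [v v0 ->] := ptP P; pose x := v *m invmx Phi.
have vE : v = x *m Phi by rewrite mulmxKV.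
have x0 : x != 0 by rewrite mulmx_neq0 ?unitmx_inv.
rewrite vE => /(pts_conic_mul uPhi x0) qx; have [[t x00 xE]|xE] := q0P qx x0.
  by right; exists t; rewrite xE -scalemxAl ptZ // mulmx_neq0 // par_neq0.
left; rewrite xE -scalemxAl ptZ ?mulmx_neq0 ?par01_neq0 //.
by apply: contra_neq x0 => x2; rewrite xE x2 scale0r.
Qed.

(** A nonzero polynomial of degree at most two contributes at most two points, and [P0] at most one
    more. *)
Lemma few_points Phi (g : {poly k}) P0 (X : set (proj_point k)) :
  g != 0 -> (size g <= 3)%N ->
  (forall P, X P -> P = P0 \/ exists2 t, root g t & P = pt (par 1 t *m Phi)) ->
  ~ (X #= `I_4).
Proof.
move=> g0 sg XP /card_seqP[s [us ss sP]].
have /choice[t tE] P : exists t, P \in s -> P != P0 -> root g t /\ P = pt (par 1 t *m Phi).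
  have [Ps|/negP Ps] := boolP (P \in s); last by exists 0.
  have [->|[t gt PE]] := XP P ((sP P).2 Ps); last by exists t.
  by exists 0 => _ /eqP.
pose s' := rem P0 s.
have s'E P : P \in s' -> P \in s /\ P != P0 by rewrite mem_rem_uniq // !inE => /andP[].
have ss' : (3 <= size s')%N.
  by rewrite /s'; case: (boolP (P0 \in s)) => [/size_rem ->|/rem_id ->]; rewrite ss.
have : (size (map t s') < size g)%N.
  apply: max_poly_roots => //.
    by apply/allP => _ /mapP[P /s'E[Ps P0P] ->]; have [] := tE P Ps P0P.
  rewrite map_inj_in_uniq ?rem_uniq // => P P' /s'E[Ps P0P] /s'E[Ps' P0P'] tt.
  by have [_ ->] := tE P Ps P0P; have [_ ->] := tE P' Ps' P0P'; rewrite tt.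
by rewrite size_map => /leq_trans/(_ sg); rewrite ltnNge ss'.
Qed.

(** The biquadratic fails to have four distinct zeros on the projective line when infinity is a
    zero, when 0 is a zero, or when its discriminant in [t^2], which is [b^2 - 4 a c = b^2 + a c],
    vanishes. In each case the zeros lie among those of a quadratic and one exceptional point. *)
Lemma biquadratic_not4 Phi (X : set (proj_point k)) (a b c : k) :
  ~~ [&& a == 0, b == 0 & c == 0] -> [|| a == 0, c == 0 | b ^+ 2 + a * c == 0] ->
  (forall P, X P -> (c = 0 /\ P = pt (par 0 1 *m Phi)) \/
     exists2 t, a + b * t ^+ 2 + c * t ^+ 4 = 0 & P = pt (par 1 t *m Phi)) ->
  ~ (X #= `I_4).
Proof.
move=> abc deg XP.
have sz (x y : k) : (size (x%:P + y *: 'X^2)%R <= 3)%N.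
  rewrite (leq_trans (size_polyD _ _)) // geq_max size_polyC.
  by rewrite (leq_trans (size_scale_leq _ _)) ?size_polyXn // (leq_trans (leq_b1 _)).
have nz (x y : k) : (x != 0) || (y != 0) -> x%:P + y *: 'X^2 != 0 :> {poly k}.
  move=> xy; apply/eqP => /polyP E; have := E 0%N; have := E 2%N.
  rewrite !coefD !coefC !coefZ !coefXn /= mulr0 mulr1 addr0 add0r => y0 x0.
  by move: xy; rewrite x0 y0 eqxx.
have rt (x y t : k) : root (x%:P + y *: 'X^2) t = (x + y * t ^+ 2 == 0).
  by rewrite /root !hornerE.
have [c0|c0] := eqVneq c 0.
  apply: (@few_points Phi (a%:P + b *: 'X^2) (pt (par 0 1 *m Phi))) => //.
    by apply: nz; move: abc; rewrite c0 eqxx andbT negb_and.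
  move=> P /XP[[_ ->]|[t]]; first by left.
  by rewrite c0 mul0r addr0 => tE ->; right; exists t; rewrite ?rt ?tE.
have [a0|a0] := eqVneq a 0.
  apply: (@few_points Phi (b%:P + c *: 'X^2) (pt (par 1 0 *m Phi))) => //.
    by apply: nz; rewrite c0 orbT.
  move=> P /XP[[c00 _]|[t tE ->]]; first by rewrite c00 eqxx in c0.
  have [->|t0] := eqVneq t 0; [by left|right; exists t => //].
  move/eqP: tE; rewrite rt a0 add0r (_ : _ + _ = t ^+ 2 * (b + c * t ^+ 2)); last by ring.
  by rewrite mulf_eq0 expf_eq0 (negbTE t0).
move: deg; rewrite (negbTE a0) (negbTE c0) /= => /eqP D.
(* A repeated root in [t^2] satisfies [b + 2 c t^2 = 0]. As [c] is nonzero, infinity is not a zero,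
   and the exceptional point is a mere placeholder. *)
apply: (@few_points Phi (b%:P + (2 * c) *: 'X^2) (pt (par 0 1 *m Phi))) => //.
  by apply: nz; rewrite mulf_neq0 ?orbT.
move=> P /XP[[c00 _]|[t tE ->]]; first by rewrite c00 eqxx in c0.
right; exists t => //; rewrite rt -sqrf_eq0; apply/eqP.
(* Completing the square: [(b + 2 c t^2)^2] is [4 c] times the biquadratic plus its discriminant. *)
transitivity (4%:R * c * (a + b * t ^+ 2 + c * t ^+ 4) + (b ^+ 2 + a * c) - 5%:R * (a * c)).
  by ring.
by rewrite tE D (five_eq0 char5) mulr0 mul0r subr0 addr0.
Qed.

End Quartic.

Section Adjacency.
Variables (k : closedFieldType) (char5 : 5%N \in [pchar k]).
Variables (w : k) (w2 : w ^+ 2 = 2).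
Variables (A : 'M[k]_3) (Gamma : curve k 6).
Hypotheses (uA : A \in unitmx) (GammaA : forms Gamma (hermitian_form A)).
Hypothesis A_neq0 : hermitian_form A != 0.
Implicit Types (M N : gf_mat) (Phi : 'M[k]_3).

Local Notation frame := (frame char5 A).
Local Notation gv := (gv_emb w).
Local Notation gm := (gm_emb w).
Local Notation gpt := (gpt w).
Local Notation embE := (gf_embE char5 w2).

Lemma pts_conic_gm Phi M x : frame Phi -> gm_unitary M -> x != 0 ->
  pts (conic Phi) (pt (x *m (gm M *m Phi))) <-> q0 (x *m gm M) = 0.
Proof.
move=> [uPhi _] uM x0; rewrite mulmxA; apply: pts_conic_mul => //.
by apply: mulmx_neq0 x0; exact: (gm_emb_unit char5 w2).
Qed.

Lemma gv_propP u v : gv v != 0 -> gv_prop u v -> exists a, gv u = a *: gv v.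
Proof.
move=> v0 uv; apply: cross_eq0 v0; rewrite -(gv_cross_emb char5 w2).
move: uv; rewrite /gv_prop; case: (gv_cross u v) => x y z /and3P[].
rewrite -!(gf_emb_eq0 char5 w2) => /eqP x0 /eqP y0 /eqP z0.
by apply/rowP; elim/ord3P; rewrite /gv_emb !row3E mxE.
Qed.

Lemma sl2_unitary s : s \in sl2 -> gm_unitary s.
Proof. by apply/allP: s; vm_compute. Qed.

Lemma sl2_stab s : s \in sl2 -> gm_stab s.
Proof. by apply/allP: s; vm_compute. Qed.

Lemma gm1_emb : gm gm1 = 1%:M.
Proof.
apply/matrixP => i j; rewrite /gm1 /gm_emb /gv_emb mx3E [RHS]mxE.
by elim/ord3P: i; elim/ord3P: j; rewrite !row3E ?embE.
Qed.

Lemma conic_stab1 M Phi : frame Phi -> gm_unitary M -> gm_stab M ->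
  conic (gm M *m Phi) = conic Phi.
Proof.
move=> [uPhi _] uM /(gm_stabP char5 w2)[c c0 E].
by apply: (conic_stab (two_neq0 char5) _ _ c0 E) => //; exact: (gm_emb_unit char5 w2).
Qed.

Lemma frame_sl2 s Phi : s \in sl2 -> frame Phi ->
  frame (gm s *m Phi) /\ conic (gm s *m Phi) = conic Phi.
Proof.
move=> ss fPhi; have us := sl2_unitary ss; split; first exact: (frame_gm w2).
exact: conic_stab1 (sl2_stab ss).
Qed.

Lemma reframe Phi u v : frame Phi -> u \in gf_points -> v \in gf_points -> u != v ->
  exists s, [/\ s \in sl2, gpt Phi u = pt (row 0 (gm s *m Phi))
    & gpt Phi v = pt (row 2%:R (gm s *m Phi))].
Proof.
move=> fPhi up vp uv; have H : check_sl2 by vm_compute.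
have := allP (allP H u up) v vp; rewrite (negbTE uv) orFb => /hasP[s ss].
have es := gm_emb_unit char5 w2 (sl2_unitary ss); have [uPhi _] := fPhi.
have := gv_neq0 char5 w2 up; have := gv_neq0 char5 w2 vp.
case: s ss es => a b c ss es v0 u0 /andP[].
have nz i : row i (gm (GM a b c)) != 0.
  apply/eqP => /(congr1 (mulmx^~ (invmx (gm (GM a b c))))); rewrite -row_mul mulmxV // mul0mx.
  by move/rowP/(_ i); rewrite !mxE eqxx => /eqP; rewrite oner_eq0.
have a0 : gv a != 0 by have := nz 0; rewrite row_mx3 row3E.
have c0 : gv c != 0 by have := nz 2%:R; rewrite row_mx3 row3E.
move=> /(gv_propP a0)[x xE] /(gv_propP c0)[y yE]; exists (GM a b c); split=> //.
  rewrite /gpt row_mul row_mx3 row3E xE -scalemxAl ptZ ?mulmx_neq0 //.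
  by apply: contra_neq u0 => x0; rewrite xE x0 scale0r.
rewrite /gpt row_mul row_mx3 row3E yE -scalemxAl ptZ ?mulmx_neq0 //.
by apply: contra_neq v0 => x0; rewrite yE x0 scale0r.
Qed.

End Adjacency.

Arguments gf_add : simpl never.
Arguments gf_mul : simpl never.
Arguments gf_opp : simpl never.
Arguments gf_conj : simpl never.
Arguments gf_of : simpl never.
Arguments gf_emb : simpl never.

Section AdjacentConics.
Variables (k : closedFieldType) (char5 : 5%N \in [pchar k]).
Variables (w : k) (w2 : w ^+ 2 = 2).
Variables (A : 'M[k]_3) (Gamma : curve k 6).
Hypotheses (uA : A \in unitmx) (GammaA : forms Gamma (hermitian_form A)).
Hypothesis A_neq0 : hermitian_form A != 0.
Implicit Types (M N : gf_mat) (Phi : 'M[k]_3).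

Local Notation frame := (frame char5 A).
Local Notation gm := (gm_emb w).
Local Notation ge := (gf_emb w).
Local Notation embE := (gf_embE char5 w2).

Lemma card_eq_I_inj (T : Type) (X : set T) m n : X #= `I_m -> X #= `I_n -> m = n.
Proof. by move=> /card_esym Xm /(card_eq_trans Xm) /card_eq_II. Qed.

Definition gm_scalar r := GM (GV r 0 0) (GV 0 r 0) (GV 0 0 r).

Lemma gm_scalarP r : gf_eq (r * gf_conj r)%gf 1 ->
  gm_unitary (gm_scalar r) /\ gm_stab (gm_scalar r).
Proof.
have H : gf_all (fun r => gf_eq (r * gf_conj r)%gf 1 ==>
  gm_unitary (gm_scalar r) && gm_stab (gm_scalar r)) by vm_compute.
by move=> r1; have := gf_allP H r; rewrite r1 => /andP.
Qed.

Lemma gm_mul_scalar r M : gm (gm_mul (gm_scalar r) M) = ge r *: gm M.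
Proof.
rewrite (gm_emb_mul char5 w2) -mul_scalar_mx; congr (_ *m _); apply/matrixP => i j.
rewrite [RHS]mxE /gm_scalar /gm_emb /gv_emb; elim/ord3P: i; elim/ord3P: j;
  by rewrite !(mx3E, row3E) ?embE.
Qed.

Lemma gm_inj : injective gm.
Proof.
move=> [a b c] [x y z] /row_matrixP E.
have := E 0; have := E 1; have := E 2%:R; rewrite !row_mx3 !row3E.
by do 3![move=> /(gv_inj char5 w2) ->].
Qed.

Lemma gm_normalize p q u v r e : gf_eq (r * e)%gf 1 ->
  gm_mul (gm_scalar r) (GM (GV p 0 q) (GV 0 e 0) (GV u 0 v)) =
    GM (GV (r * p) 0 (r * q)) (GV 0 1 0) (GV (r * u) 0 (r * v))%gf.
Proof.
move=> /(gf_eqP char5 w2) re; rewrite !embE in re; apply: gm_inj.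
rewrite gm_mul_scalar; apply/matrixP => i j; rewrite [LHS]mxE.
by elim/ord3P: i; elim/ord3P: j; rewrite !(mx3E, row3E) ?(gf_embM char5 w2) ?embE ?mulr0 ?re.
Qed.

Lemma secant_vanish Phi x : Phi \in unitmx -> x != 0 ->
  pts (secant_line Phi (row 0 1%:M) (row 2%:R 1%:M)) (pt (x *m Phi)) -> x 0 1 = 0.
Proof.
have c : cross (row 0 1%:M) (row 2%:R 1%:M) = row3 0 (-1) 0 :> 'rV[k]_3.
  rewrite /cross !mxE /=; congr row3; ring.
move=> uPhi x0 /(pts_secant_line uPhi _ x0).
rewrite c dotE !row3E !mulr0 add0r mulrN1 addr0 => E.
apply: oppr_inj; rewrite oppr0 E //.
by apply/eqP => /rowP/(_ 1); rewrite row3E mxE => /eqP; rewrite oppr_eq0 oner_eq0.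
Qed.

(** The middle row of the inverse involves only conjugates of the middle column, so here it is
    [(0, conj e, 0)]; the middle row of the product of the inverse with [M] then gives all three
    claims. *)
Lemma unitary_middle a b c e d f g h i :
  let M := GM (GV a b c) (GV d e f) (GV g h i) in
  gm_unitary M -> b = 0%gf -> h = 0%gf ->
  [/\ d = 0%gf, f = 0%gf & gf_eq (gf_conj e * e) 1]%gf.
Proof.
move=> M uM b0 h0.
have := mulmx1C (gm_invP char5 w2 uM).
rewrite -(gm_emb_mul char5 w2) -(gm1_emb w) => /(congr1 (row 1)).
rewrite /M /gm1 b0 h0 /= !row_mx3 !row3E => /rowP E.
have := E 0; have := E 1; have := E 2%:R; rewrite !row3E !embE ?expr0n /= ?(mulr0, mul0r, addr0, add0r).
move=> ef ee ed.
have e0 : ge e != 0.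
  by apply/eqP => e0; move/eqP: ee; rewrite e0 mulr0 eq_sym oner_eq0.
have e50 : ge e ^+ 5 != 0 by rewrite expf_neq0.
split; last by apply/(gf_eqP char5 w2); rewrite !embE.
  by apply: (gf_emb_inj char5 w2); rewrite embE; apply: (mulfI e50); rewrite ed mulr0.
by apply: (gf_emb_inj char5 w2); rewrite embE; apply: (mulfI e50); rewrite ef mulr0.
Qed.

(** Frames are chosen so that [L] joins the first and last points in both, that is, [L] is [y = 0].
    The first and last rows of the transition matrix then have middle entry 0, unitarity clears the
    rest of the middle row, and a scalar of norm one makes the central entry 1. *)
Lemma common_secant_normal Phi Phi2 L : frame Phi -> frame Phi2 ->
  secants Gamma (conic Phi) L -> secants Gamma (conic Phi2) L ->
  exists s p q u v, let M := GM (GV p 0 q) (GV 0 1 0) (GV u 0 v) in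
    [/\ s \in sl2, gm_unitary M & conic Phi2 = conic (gm M *m (gm s *m Phi))].
Proof.
move=> fPhi fPhi2 /(secantsP w2 GammaA A_neq0 _ fPhi)[p pp LE].
move=> /(secantsP w2 GammaA A_neq0 _ fPhi2)[q qp LE2].
have [p1 p2 p12] := pairs_mem gf_points_uniq pp.
have [q1 q2 q12] := pairs_mem gf_points_uniq qp.
have [s [ss s1 s2]] := reframe w2 fPhi p1 p2 p12.
have [r [rs r1 r2]] := reframe w2 fPhi2 q1 q2 q12.
have [fs cs] := frame_sl2 w2 ss fPhi; have [fr cr] := frame_sl2 w2 rs fPhi2.
have [uPhi _] := fPhi; have [uPhi2 _] := fPhi2.
have [L1 L2] := gsecant_pts char5 w2 uPhi pp.
have [L3 L4] := gsecant_pts char5 w2 uPhi2 qp.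
rewrite -LE s1 s2 in L1 L2; rewrite -LE2 r1 r2 in L3 L4.
set Phis := gm s *m Phi in fs cs L1 L2; set Phir := gm r *m Phi2 in fr cr L3 L4.
have [us _] := fs; have [M uM ME] := frame_rel w2 fs fr.
have nz i : row i (1%:M : 'M[k]_3) != 0.
  by apply/eqP => /rowP/(_ i); rewrite !mxE eqxx => /eqP; rewrite oner_eq0.
have LS : L = secant_line Phis (row 0 1%:M) (row 2%:R 1%:M).
  have c0 : cross (row 0 1%:M) (row 2%:R 1%:M) != 0 :> 'rV[k]_3.
    apply/eqP => /rowP/(_ 1); rewrite row3E !mxE /= mul0r mul1r sub0r => /eqP.
    by rewrite oppr_eq0 oner_eq0.
  have rP i : row i 1%:M *m Phis = row i Phis by rewrite -row_mul mul1mx.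
  by apply: (secant_line_unique us c0 (nz _) (nz _)); rewrite rP; [exact: L1|exact: L2].
have nzM i : row i (gm M) != 0.
  by have := mulmx_neq0 (gm_emb_unit char5 w2 uM) (nz i); rewrite -row_mul mul1mx.
move: L3 L4; rewrite ME !row_mul LS => /(secant_vanish us (nzM _)) M01 /(secant_vanish us (nzM _)) M21.
case: M uM ME M01 M21 {nzM} => [[a b c] [d e f] [g h i]] uM ME.
rewrite !row_mx3 !row3E => b0 h0.
have {}b0 : b = 0%gf by apply: (gf_emb_inj char5 w2); rewrite embE.
have {}h0 : h = 0%gf by apply: (gf_emb_inj char5 w2); rewrite embE.
have [d0 f0 ee] := unitary_middle uM b0 h0.
pose r' := gf_conj e.
have r'1 : gf_eq (r' * gf_conj r')%gf 1.
  apply/(gf_eqP char5 w2); move/(gf_eqP char5 w2): ee; rewrite !embE.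
  by move=> E; rewrite -exprMn mulrC E expr1n.
have [uS sS] := gm_scalarP r'1.
exists s, (r' * a)%gf, (r' * c)%gf, (r' * g)%gf, (r' * i)%gf.
set M := GM _ _ _ in uM ME; set M' := GM _ _ _; cbv zeta.
have M'E : M' = gm_mul (gm_scalar r') M.
  by rewrite /M' /M b0 h0 d0 f0 -(gm_normalize _ _ _ _ ee).
have uM' : gm_unitary M' by rewrite M'E; exact: (gm_unitary_mul char5 w2).
split; [exact: ss|exact: uM'|rewrite M'E (gm_emb_mul char5 w2) -mulmxA -/Phis -ME -cr].
exact/esym/(conic_stab1 w2 fr uS sS).
Qed.

Lemma check_adjacentE p q u v : let M := GM (GV p 0 q) (GV 0 1 0) (GV u 0 v) in
  gm_unitary M -> check_adjacency p q u v.
Proof.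
move=> M uM; have H : check_adjacent by vm_compute.
have /and4P[h1 _ h3 /and4P[_ _ _ /and3P[_ _ h9]]] := uM.
move: h1 h3 h9 => /(gf_eq0P char5 w2) h1 /(gf_eqP char5 w2) h3 /(gf_eq0P char5 w2) h9.
rewrite /gv_herm !embE ?expr0n /= in h1 h3 h9.
move: (gf_allP (gf_allP H p) q).
have -> : gf_eq0 (p * gf_conj q + q * gf_conj p)%gf.
  by apply/(gf_eq0P char5 w2); rewrite !embE -h1; ring.
move=> /gf_allP/(_ u)/gf_allP/(_ v).
have -> : gf_eq (p * gf_conj v + q * gf_conj u)%gf 1.
  by apply/(gf_eqP char5 w2); rewrite !embE -h3; ring.
have -> // : gf_eq0 (u * gf_conj v + v * gf_conj u)%gf.
by apply/(gf_eq0P char5 w2); rewrite !embE -h9; ring.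
Qed.

(** One of the three common secants gives the normal form; then the secant count is tested on
    matrices. The common points of the conics may lie outside F_25, so the condition that there are
    four enters only through the coefficients of the biquadratic. *)
Lemma adjacent_neighbour Phi Q : frame Phi -> adjacent Gamma (conic Phi) Q ->
  exists2 N, N \in gf_neighbours & Q = conic (gm N *m Phi).
Proof.
move=> fPhi [_ /(tangent_conic_frameP char5 uA GammaA A_neq0)[Phi2 fPhi2 ->] _ four three].
have [t [_ st tP]] := (card_seqP _ _).1 three.
case: t st tP => // L t _ tP.
have [LQ LQ'] := (tP L).2 (mem_head _ _).
have [s [p [q [u [v [ss uM cE]]]]]] := common_secant_normal fPhi fPhi2 LQ LQ'.
set M := GM _ _ _ in uM cE; have [fs cs] := frame_sl2 w2 ss fPhi.
rewrite cE; rewrite cE -cs in four three.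
have c3 : common_secants M == 3.
  apply/eqP/(card_eq_I_inj _ three).
  exact: (common_secants_card w2 GammaA A_neq0 fs uM).
have := check_adjacentE uM; rewrite /check_adjacency -/M c3 => /andP[nondeg].
set a := (p * q)%gf in nondeg *; set b := (p * v + q * u - 1)%gf in nondeg *.
set c := (u * v)%gf in nondeg *.
case: ifP => [deg _|_ /allP sP].
  case: (biquadratic_not4 char5 (Phi := gm M *m (gm s *m Phi)) (a := ge a) (b := ge b) (c := ge c) _ _ _ four).
  - by rewrite !(gf_emb_eq0 char5 w2).
  - have -> : ge b ^+ 2 + ge a * ge c = ge (b * b + a * c)%gf by rewrite !embE expr2.
    by rewrite !(gf_emb_eq0 char5 w2).
  have uMs : gm M *m (gm s *m Phi) \in unitmx by case: (frame_gm w2 uM fs).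
  have parM x y : par x y *m gm M = row3 (x ^+ 2 * ge p + y ^+ 2 * ge u) (x * y) (x ^+ 2 * ge q + y ^+ 2 * ge v).
    rewrite /par row3_mulmx /gm_emb !row_mx3 !row3E /gv_emb.
    by apply/rowP; elim/ord3P; rewrite !mxE /= ?embE; ring.
  move=> P [sPP MP]; have [PE|[t' PE]] := conic_pts_par uMs MP; [left|right].
    split; last exact: PE.
    move: sPP; rewrite PE => /(pts_conic_gm w2 fs uM (par01_neq0 k)); rewrite parM /q0 !row3E /c !embE => <-.
    by ring.
  exists t'; last exact: PE.
  move: sPP; rewrite PE => /(pts_conic_gm w2 fs uM (par_neq0 t')); rewrite parM /q0 !row3E /a /b /c !embE => <-.
  by ring.
(* The normal form is relative to the frame [gm s *m Phi], but the neighbour is wanted relative to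
   [Phi]; for this reason the check runs over every [s] in [sl2]. *)
have /hasP[N Nn stab] := sP _ ss.
exists N; first exact: Nn.
rewrite mulmxA -(gm_emb_mul char5 w2).
have us := sl2_unitary ss.
apply: (conic_gm_stab w2 _ _ fPhi stab); first exact: (gm_unitary_mul char5 w2).
by apply/gf_conics_unitary/mem_behead/mem_take/Nn.
Qed.

End AdjacentConics.

Section Components.
Variables (k : closedFieldType) (char5 : 5%N \in [pchar k]).
Variables (w : k) (w2 : w ^+ 2 = 2).
Variables (A : 'M[k]_3) (Gamma : curve k 6).
Hypotheses (uA : A \in unitmx) (GammaA : forms Gamma (hermitian_form A)).
Hypothesis A_neq0 : hermitian_form A != 0.
Implicit Types (M N : gf_mat) (Phi : 'M[k]_3).

Local Notation frame := (frame char5 A).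
Local Notation gm := (gm_emb w).
Local Notation ge := (gf_emb w).

Lemma gf_neighboursE : check_neighbours. Proof. by vm_compute. Qed.

Lemma neighbour_conics N : N \in gf_neighbours -> N \in gf_conics.
Proof. by move=> Nn; apply/mem_behead/mem_take/Nn. Qed.

Lemma quartic_parametrized (S : 'M[k]_3) : exists g : {poly k},
  (size g <= 5)%N /\ forall t, g.[t] = q0 (par 1 t *m S).
Proof.
pose X (i : 'I_3) : {poly k} := (S 0 i)%:P + S 1 i *: 'X + S 2%:R i *: 'X^2.
have sX i : (size (X i) <= 3)%N.
  rewrite (leq_trans (size_polyD _ _)) // geq_max (leq_trans (size_scale_leq _ _)) ?size_polyXn // andbT.
  rewrite (leq_trans (size_polyD _ _)) // geq_max (leq_trans (size_scale_leq _ _)) ?size_polyX // andbT.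
  by rewrite size_polyC (leq_trans (leq_b1 _)).
have sXX i j : (size (X i * X j)%R <= 5)%N.
  by rewrite (leq_trans (size_polyMleq _ _)) // -subn1 leq_subLR (leq_add (sX i) (sX j)).
exists (X 0 * X 2%:R - X 1 * X 1); split=> [|t].
  by rewrite (leq_trans (size_polyD _ _)) // geq_max size_polyN !sXX.
have XE i : (X i).[t] = (par 1 t *m S) 0 i.
  by rewrite /par row3_mulmx /X !(hornerD, hornerZ, hornerXn, hornerX, hornerC) !mxE; ring.
by rewrite hornerD hornerN !hornerM !XE /q0 expr2.
Qed.

(** The quartic in the parameter already has four roots in F_25, and its degree leaves no room for
    further ones in [k]; the point at infinity is excluded separately. *)
Lemma neighbour_points N Phi : frame Phi -> N \in gf_neighbours ->
  pts (conic Phi) `&` pts (conic (gm N *m Phi)) #= `I_4.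
Proof.
move=> fPhi Nn; have /and3P[_ inf /eqP cnt] := allP gf_neighboursE N Nn.
have uN := gf_conics_unitary (neighbour_conics Nn).
have [uNPhi _] := frame_gm w2 uN fPhi.
set Z := fun t => _ in cnt.
have [g [sg gE]] := quartic_parametrized (gm N).
have ZE t : Z t = (g.[ge t] == 0).
  by rewrite /Z -(gf_emb_eq0 char5 w2) (gf_emb_q0 char5 w2) (gv_emb_mul char5 w2) (gv_emb_par char5 w2) gE.
have g0 : g != 0.
  apply/eqP => g0; move: cnt; rewrite (@eq_count _ _ predT) // => t.
  by rewrite ZE g0 horner0 eqxx.
pose rs := [seq ge t | t <- gf_enum & Z t].
have rsP t : t \in rs -> g.[t] = 0.
  by case/mapP=> x + ->; rewrite mem_filter ZE => /andP[/eqP].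
have urs : uniq rs by rewrite (map_inj_uniq (gf_emb_inj char5 w2)) filter_uniq.
have srs : size rs = 4 by rewrite size_map size_filter.
have rootsE t : g.[t] = 0 -> t \in rs.
  move=> gt; apply: contraT => nt.
  have : (size (t :: rs) < size g)%N.
    apply: max_poly_roots; [exact: g0| |by rewrite cons_uniq nt urs].
    apply/allP => x; rewrite in_cons rootE => /orP[/eqP->|/rsP->]; last exact: eqxx.
    by rewrite gt.
  by rewrite -[size (t :: rs)]/(size rs).+1 srs => /leq_trans/(_ sg).
apply/card_seqP; exists [seq pt (par 1 t *m (gm N *m Phi)) | t <- rs].
split.
- by rewrite map_inj_uniq // => s t; exact: par_inj.
- by rewrite size_map.
move=> P; split=> [[PP NP]|/mapP[t /rsP tr ->]].
  have [PE|[t PE]] := conic_pts_par uNPhi NP; move: PP; rewrite PE.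
    move=> /(pts_conic_gm w2 fPhi uN (par01_neq0 k)).
    rewrite -(gv_emb_inf w) -(gv_emb_mul char5 w2) -(gf_emb_q0 char5 w2).
    by move/eqP; rewrite (gf_emb_eq0 char5 w2) (negbTE inf).
  move=> /(pts_conic_gm w2 fPhi uN (par_neq0 t)); rewrite -gE => /rootsE tr.
  by apply: map_f.
split; first by apply/(pts_conic_gm w2 fPhi uN (par_neq0 _)); rewrite -gE.
apply/(pts_conic_mul uNPhi (par_neq0 _)).
by rewrite /q0 !row3E; ring.
Qed.

Lemma neighbour_adjacent N Phi : frame Phi -> N \in gf_neighbours ->
  adjacent Gamma (conic Phi) (conic (gm N *m Phi)).
Proof.
move=> fPhi Nn; have Nc := neighbour_conics Nn; have uN := gf_conics_unitary Nc.
have fN := frame_gm w2 uN fPhi; split.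
- exact: (frame_tangent GammaA A_neq0 fPhi).
- exact: (frame_tangent GammaA A_neq0 fN).
- rewrite -[X in conic X = _](mul1mx Phi) -(gm1_emb w).
  move=> /(conics_inj w2 GammaA A_neq0 fPhi) E.
  have /negP[] : gm1 \notin gf_neighbours by vm_compute.
  by rewrite (E _ Nc).
- exact: neighbour_points.
have /and3P[/eqP c3 _ _] := allP gf_neighboursE N Nn.
by have := common_secants_card w2 GammaA A_neq0 fPhi uN; rewrite c3.
Qed.

Lemma adjacent_sym Q Q' : adjacent Gamma Q Q' -> adjacent Gamma Q' Q.
Proof.
by case=> tQ tQ' /nesym ne i4 i3; split; rewrite // setIC.
Qed.

Lemma component_refl Q : component Gamma Q Q. Proof. exact: rt_refl. Qed.

Lemma component_eq Q Q' : component Gamma Q Q' -> component Gamma Q = component Gamma Q'.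
Proof.
have sym P P' : component Gamma P P' -> component Gamma P' P.
  elim=> [x y /adjacent_sym|x|x y z _ yx _ zy]; [exact: rt_step|exact: rt_refl|].
  exact: rt_trans zy yx.
move=> QQ'; apply/seteqP; split=> P; apply: rt_trans; last exact: QQ'.
exact: sym.
Qed.

Lemma in_conics_component M Phi : frame Phi -> gm_unitary M -> in_conics M ->
  exists2 N, N \in gf_conics & conic (gm M *m Phi) = conic (gm N *m Phi).
Proof.
move=> fPhi uM /hasP[N Nc stab]; exists N; first exact: Nc.
exact: (conic_gm_stab w2 uM (gf_conics_unitary Nc) fPhi stab).
Qed.

Lemma conic1 Phi : conic Phi = conic (gm gm1 *m Phi).
Proof. by rewrite (gm1_emb w) mul1mx. Qed.

(** The list is closed under passing to neighbours: those of the conic with frame [gm M *m Phi] are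
    given by products [N M], which [check_closed] finds in the list again. Conversely, paths of
    length at most two reach every entry. *)
Lemma componentE Phi : frame Phi -> component Gamma (conic Phi) =
  [set Q | exists2 M, M \in gf_conics & Q = conic (gm M *m Phi)].
Proof.
move=> fPhi; apply/seteqP; split=> Q.
  set X := [set Q | _]; have X0 : X (conic Phi).
    by exists gm1; [exact: mem_head|exact: conic1].
  suff: component Gamma (conic Phi) Q -> X (conic Phi) -> X Q by move=> H /H; apply.
  elim=> [x y + [M Mc xE]|//|x y z _ IH1 _ IH2 /IH1 /IH2 //].
  have uM := gf_conics_unitary Mc.
  rewrite xE => /(adjacent_neighbour w2 uA GammaA A_neq0 (frame_gm w2 uM fPhi))[N Nn ->].
  have uN := gf_conics_unitary (neighbour_conics Nn).
  have H : check_closed by vm_compute.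
  have NM := allP (allP H M Mc) N Nn.
  have [N' N'c E] := in_conics_component fPhi (gm_unitary_mul char5 w2 uN uM) NM.
  by exists N'; [exact: N'c|rewrite mulmxA -(gm_emb_mul char5 w2)].
case=> M Mc ->; have uM := gf_conics_unitary Mc.
have H : check_connected by vm_compute.
case/orP: (allP H M Mc) => [stab|/hasP[N Nn /hasP[N' N'n]]].
  by rewrite (conic_stab1 w2 fPhi uM stab); exact: component_refl.
have uN := gf_conics_unitary (neighbour_conics Nn).
have uN' := gf_conics_unitary (neighbour_conics N'n).
case/orP=> stab.
  rewrite (conic_gm_stab w2 uM uN fPhi stab).
  by apply: rt_step; exact: neighbour_adjacent.
rewrite (conic_gm_stab w2 uM (gm_unitary_mul char5 w2 uN' uN) fPhi stab).
rewrite (gm_emb_mul char5 w2) -mulmxA; apply: (@rt_trans _ _ _ (conic (gm N *m Phi))).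
  by apply: rt_step; exact: neighbour_adjacent.
by apply: rt_step; apply: neighbour_adjacent N'n; exact: (frame_gm w2).
Qed.

End Components.

Lemma gf_inverse c : ~~ gf_eq0 c -> exists r, gf_mul r c = 1%gf.
Proof.
have H : gf_all (fun c => gf_eq0 c || has (fun r => gf_mul r c == 1%gf) gf_enum) by vm_compute.
by move=> c0; have := gf_allP H c; rewrite (negbTE c0) => /hasP[r _ /eqP]; exists r.
Qed.

(** * Normal form of a pair of components *)

Section NormalForm.
Variables (k : closedFieldType) (char5 : 5%N \in [pchar k]).
Variables (w : k) (w2 : w ^+ 2 = 2).
Variables (A : 'M[k]_3) (Gamma : curve k 6).
Hypotheses (uA : A \in unitmx) (GammaA : forms Gamma (hermitian_form A)).
Hypothesis A_neq0 : hermitian_form A != 0.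
Implicit Types (M N : gf_mat) (Phi : 'M[k]_3).

Local Notation frame := (frame char5 A).
Local Notation gv := (gv_emb w).
Local Notation gm := (gm_emb w).
Local Notation ge := (gf_emb w).
Local Notation gpt := (gpt w).
Local Notation embE := (gf_embE char5 w2).

Lemma isotropic_covered x : gf_eq0 (gv_herm x x) -> gv x != 0 ->
  exists2 N, N \in gf_conics & q0 (gv x *m invmx (gm N)) = 0.
Proof.
move=> /(gf_eq0P char5 w2) x_iso x0.
have /andP[H1 H2] : check_cover by vm_compute.
suff [r [v [r0 vE]]] : exists r v, [/\ r != 0, gv v = r *: gv x &
    has (fun N => gf_eq0 (gv_q0 (gv_mul v N))) (map gm_inv gf_conics)].
  case/hasP=> _ /mapP[N Nc ->] /(gf_eq0P char5 w2).
  rewrite (gf_emb_q0 char5 w2) (gv_emb_mul char5 w2) vE (gm_invE char5 w2 (gf_conics_unitary Nc)) => E.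
  exists N; first exact: Nc.
  have r2 : r ^+ 2 != 0 by rewrite expf_neq0.
  apply: (mulfI r2); rewrite mulr0 -E -scalemxAl /q0 !mxE; ring.
case: x x_iso x0 => a b c x_iso x0.
have [/(gf_eq0P char5 w2) c0|c0] := boolP (gf_eq0 c).
  have b0 : ge b = 0.
    move: x_iso; rewrite /gv_herm !embE c0 expr0n /= mulr0 mul0r addr0 sub0r => /eqP.
    by rewrite oppr_eq0 mulf_eq0 (negbTE (two_neq0 char5)) orFb -exprS expf_eq0 => /andP[_ /eqP].
  have a0 : ~~ gf_eq0 a.
    rewrite -(gf_emb_eq0 char5 w2); apply: contra_neq x0 => a0.
    by rewrite /gv_emb a0 b0 c0; apply/rowP; elim/ord3P; rewrite row3E mxE.
  have [r ra] := gf_inverse a0; have {}ra := congr1 ge ra; rewrite !embE in ra.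
  exists (ge r), (GV 1 0 0); split; last exact: H1.
    by apply/eqP => r0; move/eqP: ra; rewrite r0 mul0r eq_sym oner_eq0.
  by apply/rowP; elim/ord3P; rewrite [RHS]mxE /gv_emb !row3E ?b0 ?c0 !embE ?mulr0 ?ra.
have [r rc] := gf_inverse c0; have {}rc := congr1 ge rc; rewrite !embE in rc.
pose v := GV (r * a)%gf (r * b)%gf 1%gf.
have vE : gv v = ge r *: gv (GV a b c).
  by apply/rowP; elim/ord3P; rewrite [RHS]mxE /gv_emb !row3E !embE ?rc.
exists (ge r), v; split; [|exact: vE|].
  by apply/eqP => r0; move/eqP: rc; rewrite r0 mul0r eq_sym oner_eq0.
have := gf_allP (gf_allP H2 (r * b)%gf) (r * a)%gf; cbv beta zeta; rewrite -/v.
suff -> : gf_eq0 (gv_herm v v) by [].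
apply/(gf_eq0P char5 w2); rewrite (gf_emb_herm char5 w2) vE map_mxZ linearZ /=.
rewrite -!scalemxAl -!scalemxAr mxE [X in _ * X]mxE.
by move: x_iso; rewrite (gf_emb_herm char5 w2) => ->; rewrite !mulr0.
Qed.

Lemma triangular Phi Phi2 : frame Phi -> frame Phi2 ->
  exists M l p t, [/\ M = GM (GV l 0 0) (GV p 1 0) t, ~~ gf_eq0 l, gm_unitary M &
    component Gamma (conic Phi2) (conic (gm M *m Phi))].
Proof.
move=> fPhi fPhi2; have [uPhi _] := fPhi; have [uPhi2 _] := fPhi2.
have nz i : row i (1%:M : 'M[k]_3) != 0.
  by apply/eqP => /rowP/(_ i); rewrite !mxE eqxx => /eqP; rewrite oner_eq0.
have [[u0 u1 u2] uX XE] := frame_rel w2 fPhi2 fPhi.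
have u00 : gv u0 != 0.
  have := mulmx_neq0 (gm_emb_unit char5 w2 uX) (nz 0).
  by rewrite -row_mul mul1mx row_mx3 row3E.
have iso : gf_eq0 (gv_herm u0 u0) by case/andP: uX.
have [N Nc q0N] := isotropic_covered iso u00.
have uN := gf_conics_unitary Nc; have fN := frame_gm w2 uN fPhi2; have [uNPhi _] := fN.
have eN := gm_emb_unit char5 w2 uN.
have r0E : row 0 Phi = (gv u0 *m invmx (gm N)) *m (gm N *m Phi2).
  by rewrite XE row_mul row_mx3 row3E mulmxA mulmxKV.
have par0 : gv (GV 1 0 0) *m Phi = row 0 Phi.
  rewrite /gv_emb !embE row3_mulmx scale1r !scale0r !addr0; by [].
have P0 : (pts (conic (gm N *m Phi2)) `&` pts Gamma) (pt (row 0 Phi)).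
  split.
    rewrite r0E; apply/pts_conic_mul; first exact: uNPhi; last exact: q0N.
    by apply: mulmx_neq0 u00; rewrite unitmx_inv.
  have [] // : (pts (conic Phi) `&` pts Gamma) (pt (row 0 Phi)).
  apply/(gpt_six w2 GammaA A_neq0 _ fPhi); exists (GV 1 0 0); first by vm_compute.
  by rewrite /gpt par0.
have /(gpt_six w2 GammaA A_neq0 _ fN)[u up uE] := P0.
have [u' u'p uu'] : exists2 u', u' \in gf_points & u != u'.
  have H : all (fun u => has (fun u' => u != u') gf_points) gf_points by vm_compute.
  by have /hasP[u' ? ?] := allP H u up; exists u'.
have [s [ss sE _]] := reframe w2 fN up u'p uu'.
have [fs cs] := frame_sl2 w2 ss fN; have [b ub bE] := frame_rel w2 fPhi fs.
(* Both frames now start at the same point, so the first row of the transition matrix is a multiple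
   of [(1, 0, 0)]. *)
have [a a0 rb] : exists2 a, a != 0 & row 0 (gm b) = a *: row 0 1%:M.
  apply/(eq_pt_mul uPhi _ (nz 0)).
    by have := mulmx_neq0 (gm_emb_unit char5 w2 ub) (nz 0); rewrite -row_mul mul1mx.
  by rewrite -!row_mul mul1mx -bE -sE -uE.
case: b ub bE rb => [[l b c] [d e f] [g h i]] ub bE.
rewrite row_mx3 row3E => /rowP rb.
have := rb 0; have := rb 1; have := rb 2%:R; rewrite /gv_emb !row3E !mxE /= !mulr0 mulr1.
move=> c0 b0 la.
have {}b0 : b = 0%gf by apply: (gf_emb_inj char5 w2); rewrite !embE.
have {}c0 : c = 0%gf by apply: (gf_emb_inj char5 w2); rewrite !embE.
have l0 : ge l != 0 by rewrite la.
move: {rb la} ub bE; rewrite b0 c0 => ub bE.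
have /and4P[_ /(gf_eq0P char5 w2) h1 _ /and4P[_ /(gf_eqP char5 w2) h2 _ _]] := ub.
rewrite /gv_herm !embE ?expr0n /= in h1.
(* Orthogonality of the first two rows reads [l * conj f = 0]. *)
have f0 : f = 0%gf.
  have /eqP : ge l * ge f ^+ 5 = 0 by rewrite -h1; ring.
  rewrite mulf_eq0 (negbTE l0) orFb expf_eq0 => /andP[_ /eqP f0].
  by apply: (gf_emb_inj char5 w2); rewrite !embE.
rewrite f0 /gv_herm !embE ?expr0n /= in h2.
(* The middle row has the Hermitian value -2, so [e] has norm one; scaling by its conjugate makes
   the central entry 1 and preserves the conic. *)
have ee : ge e ^+ 5 * ge e = 1.
  have m2 : - 2 != 0 :> k by rewrite oppr_eq0 two_neq0.
  by apply: (mulfI m2); rewrite mulr1 -[RHS]h2; ring.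
pose r := gf_conj e.
have r1 : gf_eq (r * gf_conj r)%gf 1.
  by apply/(gf_eqP char5 w2); rewrite !embE -exprMn [ge e * _]mulrC ee expr1n.
have [uS sS] := gm_scalarP r1.
have re : gf_mul r e = 1%gf by apply: (gf_emb_inj char5 w2); rewrite !embE.
have r0 : ge r != 0.
  by apply/eqP => r0; move/eqP: ee; rewrite -(gf_emb_conj char5 w2) -/r r0 mul0r eq_sym oner_eq0.
set M0 := GM _ _ _ in ub bE.
exists (gm_mul (gm_scalar r) M0), (r * l)%gf, (r * d)%gf, (gv_mul (GV 0 0 r) M0).
split.
- have row0E : gv_mul (GV r 0 0) M0 = GV (r * l)%gf 0 0.
    apply: (gv_inj char5 w2); rewrite /M0 /gv_mul /gv_emb.
    by apply/rowP; elim/ord3P; rewrite !row3E !embE; ring.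
  have row1E : gv_mul (GV 0 r 0) M0 = GV (r * d)%gf 1 0.
    apply: (gv_inj char5 w2); rewrite /M0 /gv_mul /gv_emb f0 -re.
    by apply/rowP; elim/ord3P; rewrite !row3E !embE; ring.
  by rewrite -row0E -row1E.
- by rewrite -(gf_emb_eq0 char5 w2) embE mulf_neq0.
- exact: (gm_unitary_mul char5 w2).
rewrite (gm_emb_mul char5 w2) -mulmxA -bE (conic_stab1 w2 fs uS sS) cs.
rewrite (componentE w2 uA GammaA A_neq0 fPhi2); exists N; [exact: Nc|reflexivity].
Qed.

End NormalForm.

(** * Reduction of triangular matrices to the computed cases *)

Section Reduction.
Variables (k : closedFieldType) (char5 : 5%N \in [pchar k]).
Variables (w : k) (w2 : w ^+ 2 = 2).
Variables (A : 'M[k]_3).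
Implicit Types (M N : gf_mat) (Phi : 'M[k]_3).

Local Notation frame := (frame char5 A).
Local Notation gm := (gm_emb w).
Local Notation embE := (gf_embE char5 w2).

Lemma gf_eqE x y : gf_eq x y -> x = y.
Proof. by move=> /(gf_eqP char5 w2)/(gf_emb_inj char5 w2). Qed.

Lemma torus_reduction l p t Phi : let M := GM (GV l 0 0) (GV p 1 0) t in
  frame Phi -> gm_unitary M -> ~~ gf_eq0 l -> exists l' t',
  let M' := GM (GV l' 0 0) (GV p 1 0) t' in
  [/\ l' \in gf_classes, gm_unitary M' & conic (gm M' *m Phi) = conic (gm M *m Phi)].
Proof.
move=> M fPhi uM l0; have H : check_torus by vm_compute.
have := gf_allP H l; rewrite (negbTE l0) orFb => /hasP[c cc /hasP[l' l'c /gf_eqE lE]].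
have [uS sS] : gm_unitary (gm_torus c) /\ gm_stab (gm_torus c).
  have T : all (fun c => gm_unitary (gm_torus c) && gm_stab (gm_torus c)) [:: f1; f2; f3; f4] by vm_compute.
  exact/andP/(allP T).
pose d : gf := gf_of (f5_mul c (f5_mul c c)).
exists l', (gv_mul (GV 0 0 d) M) => M'.
have ME : M' = gm_mul (gm_torus c) M.
  have row0E : gv_mul (GV (gf_of c) 0 0) M = GV l' 0 0.
    apply: (gv_inj char5 w2); rewrite /M /gv_mul /gv_emb -lE; case: {M' M uM} t => x y z.
    by apply/rowP; elim/ord3P; rewrite !row3E !embE; ring.
  have row1E : gv_mul (GV 0 1 0) M = GV p 1 0.
    apply: (gv_inj char5 w2); rewrite /M /gv_mul /gv_emb; case: {M' M uM row0E} t => x y z.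
    by apply/rowP; elim/ord3P; rewrite !row3E !embE; ring.
  by rewrite /M' -row0E -row1E.
have uM' : gm_unitary M' by rewrite ME; exact: (gm_unitary_mul char5 w2).
split; [exact: l'c|exact: uM'|].
by rewrite ME (gm_emb_mul char5 w2) -mulmxA (conic_stab1 w2 (frame_gm w2 uM fPhi) uS sS).
Qed.

(** The shears [gm_sym2 f1 f0 d f1] fix the first row of [M] and add [2 d l] to [p]; again only the
    frame of the second conic changes. *)
Lemma shear_reduction l p t Phi : let M := GM (GV l 0 0) (GV p 1 0) t in
  frame Phi -> gm_unitary M -> l \in gf_classes -> exists e t',
  let M' := GM (GV l 0 0) (GV (l * GF f0 e)%gf 1 0) t' in
  gm_unitary M' /\ conic (gm M' *m Phi) = conic (gm M *m Phi).
Proof.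
move=> M fPhi uM lc; have H : check_shear by vm_compute.
have /f5_hasP[d /f5_hasP[e /gf_eqE pE]] := gf_allP (allP H l lc) p.
have [uS sS] : gm_unitary (gm_sym2 f1 f0 d f1) /\ gm_stab (gm_sym2 f1 f0 d f1).
  have T : f5_all (fun d => gm_unitary (gm_sym2 f1 f0 d f1) && gm_stab (gm_sym2 f1 f0 d f1)) by vm_compute.
  exact/andP/(f5_allP T).
have SE : exists x, gm_sym2 f1 f0 d f1 = GM (GV 1 0 0) (GV (gf_of (f5_mul f2 d)) 1 0) x.
  by case: {pE uS sS} d; eexists; reflexivity.
have [x xE] := SE; rewrite xE in uS sS.
exists e, (gv_mul x M) => M'.
have ME : M' = gm_mul (GM (GV 1 0 0) (GV (gf_of (f5_mul f2 d)) 1 0) x) M.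
  have row0E : gv_mul (GV 1 0 0) M = GV l 0 0.
    apply: (gv_inj char5 w2); rewrite /M /gv_mul /gv_emb; case: {M' M uM} t => y z y'.
    by apply/rowP; elim/ord3P; rewrite !row3E !embE; ring.
  have row1E : gv_mul (GV (gf_of (f5_mul f2 d)) 1 0) M = GV (l * GF f0 e)%gf 1 0.
    apply: (gv_inj char5 w2); rewrite -pE /M /gv_mul /gv_emb; case: {M' M uM row0E} t => y z y'.
    by apply/rowP; elim/ord3P; rewrite !row3E !embE; ring.
  by rewrite /M' -row0E -row1E.
have uM' : gm_unitary M' by rewrite ME; exact: (gm_unitary_mul char5 w2).
split; first exact: uM'.
by rewrite ME (gm_emb_mul char5 w2) -mulmxA (conic_stab1 w2 (frame_gm w2 uM fPhi) uS sS).
Qed.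

Lemma check_typesE : check_types. Proof. by vm_compute. Qed.

Lemma types_verdict l e t : let M := GM (GV l 0 0) (GV (l * GF f0 e)%gf 1 0) t in
  gm_unitary M -> l \in gf_classes -> in_conics M \/ verdict (meeting_table M).
Proof.
case: t => x y z M uM lc.
have /and4P[_ _ /(gf_eqP char5 w2) h1 /and4P[_ _ /(gf_eq0P char5 w2) h2 _]] := uM.
have := gf_allP (f5_allP (allP check_typesE l lc) e) z; cbv beta.
have -> : gf_eq (l * gf_conj z)%gf 1.
  apply/(gf_eqP char5 w2); rewrite -h1 /gv_herm !embE; ring.
move=> /gf_allP/(_ y); cbv beta zeta.
(* The entry [x] is paired with the zero at the end of the middle row, so 0 can stand for it and the
   search is pruned before [x] is chosen. *)
have -> : gf_eq0 (gv_herm (GV (l * GF f0 e)%gf 1 0) (GV 0 y z)).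
  apply/(gf_eq0P char5 w2); rewrite -h2 /gv_herm !embE; ring.
move=> /gf_allP/(_ x); cbv beta zeta; rewrite -/M uM.
by case: ifP => [_ _|_]; [left|right].
Qed.

Lemma triangular_verdict l p t Phi : let M := GM (GV l 0 0) (GV p 1 0) t in
  frame Phi -> gm_unitary M -> ~~ gf_eq0 l -> exists M',
  [/\ gm_unitary M', conic (gm M' *m Phi) = conic (gm M *m Phi) &
      in_conics M' \/ verdict (meeting_table M')].
Proof.
move=> M fPhi uM l0; have [l' [t' [l'c uM' cM']]] := torus_reduction fPhi uM l0.
have [e [t2 [uM2 cM2]]] := shear_reduction fPhi uM' l'c.
exists (GM (GV l' 0 0) (GV (l' * GF f0 e)%gf 1 0) t2); split; [exact: uM2| |exact: types_verdict].
exact (etrans cM2 cM').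
Qed.

End Reduction.

(** * Types *)

Section Types.
Variables (k : closedFieldType) (char5 : 5%N \in [pchar k]).
Variables (w : k) (w2 : w ^+ 2 = 2).
Variables (A : 'M[k]_3) (Gamma : curve k 6).
Hypotheses (uA : A \in unitmx) (GammaA : forms Gamma (hermitian_form A)).
Hypothesis A_neq0 : hermitian_form A != 0.
Implicit Types (M N C : gf_mat) (Phi : 'M[k]_3).

Local Notation frame := (frame char5 A).
Local Notation gm := (gm_emb w).

Definition meeting_row M C := [seq meets C (gm_mul N M) | N <- gf_conics].

Lemma meeting_tableE M : meeting_table M = [seq meeting_row M C | C <- gf_conics].
Proof.
rewrite /meeting_table -map_comp; apply: eq_map => C.
rewrite /meeting_row [LHS]/comp -map_comp; apply: eq_map => N.
by rewrite [LHS]/comp count_map.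
Qed.

Lemma gf_conics_uniq : uniq gf_conics. Proof. by vm_compute. Qed.

(** With [X] arbitrary this serves twice: for the meeting numbers along a row of the table, and for
    the number of rows of a given type. *)
Lemma card_conics Phi (P : pred gf_mat) (X : set (curve k 2)) : frame Phi ->
  (forall C, C \in gf_conics -> X (conic (gm C *m Phi)) <-> P C) ->
  [set Q | component Gamma (conic Phi) Q /\ X Q] #= `I_(count P gf_conics).
Proof.
move=> fPhi XP; apply/card_seqP.
exists [seq conic (gm C *m Phi) | C <- gf_conics & P C]; split.
- rewrite map_inj_in_uniq; first exact: filter_uniq gf_conics_uniq.
  move=> C C'; rewrite !mem_filter => /andP[_ Cc] /andP[_ C'c].
  exact: (conics_inj w2 GammaA A_neq0 fPhi).
- by rewrite size_map size_filter.
move=> Q; rewrite (componentE w2 uA GammaA A_neq0 fPhi); split.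
  case=> -[C Cc ->] /(XP C Cc) PC; apply: (map_f (fun C => conic (gm C *m Phi))).
  by rewrite mem_filter PC.
case/mapP=> C; rewrite mem_filter => /andP[PC Cc] ->; split; last exact/(XP C Cc).
by exists C; [exact: Cc|reflexivity].
Qed.

Section Pair.
Variables (M : gf_mat) (Phi : 'M[k]_3).
Hypotheses (uM : gm_unitary M) (fPhi : frame Phi).
Let D' := component Gamma (conic (gm M *m Phi)).

Lemma meeting_card C i : C \in gf_conics ->
  meeting Gamma (conic (gm C *m Phi)) D' i #= `I_(occurs i (meeting_row M C)).
Proof.
move=> Cc; rewrite /occurs /meeting_row count_map.
apply: (card_conics (frame_gm w2 uM fPhi)) => N Nc.
have uC := gf_conics_unitary Cc; have uN := gf_conics_unitary Nc.
have := meet_card w2 GammaA A_neq0 fPhi uC (gm_unitary_mul char5 w2 uN uM).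
rewrite (gm_emb_mul char5 w2) -mulmxA => meetE; split=> [|/eqP <-]; last exact: meetE.
by move=> /(card_eq_I_inj meetE) /= ->.
Qed.

Lemma meeting_cardP C i n : C \in gf_conics ->
  meeting Gamma (conic (gm C *m Phi)) D' i #= `I_n <-> occurs i (meeting_row M C) == n.
Proof.
move=> /(meeting_card i) E; split=> [/(card_eq_I_inj E) ->|/eqP <-]; last exact: E.
exact: eqxx.
Qed.

Definition of_type (t : pair_type) : pred (seq nat) :=
  match t with type_alpha => is_alpha | type_beta => is_beta | type_gamma => is_gamma end.

Lemma has_typeP C t : C \in gf_conics ->
  has_type Gamma (conic (gm C *m Phi)) D' t <-> of_type t (meeting_row M C).
Proof.
move=> Cc; have E i n := meeting_cardP i n Cc; case: t; split.
- by case=> /E h1 /E h2; apply/andP; split; [exact: h1|exact: h2].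
- by case/andP=> h1 h2; split; apply/E; [exact: h1|exact: h2].
- by case=> /E h1 /E h2 /E h3; apply/and3P; split; [exact: h1|exact: h2|exact: h3].
- by case/and3P=> h1 h2 h3; split; apply/E; [exact: h1|exact: h2|exact: h3].
- by case=> /E h1 /E h2; apply/andP; split; [exact: h1|exact: h2].
by case/andP=> h1 h2; split; apply/E; [exact: h1|exact: h2].
Qed.

Let D := component Gamma (conic Phi).

Lemma type_card t :
  [set Q | D Q /\ has_type Gamma Q D' t] #= `I_(count (of_type t) (meeting_table M)).
Proof.
rewrite meeting_tableE count_map; apply: (card_conics fPhi) => C Cc.
exact: has_typeP.
Qed.

Lemma type_all t : all (of_type t) (meeting_table M) -> forall Q, D Q -> has_type Gamma Q D' t.
Proof.
rewrite meeting_tableE all_map => /allP H Q.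
rewrite /D (componentE w2 uA GammaA A_neq0 fPhi) => -[C Cc ->].
exact/(has_typeP _ Cc)/(H C Cc).
Qed.

Lemma verdict_types : verdict (meeting_table M) ->
  [\/ (forall Q, D Q -> has_type Gamma Q D' type_beta),
      (forall Q, D Q -> has_type Gamma Q D' type_gamma),
      ([set Q | D Q /\ has_type Gamma Q D' type_alpha] #= `I_15 /\
       [set Q | D Q /\ has_type Gamma Q D' type_gamma] #= `I_6)
    | ([set Q | D Q /\ has_type Gamma Q D' type_alpha] #= `I_3 /\
       [set Q | D Q /\ has_type Gamma Q D' type_gamma] #= `I_18)].
Proof.
have cA : _ #= `I_(count is_alpha (meeting_table M)) := type_card type_alpha.
have cG : _ #= `I_(count is_gamma (meeting_table M)) := type_card type_gamma.
case/or4P=> [b|g|/andP[/eqP a /eqP g]|/andP[/eqP a /eqP g]].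
- exact (Or41 _ _ _ (type_all (t := type_beta) b)).
- exact (Or42 _ _ _ (type_all (t := type_gamma) g)).
- by rewrite a in cA; rewrite g in cG; apply: Or43; split; [exact: cA|exact: cG].
by rewrite a in cA; rewrite g in cG; apply: Or44; split; [exact: cA|exact: cG].
Qed.

End Pair.
End Types.

Theorem proposition1p6 (k : closedFieldType) (char5 : 5%N \in [pchar k])
    (Gamma : curve k 6) (hGamma : hermitian_curve Gamma)
    (D D' : set (curve k 2)) (hD : components Gamma D)
    (hD' : components Gamma D') (neqDD' : D <> D') :
  [\/ (forall Q, D Q -> has_type Gamma Q D' type_beta),
      (forall Q, D Q -> has_type Gamma Q D' type_gamma),
      ([set Q | D Q /\ has_type Gamma Q D' type_alpha] #= `I_15 /\
       [set Q | D Q /\ has_type Gamma Q D' type_gamma] #= `I_6)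
    | ([set Q | D Q /\ has_type Gamma Q D' type_alpha] #= `I_3 /\
       [set Q | D Q /\ has_type Gamma Q D' type_gamma] #= `I_18)].
Proof.
have [A [uA GammaA A_neq0]] := hermitian_curveP char5 hGamma.
(* As 2 is not a square modulo 5, a root [w] generates the field with 25 elements inside [k]. *)
have [w w2] := closed_sqrt 1 (2 : k).
case: hD => Q /(tangent_conic_frameP char5 uA GammaA A_neq0)[Phi fPhi QE] DE.
case: hD' => Q' /(tangent_conic_frameP char5 uA GammaA A_neq0)[Phi2 fPhi2 QE'] DE'.
have [M [l [p [t [ME l0 uM CM]]]]] := triangular w2 uA GammaA A_neq0 fPhi fPhi2.
rewrite ME in uM CM.
have [M' [uM' cM' verd]] := triangular_verdict w2 fPhi uM l0.
rewrite -cM' -QE' in CM; have {}DE' := etrans (esym DE') (component_eq CM).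
rewrite QE in DE; rewrite -{}DE in neqDD' *; rewrite {}DE' in neqDD' *.
(* If the matrix represents one of the 21 conics of [D], the two components meet and therefore
   coincide, against [D <> D']. *)
case: verd neqDD' => [inM []|verd _]; last first.
  exact (verdict_types w2 uA GammaA A_neq0 uM' fPhi verd).
have [N Nc NE] := in_conics_component w2 fPhi uM' inM.
by apply: component_eq; rewrite (componentE w2 uA GammaA A_neq0 fPhi); exists N; [exact: Nc|exact: NE].
Qed.
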